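(* Let $\Sigma$ be a topological graph in $\mathbb{R}^3$ with smooth edges, let $P_\Sigma$ be its set of non-smooth points, and let $\rho(\mathbf{x})=\inf_{\mathbf{y}\in\Sigma}|\mathbf{x}-\mathbf{y}|$ be the distance function to $\Sigma$. Define $$\frac{\delta(\rho)}{2\pi\rho}:=\lim_{\epsilon\to0}\frac{\chi_\epsilon\cdot\delta(\rho)}{2\pi\rho}$$ as a weak limit, where $\chi_\epsilon$ is the characteristic function of $\mathbb{R}^3\setminus U_\epsilon$ and $(U_\epsilon)_{\epsilon>0}$ is an admissible family of neighbourhoods of $P_\Sigma$ shrinking to $P_\Sigma$ as $\epsilon\to0$. Then this definition is independent of the choices made (the limit exists and is the same for every admissible family), and $$\delta_\Sigma(\mathbf{x})=\frac{\delta(\rho)}{2\pi\rho},$$ that is, for every $f\in C_c^\infty(\mathbb{R}^3)$, $$\lim_{\epsilon\to0}\int_{\mathbb{R}^3}\frac{\chi_\epsilon\cdot\delta(\rho)}{2\pi\rho}\,f(\mathbf{x})\,d\mathbf{x}=\int_\Sigma f(\mathbf{x}(s))\,ds .$$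
   Context: Topological graph with smooth edges: a closed subset $\Sigma\subset\mathbb{R}^3$ that is a union of finitely or countably many vertices and edges. Each edge is a smooth regular curve, smooth up to its endpoints (if any), the endpoints being vertices and the interior being simple (no self-intersection); closed smooth loops without vertices and edges of infinite length are allowed. Interiors of distinct edges are disjoint from each other and from the vertices, there are finitely many edges between any two vertices, and there is no local accumulation: every compact subset of $\mathbb{R}^3$ meets only finitely many edges and vertices. Thus $\Sigma$ may be open or closed as a curve, may have corners and self-intersections (these being vertices), and may be disconnected. $P_\Sigma=\{\mathbf{p}_j\}_{j\in\Gamma}$ is the (finite or countable, locally finite) set of points of $\Sigma$ near which $\Sigma$ is not a one-dimensional smooth embedded submanifold without boundary. $\int_\Sigma\,\cdot\,ds$ is the integral with respect to arc length over all edges. $\delta_\Sigma$ is the distribution with $\int_{\mathbb{R}^3}\delta_\Sigma f\,d\mathbf{x}=\int_\Sigma f(\mathbf{x}(s))\,ds$ for $f\in C_c^\infty(\mathbb{R}^3)$. Admissible family: for each small $\epsilon>0$, $U_\epsilon$ is a union of pairwise disjoint bounded open neighbourhoods, one around each $\mathbf{p}_j$, contained in the $\epsilon$-neighbourhood of $P_\Sigma$, whose boundary is near each point of $\Sigma\cap\partial U_\epsilon$ a smooth surface perpendicular to $\Sigma$ at that point. Convention: $\int_0^\infty\delta(t)g(t)\,dt=g(0)$. Meaning of $\int_{\mathbb{R}^3}\frac{\chi_\epsilon\,\delta(\rho)}{2\pi\rho}f\,d\mathbf{x}$: for a compact arc $\Sigma_i=\{\mathbf{x}(s):s\in[a_i,b_i]\}\subset\Sigma\setminus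 P_\Sigma$ parametrized by arc length, choose smooth unit fields $U,V$ along it such that $(U,V,\frac{\partial}{\partial s})$ is a right-handed orthonormal frame, and $\epsilon_i>0$ small so that $\mathbf{x}(\rho,\theta,s)=\mathbf{x}(s)+\rho\cos\theta\,U(s)+\rho\sin\theta\,V(s)$, $0\le\rho<\epsilon_i$, $\theta\in[0,2\pi)$, $s\in[a_i,b_i]$, are (polar-type) coordinates on the tube of normal discs of radius $\epsilon_i$, on which $\rho$ equals the distance to $\Sigma$; let $J_i=\det\frac{\partial(x,y,z)}{\partial(\rho,\theta,s)}$, which is smooth and vanishes at $\rho=0$. Choose finitely many such arcs and functions $h_i\in C_c^\infty(\mathbb{R}^3)$ with $\operatorname{supp}h_i\cap\Sigma\subset\Sigma_i$ and $\sum_ih_i=1$ on a neighbourhood of $(\Sigma\setminus U_\epsilon)\cap\operatorname{supp}f$. Then $$\int_{\mathbb{R}^3}\frac{\chi_\epsilon\,\delta(\rho)}{2\pi\rho}f\,d\mathbf{x}=\sum_i\int_{a_i}^{b_i}\int_0^{2\pi}\left[\int_0^{\epsilon_i}\delta(\rho)\,\frac{(\chi_\epsilon f h_i)(\mathbf{x}(\rho,\theta,s))\,J_i(\rho,\theta,s)}{2\pi\rho}\,d\rho\right]d\theta\,ds,$$ the inner integral being the limit as $\rho\to0^+$ of $\frac{\chi_\epsilon f h_iJ_i}{2\pi\rho}$ (defined for all $s$ except the finitely many with $\mathbf{x}(s)\in\partial U_\epsilon$). Weak limit means convergence of these integrals for each $f\in C_c^\infty(\mathbb{R}^3)$. *)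

(* Defs.v *)
(* The library norm on R^3 = 'rV[R]_3 is the sup norm, so the Euclidean norm is
   [enorm] below; open, closed, compact and bounded sets are the same for both
   norms. *)
From mathcomp Require Export all_boot all_order all_algebra.
From mathcomp Require Export all_classical all_reals all_analysis.
Export Order.TTheory GRing.Theory Num.Theory.
Export numFieldNormedType.Exports.

Set Implicit Arguments.
Unset Strict Implicit.
Unset Printing Implicit Defensive.

Global Open Scope classical_set_scope.
Global Open Scope ring_scope.

Section Euclidean.
Context {R : realType}.
Local Notation E3 := 'rV[R]_3.

Definition dot (u v : E3) : R := \sum_(i < 3) u 0 i * v 0 i.

Definition enorm (u : E3) : R := Num.sqrt (dot u u).

Definition rho (Sigma : set E3) (x : E3) : R :=
  inf [set enorm (x - y) | y in Sigma].

Definition eps_nbhd (P : set E3) (e : R) : set E3 :=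
  [set x | exists2 p, P p & enorm (x - p) < e].

Definition cols3 (u v w : E3) : 'M[R]_3 :=
  \matrix_(i, j) [:: u; v; w]`_j 0 i.

Definition right_handed_orthonormal (u v w : E3) : Prop :=
  [/\ dot u u = 1, dot v v = 1, dot w w = 1,
      [/\ dot u v = 0, dot v w = 0 & dot w u = 0] & 0 < \det (cols3 u v w)].

End Euclidean.

Section Smoothness.
Context {R : realType}.
Local Notation E3 := 'rV[R]_3.

(* C^oo on an arbitrary A (for instance a closed interval): c is C^oo on an
   open neighbourhood of A, hence smooth up to the endpoints. *)
Definition smooth_curve_on (A : set R) (c : R -> E3) : Prop :=
  forall t, A t -> \forall u \near t, forall n, derivable (derive1n n c) u 1.

Definition pder (i : 'I_3) (f : E3 -> R) : E3 -> R :=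
  fun x => 'D_(delta_mx 0 i) f x.

(* Differentiability of every iterated partial derivative gives existence and
   continuity of the partial derivatives of all orders. *)
Definition smooth_fun_on (A : set E3) (f : E3 -> R) : Prop :=
  forall x, A x -> \forall y \near x,
    forall s : seq 'I_3, differentiable (foldr pder f s) y.

Definition gradient (f : E3 -> R) (x : E3) : E3 := \row_i pder i f x.

Definition supp (f : E3 -> R) : set E3 := closure [set x | f x != 0].

Definition test_function (f : E3 -> R) : Prop :=
  smooth_fun_on setT f /\ compact (supp f).

End Smoothness.

Section TopologicalGraph.
Context {R : realType}.
Local Notation E3 := 'rV[R]_3.

(* Parameter domain of an edge: [a, b] for an edge with two (possibly equal)
   endpoints, [a, +oo[ for an infinite edge with one endpoint, R for an
   infinite edge with no endpoint, and one period [a, b] of a closed loop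
   without vertices. *)
Inductive edge_kind := Segment of R & R | Ray of R | Line | Loop of R & R.

Record edge := Edge { ekind : edge_kind; ecurve :> R -> E3 }.

Definition edom (e : edge) : set R :=
  match ekind e with
  | Segment a b => `[a, b]
  | Ray a => `[a, +oo[
  | Line => setT
  | Loop a b => `[a, b]
  end.

(* For a loop there is no endpoint: the "interior" is the whole loop, each of
   its points being counted once. *)
Definition eint (e : edge) : set R :=
  match ekind e with
  | Segment a b => `]a, b[
  | Ray a => `]a, +oo[
  | Line => setT
  | Loop a b => `[a, b[
  end.

Definition eends (e : edge) : set E3 :=
  match ekind e with
  | Segment a b => [set e a; e b]
  | Ray a => [set e a]
  | Line => set0
  | Loop _ _ => set0
  end.

Definition kind_ok (e : edge) : Prop :=
  match ekind e with
  | Segment a b => a < b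
  | Loop a b => a < b /\ forall t, e (t + (b - a)) = e t
  | _ => True
  end.

(* The last clause says that the parametrization is proper.  It is automatic
   for segments and loops; for rays and lines it says that the edge does not
   accumulate on itself or elsewhere in R^3, but goes off to infinity. *)
Definition smooth_edge (e : edge) : Prop :=
  [/\ kind_ok e,
      smooth_curve_on (edom e) e,
      forall t, edom e t -> derive1 e t != 0,
      {in eint e &, injective e}
    & forall K : set E3, compact K -> compact (edom e `&` e @^-1` K)].

Definition graph_set (V : set E3) (I : set nat) (e : nat -> edge) : set E3 :=
  V `|` \bigcup_(i in I) (e i @` edom (e i)).

Record topological_graph := TopologicalGraph {
  vertices : set E3 ;
  edges : set nat ;
  edge_of : nat -> edge ;
  graph_closed : closed (graph_set vertices edges edge_of) ;
  edges_smooth : forall i, edges i -> smooth_edge (edge_of i) ;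
  ends_vertices : forall i, edges i -> eends (edge_of i) `<=` vertices ;
  interiors_vertices : forall i, edges i ->
    (edge_of i @` eint (edge_of i)) `&` vertices = set0 ;
  interiors_disjoint :
    trivIset edges (fun i => edge_of i @` eint (edge_of i)) ;
  finite_between : forall u v, vertices u -> vertices v ->
    finite_set [set i | edges i /\ eends (edge_of i) = [set u; v]] ;
  locally_finite : forall K : set E3, compact K ->
    finite_set (vertices `&` K) /\
    finite_set [set i | edges i /\
                        (edge_of i @` edom (edge_of i)) `&` K !=set0] }.

Definition Sigma_of (G : topological_graph) : set E3 :=
  graph_set (vertices G) (edges G) (edge_of G).

(* The integral over Sigma with respect to arc length (ds = |e'(t)| dt), that
   is, the distribution delta_Sigma applied to f.  For f of compact support
   only finitely many terms of the sum are nonzero. *)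
Definition delta_Sigma (G : topological_graph) (f : E3 -> R) : R :=
  \sum_(i \in edges G)
    \int[lebesgue_measure]_(t in edom (edge_of G i))
      (f (edge_of G i t) * enorm (derive1 (edge_of G i) t)).

End TopologicalGraph.
Arguments edge : clear implicits.
Arguments edge_kind : clear implicits.
Arguments topological_graph : clear implicits.

Section NonSmoothPoints.
Context {R : realType}.
Local Notation E3 := 'rV[R]_3.

(* Near p, S is a one-dimensional smooth embedded submanifold without
   boundary: it has a local regular parametrization c that is a homeomorphism
   onto a relatively open part of S, with continuous inverse tau. *)
Definition smooth_point (S : set E3) (p : E3) : Prop :=
  exists (W : set E3) (r : R) (c : R -> E3) (tau : E3 -> R),
    [/\ open W /\ 0 < r,
        smooth_curve_on `]- r, r[ c /\
          (forall t : R, - r < t < r -> derive1 c t != 0),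
        c 0 = p,
        c @` `]- r, r[ = S `&` W
      & {within S `&` W, continuous tau} /\
        (forall t : R, - r < t < r -> tau (c t) = t)].

Definition P_Sigma (S : set E3) : set E3 := [set p | S p /\ ~ smooth_point S p].

Definition tangent_vector (S : set E3) (p v : E3) : Prop :=
  exists c : R -> E3,
    [/\ smooth_curve_on [set 0] c, c 0 = p,
        (\forall t \near (0 : R), S (c t)) & derive1 c 0 = v].

(* Near p, B is a smooth surface (a regular level set of g) whose normal line
   at p contains the tangent vectors of S at p. *)
Definition perpendicular_surface_at (S B : set E3) (p : E3) : Prop :=
  exists (W : set E3) (g : E3 -> R),
    [/\ open W /\ W p,
        smooth_fun_on W g,
        forall x, W x -> gradient g x != 0,
        B `&` W = [set x | W x /\ g x = 0]
      & forall v, tangent_vector S p v -> exists k, v = k *: gradient g p].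

Definition boundary (A : set E3) : set E3 := closure A `\` interior A.

Definition admissible_nbhd (S : set E3) (e : R) (U : set E3) : Prop :=
  [/\ exists N : E3 -> set E3,
        [/\ forall p, P_Sigma S p ->
              [/\ open (N p), bounded_set (N p) & N p p],
            trivIset (P_Sigma S) N
          & U = \bigcup_(p in P_Sigma S) N p],
      U `<=` eps_nbhd (P_Sigma S) e
    & forall p, S p -> boundary U p ->
        perpendicular_surface_at S (boundary U) p].

Definition admissible_family (S : set E3) (U : R -> set E3) : Prop :=
  \forall e \near 0^'+, admissible_nbhd S e (U e).

End NonSmoothPoints.

Section DeltaOfDistance.
Context {R : realType}.
Local Notation E3 := 'rV[R]_3.

Record tube := Tube {
  tlo : R ; thi : R ;
  tarc : R -> E3 ;
  tfu : R -> E3 ; tfv : R -> E3 ;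
  trad : R }.

Definition tube_map (T : tube) (r th s : R) : E3 :=
  tarc T s + (r * cos th) *: tfu T s + (r * sin th) *: tfv T s.

Definition tube_jac (T : tube) (r th s : R) : R :=
  \det (cols3 (derive1 (fun r' => tube_map T r' th s) r)
              (derive1 (fun th' => tube_map T r th' s) th)
              (derive1 (fun s' => tube_map T r th s') s)).

Definition tube_base (T : tube) : set E3 := tarc T @` `[tlo T, thi T].

(* A compact arc of S \ P_Sigma S parametrized by arc length, a smooth frame
   along it, and a radius for which (r, th, s) are polar-type coordinates. *)
Definition tube_ok (S : set E3) (T : tube) : Prop :=
  [/\ tlo T < thi T /\ 0 < trad T,
      [/\ smooth_curve_on `[tlo T, thi T] (tarc T),
          forall s : R, tlo T <= s <= thi T -> enorm (derive1 (tarc T) s) = 1,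
          {in `[tlo T, thi T] &, injective (tarc T)}
        & tube_base T `<=` S `\` P_Sigma S],
      [/\ smooth_curve_on `[tlo T, thi T] (tfu T),
          smooth_curve_on `[tlo T, thi T] (tfv T)
        & forall s : R, tlo T <= s <= thi T ->
            right_handed_orthonormal (tfu T s) (tfv T s) (derive1 (tarc T) s)],
      (forall r th s r' th' s' : R,
          0 < r < trad T -> 0 <= th < 2 * pi -> tlo T <= s <= thi T ->
          0 < r' < trad T -> 0 <= th' < 2 * pi -> tlo T <= s' <= thi T ->
          tube_map T r th s = tube_map T r' th' s' ->
          [/\ r = r', th = th' & s = s']) /\
      (forall r th s : R, 0 < r < trad T -> 0 <= th < 2 * pi ->
          tlo T <= s <= thi T -> tube_jac T r th s != 0)
    & forall r th s : R, 0 <= r < trad T -> 0 <= th < 2 * pi ->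
        tlo T <= s <= thi T -> rho S (tube_map T r th s) = r].

(* The convention that the integral of delta(t) g(t) over t >= 0 is g(0), read
   as a right limit since the integrand below is undefined at r = 0. *)
Definition delta_at0 (g : R -> R) : R := lim (g r @[r --> 0^'+]).

(* The integral of chi delta(rho) / (2 pi rho) f h over a tube, chi being the
   characteristic function of the complement of U.  The right limit in
   [delta_at0] may fail to exist for the finitely many s with
   tarc T s \in boundary U. *)
Definition tube_integral (U : set E3) (f h : E3 -> R) (T : tube) : R :=
  \int[lebesgue_measure]_(s in `[tlo T, thi T])
    \int[lebesgue_measure]_(th in `[0, 2 * pi])
      delta_at0 (fun r =>
        let x := tube_map T r th s in
        \1_(~` U) x * f x * h x * tube_jac T r th s / (2 * pi * r)).

Definition chi_delta_value (S U : set E3) (f : E3 -> R) (v : R) : Prop :=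
  exists (n : nat) (T : 'I_n -> tube) (h : 'I_n -> E3 -> R),
    [/\ forall i, tube_ok S (T i),
        forall i, test_function (h i),
        forall i, supp (h i) `&` S `<=` tube_base (T i),
        forall x, ((S `\` U) `&` supp f) x ->
          \forall y \near x, \sum_(i < n) h i y = 1
      & v = \sum_(i < n) tube_integral U f (h i) (T i)].

(* The integral of chi delta(rho) / (2 pi rho) f over R^3, chi being the
   characteristic function of the complement of U. *)
Definition chi_delta (S U : set E3) (f : E3 -> R) : R :=
  xget 0 [set v | chi_delta_value S U f v].

End DeltaOfDistance.

(* Main.v *)
(* Let $\chi$ be the characteristic function of the complement of $U$.  On a tube with
   framed arc $(x,u,v)$ the Jacobian is $J = \rho (1 + O(\rho))$, hence
   $J / (2 \pi \rho)$ tends to $1 / (2 \pi)$ and the integral over the tube is the arc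
   length integral of $\chi f h$ over its arc.  Near all but finitely many of its points
   the arc is a reparametrization of an edge, so that this integral equals
   $\sum_j \int \chi f h |e_j'|$, and summing over the partition of unity gives
   $\sum_j \int \chi f |e_j'|$ whatever the tubes and the $h_i$.  Tubes and $h_i$ exist
   because the smooth points of $\Sigma$ have tubular neighbourhoods and
   $(\Sigma \setminus U) \cap \mathrm{supp} f$ is compact.  Finally every interior point
   of an edge is smooth, hence outside $U_\epsilon$ for small $\epsilon$, and dominated
   convergence gives the limit. *)
Require Import Defs.
From mathcomp Require Import measurable_realfun ring lra.

Set Implicit Arguments.
Unset Strict Implicit.
Unset Printing Implicit Defensive.

(** * Functions of one variable *)

(** The obstacle is that an arc and the edges need not match globally: an arc of smooth points may
    run through a vertex where edges join smoothly, or through the base point of a loop, and so be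
    covered by several edges, each in either direction. No single change of variables applies.
    Instead the function [Phi] of the right end [b] of the arc compares the integral over the part
    of the edges already swept with the integral over the arc up to [b]. It is continuous, has zero
    derivative off finitely many [b], and vanishes at the left end, so it vanishes at the right end
    too.

    Perpendicularity of the boundary of $U$ makes the exceptional set finite: a defining function of
    the boundary has nonzero derivative along the arc at each crossing, so crossings are isolated,
    and a compact arc has finitely many. This also confines to finitely many [s] the places where
    the inner limit may fail to exist.

    Since every admissible choice of tubes and of $h_i$ yields the same sum over edges, existence of
    one choice makes [chi_delta] equal to that sum, and the limit becomes a statement about edges
    alone. *)

Section OneVariable.
Context {R : realType}.
Implicit Types (f g : R -> R) (O : set R).

(** [Ck k] provides [k + 1] successive derivatives. They are witnesses rather than values of
    [derive1n], so that the rules for products and compositions go by induction on [k] without a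
    formula for higher derivatives. *)
Fixpoint Ck (k : nat) O f : Prop :=
  match k with
  | 0%N => forall u, O u -> derivable f u 1
  | k.+1 => exists2 f', forall u, O u -> is_derive u 1 f (f' u) & Ck k O f'
  end.

Definition smooth_on O f := forall k, Ck k O f.

Lemma CkW k O f : Ck k.+1 O f -> Ck k O f.
Proof.
elim: k f => [|k IH] f /= [f' ff' Cf']; first by move=> u /ff' [].
by exists f' => //; exact: IH.
Qed.

Lemma Ck_derivable k O f u : Ck k O f -> O u -> derivable f u 1.
Proof. by case: k => [|k] /=; [exact | move=> [f' ff' _] /ff' []]. Qed.

Lemma Ck_sub k O O' f : O' `<=` O -> Ck k O f -> Ck k O' f.
Proof.
move=> O'O; elim: k f => [|k IH] f /= => [h u /O'O /h //|[f' ff' Cf']].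
by exists f' => [u /O'O /ff' //|]; exact: IH.
Qed.

Lemma eq_derive1n O f g n u : open O -> {in O, f =1 g} -> O u ->
  derive1n n f u = derive1n n g u.
Proof.
move=> oO fg; elim: n u => [|n IH] u Ou; first by apply: fg; rewrite inE.
rewrite !derive1nS !derive1E; apply: near_eq_derive.
by have := open_nbhs_nbhs (conj oO Ou); apply: filterS => v; exact: IH.
Qed.

Lemma smooth_onP O f : open O ->
  smooth_on O f <-> (forall n u, O u -> derivable (derive1n n f) u 1).
Proof.
move=> oO; split=> [sf n|].
  have := sf n; elim: n {sf} f => [|n IH] f; first exact.
  move=> [f' ff' Cf'] u Ou; apply: (near_eq_derivable (f := derive1n n f')); last first.
    exact: IH.
  have := open_nbhs_nbhs (conj oO Ou); apply: filterS => v Ov.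
  rewrite derive1Sn; apply: eq_derive1n oO _ Ov => w; rewrite inE => Ow.
  by rewrite derive1E; case: (ff' w Ow).
move=> h k; elim: k f h => [|k IH] f h; first exact: (h 0%N).
exists (derive1 f) => [u Ou|].
  by have := h 0%N u Ou; rewrite derive1E => /derivableP.
by apply: IH => n u Ou; rewrite -derive1Sn; exact: h.
Qed.

Lemma smooth_on_derive O f : open O -> smooth_on O f -> smooth_on O (derive1 f).
Proof.
move=> oO /(smooth_onP _ oO) h; apply/(smooth_onP _ oO) => n u Ou.
by rewrite -derive1Sn; exact: h.
Qed.

Lemma Ck_cst k O (c : R) : Ck k O (cst c).
Proof.
elim: k c => [|k IH] c /=; first by move=> u _; exact: derivable_cst.
by exists (cst 0) => // u _; exact: is_derive_cst.
Qed.

Lemma Ck_id k O : Ck k O id.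
Proof.
case: k => [|k] /=; first by move=> u _; exact: derivable_id.
exists (cst 1) => [u _|]; [exact: is_derive_id|exact: Ck_cst].
Qed.

Lemma CkD k O f g : Ck k O f -> Ck k O g -> Ck k O (fun x => f x + g x).
Proof.
elim: k f g => [|k IH] f g /=.
  by move=> hf hg u Ou; apply: derivableD; [exact: hf|exact: hg].
move=> [f' ff' Cf'] [g' gg' Cg']; exists (fun x => f' x + g' x); last exact: IH.
by move=> u Ou; apply: is_deriveD; [exact: ff'|exact: gg'].
Qed.

Lemma CkM k O f g : Ck k O f -> Ck k O g -> Ck k O (fun x => f x * g x).
Proof.
elim: k f g => [|k IH] f g.
  by move=> hf hg u Ou; apply: derivableM; [exact: hf|exact: hg].
move=> Cf Cg; have [f' ff' Cf'] := Cf; have [g' gg' Cg'] := Cg.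
exists (fun x => f x * g' x + g x * f' x); last first.
  by apply: CkD; apply: IH => //; exact: CkW.
by move=> u Ou; have := ff' u Ou; have := gg' u Ou => ? ?; exact: is_deriveM.
Qed.

Lemma CkN k O f : Ck k O f -> Ck k O (fun x => - f x).
Proof.
move=> Cf; have := CkM (Ck_cst k O (- 1)) Cf; congr Ck.
by apply/funext => x; rewrite /cst mulN1r.
Qed.

Lemma CkB k O f g : Ck k O f -> Ck k O g -> Ck k O (fun x => f x - g x).
Proof. by move=> Cf /CkN; exact: CkD. Qed.

(** The derivative [f' (g x) * g' x] contains [g] itself, which is why [CkW] must lower the order of
    [g] before the induction hypothesis applies. *)
Lemma Ck_comp k O O' f g : (forall u, O u -> O' (g u)) ->
  Ck k O' f -> Ck k O g -> Ck k O (fun x => f (g x)).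
Proof.
move=> gO; elim: k f g gO => [|k IH] f g gO.
  move=> hf hg u Ou; apply/derivable1_diffP.
  by apply: differentiable_comp; apply/derivable1_diffP; [exact: hg|exact/hf/gO].
move=> Cf Cg; have [f' ff' Cf'] := Cf; have [g' gg' Cg'] := Cg.
exists (fun x => f' (g x) * g' x); last first.
  by apply: CkM => //; apply: IH => //; exact: CkW.
move=> u Ou; have h1 := gg' u Ou; have h2 := ff' _ (gO u Ou).
exact: is_derive1_comp.
Qed.

Lemma CkV_id k : Ck k [set x : R | x != 0] (fun x => x^-1).
Proof.
elim: k => [|k IH]; first by move=> u /= u0; apply: derivableV.
exists (fun x => - (x^-1 * x^-1)); last by apply: CkN; exact: CkM.
move=> u /= u0; have := is_deriveV (f := id) (x := u) (v := 1) (t := 1) u0 _.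
move=> /(_ (is_derive_id _ _)) h.
by apply: is_derive_eq; rewrite scaler1 -exprVn expr2.
Qed.

Lemma CkV k O f : (forall u, O u -> f u != 0) -> Ck k O f ->
  Ck k O (fun x => (f x)^-1).
Proof. by move=> f0; exact: (Ck_comp (O' := [set x | x != 0])) (CkV_id k). Qed.

Lemma Ck_sqrt k O f : (forall u, O u -> 0 < f u) -> Ck k O f ->
  Ck k O (fun x => Num.sqrt (f x)).
Proof.
move=> f0; apply: (Ck_comp (O' := [set x | 0 < x])) => // {f f0}.
elim: k => [|k IH]; first by move=> u /= u0; have [] := is_derive1_sqrt u0.
exists (fun x => (2 * Num.sqrt x)^-1); first by move=> u; exact: is_derive1_sqrt.
apply: CkV => [u u0|]; first by rewrite mulf_neq0// gt_eqF ?sqrtr_gt0.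
by apply: CkM => //; exact: Ck_cst.
Qed.

(** Bootstrap: the right side of [psi' = 1 / m' (psi)] is as regular as [psi], so each step gains
    one derivative. *)
Lemma Ck_inverse k O O' (m psi : R -> R) :
  (forall u, O u -> O' (psi u)) -> smooth_on O' m -> open O' ->
  (forall t, O' t -> derive1 m t != 0) ->
  (forall u, O u -> is_derive u 1 psi (derive1 m (psi u))^-1) ->
  Ck k O psi.
Proof.
move=> psiO sm oO' m0 dpsi; elim: k => [|k IH]; first by move=> u /dpsi [].
exists (fun u => (derive1 m (psi u))^-1) => //; apply: CkV => [u /psiO /m0 //|].
by apply: (Ck_comp (O' := O')) => //; exact: smooth_on_derive.
Qed.

Lemma open_itvoo (a b : R) : open [set t : R | a < t < b].
Proof.
rewrite (_ : [set t | _] = [set` `]a, b[]); first exact: itv_open.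
by apply/funext => t /=; rewrite in_itv.
Qed.

Lemma near_itvoo (a b t : R) : a < t < b -> \forall s \near t, a < s < b.
Proof.
move=> tab; have := open_nbhs_nbhs (conj (@open_itvoo a b) tab).
by apply: filterS.
Qed.

Lemma increasing_local_inverse (m : R -> R) (a b : R) : a < b ->
  (forall t, a < t < b -> derivable m t 1) ->
  (forall t, a < t < b -> 0 < derive1 m t) ->
  {in `]a, b[ &, {homo m : x y / x < y}} /\
  exists psi : R -> R,
    (forall t, a < t < b -> psi (m t) = t) /\
    (forall t, a < t < b -> is_derive (m t) 1 psi (derive1 m t)^-1).
Proof.
move=> ab dm m0.
have cm : {in `]a, b[, continuous m}.
  move=> t /=; rewrite in_itv /= => tab.
  exact/differentiable_continuous/derivable1_diffP/dm.
have inc : {in `]a, b[ &, {homo m : x y / x < y}}.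
  apply: gtr0_derive1_lt_oo => [t tab|t tab|]; last by move=> t; rewrite inE => ?; exact: cm.
    by apply: dm; move: tab; rewrite in_itv.
  by apply: m0; move: tab; rewrite in_itv.
split=> //.
(* The default [a] is only taken off the image of [m], where nothing is claimed. *)
pose psi y := xget a [set t | a < t < b /\ m t = y].
have psiK t : a < t < b -> psi (m t) = t.
  move=> tab; rewrite /psi; case: xgetP => [s _ [sab mst]|/(_ t)]; last first.
    by move=> /not_andP [].
  case: (ltgtP s t) => // st.
    by have := inc s t; rewrite !in_itv /= sab tab mst ltxx => /(_ isT isT st).
  by have := inc t s; rewrite !in_itv /= sab tab mst ltxx => /(_ isT isT st).
exists psi; split=> // t tab.
have tnear : \forall s \near t, a < s < b.
  exact: near_itvoo.
apply: is_derive_inverse; last by rewrite gt_eqF// m0.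
- by apply: filterS tnear => s; exact: psiK.
- apply: filterS tnear => s sab; apply: cm; by rewrite in_itv.
- by have := dm t tab; rewrite derive1E => /derivableP.
Qed.

Lemma continuous_derivable (f : R -> R) u : derivable f u 1 -> {for u, continuous f}.
Proof. by move=> /derivable1_diffP/differentiable_continuous. Qed.

Lemma nbhs_itvP (u : R) (P : R -> Prop) : (\forall v \near u, P v) ->
  exists2 d, 0 < d & forall v, u - d < v < u + d -> P v.
Proof.
move=> [d /= d0 h]; exists d => // v vud; apply: h => /=.
by rewrite ltr_norml; lra.
Qed.

Lemma itv_nbhs (u d : R) (P : R -> Prop) : 0 < d ->
  (forall v, u - d < v < u + d -> P v) -> \forall v \near u, P v.
Proof.
move=> d0 h; exists d => //= v /=; rewrite ltr_norml => /andP[h1 h2]; apply: h.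
by lra.
Qed.

Lemma MVT_near (f f' : R -> R) (a b : R) :
  (forall t, a < t < b -> is_derive t 1 f (f' t)) ->
  forall s t, a < s < b -> a < t < b ->
  exists2 c, a < c < b /\ `|c - s| <= `|t - s| & f t - f s = f' c * (t - s).
Proof.
move=> df; have key s t : s <= t -> a < s < b -> a < t < b ->
  exists2 c, s <= c <= t & f t - f s = f' c * (t - s).
  move=> st sab tab.
  have ds x : s <= x <= t -> is_derive x 1 f (f' x) by move=> h; apply: df; lra.
  have [||c] := @MVT_segment R f f' s t st.
  - by move=> x; rewrite in_itv /= => h; apply: ds; lra.
  - apply: continuous_in_subspaceT => x; rewrite inE /= in_itv /= => /ds [h _].
    exact: continuous_derivable.
  - by rewrite in_itv /=; exists c.
move=> s t sab tab; case: (leP s t) => st.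
  have [c cst e] := key s t st sab tab; exists c => //; split; first by lra.
  by rewrite !ger0_norm; lra.
have [c cst e] := key t s (ltW st) tab sab; exists c.
  by split; [lra|rewrite !ler0_norm; lra].
by rewrite -opprB e -mulrN opprB.
Qed.

End OneVariable.

(** * Vectors and curves *)

Section Vectors.
Context {R : realType}.
Local Notation E3 := 'rV[R]_3.
Implicit Types (u v w : E3) (a b c : R).

Definition o0 : 'I_3 := @Ordinal 3 0 isT.
Definition o1 : 'I_3 := @Ordinal 3 1 isT.
Definition o2 : 'I_3 := @Ordinal 3 2 isT.

Lemma forall_ord3 (P : 'I_3 -> Prop) : P o0 -> P o1 -> P o2 -> forall i, P i.
Proof.
move=> h0 h1 h2 [[|[|[|//]]] hi].
- by rewrite (_ : Ordinal hi = o0)//; exact: val_inj.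
- by rewrite (_ : Ordinal hi = o1)//; exact: val_inj.
- by rewrite (_ : Ordinal hi = o2)//; exact: val_inj.
Qed.

Lemma sum_ord3 (F : 'I_3 -> R) : \sum_i F i = F o0 + F o1 + F o2.
Proof.
rewrite !big_ord_recl big_ord0 addr0 addrA; congr (F _ + F _ + F _); exact: val_inj.
Qed.

Lemma dotE u v : dot u v = u 0 o0 * v 0 o0 + u 0 o1 * v 0 o1 + u 0 o2 * v 0 o2.
Proof. exact: sum_ord3. Qed.

Definition vec a b c : E3 := \row_i [:: a; b; c]`_i.

Lemma vecE a b c :
  (vec a b c 0 o0 = a) * (vec a b c 0 o1 = b) * (vec a b c 0 o2 = c).
Proof. by rewrite !mxE. Qed.

Lemma vecP u v : u 0 o0 = v 0 o0 -> u 0 o1 = v 0 o1 -> u 0 o2 = v 0 o2 -> u = v.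
Proof. by move=> h0 h1 h2; apply/rowP; exact: forall_ord3. Qed.

Definition cross u v : E3 :=
  vec (u 0 o1 * v 0 o2 - u 0 o2 * v 0 o1)
      (u 0 o2 * v 0 o0 - u 0 o0 * v 0 o2)
      (u 0 o0 * v 0 o1 - u 0 o1 * v 0 o0).

Lemma dotC u v : dot u v = dot v u.
Proof. by rewrite !dotE; ring. Qed.

Lemma dotDl u v w : dot (u + v) w = dot u w + dot v w.
Proof. by rewrite !dotE !mxE; ring. Qed.

Lemma dotDr u v w : dot w (u + v) = dot w u + dot w v.
Proof. by rewrite !dotE !mxE; ring. Qed.

Lemma dotZl a u v : dot (a *: u) v = a * dot u v.
Proof. by rewrite !dotE !mxE; ring. Qed.

Lemma dotZr a u v : dot v (a *: u) = a * dot v u.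
Proof. by rewrite !dotE !mxE; ring. Qed.

Lemma dotNl u v : dot (- u) v = - dot u v.
Proof. by rewrite !dotE !mxE; ring. Qed.

Lemma dotNr u v : dot u (- v) = - dot u v.
Proof. by rewrite !dotE !mxE; ring. Qed.

Lemma dot_ge0 u : 0 <= dot u u.
Proof. by rewrite dotE !addr_ge0 // -expr2 sqr_ge0. Qed.

Lemma dot_eq0 u : dot u u = 0 -> u = 0.
Proof.
rewrite dotE => h; apply: vecP; rewrite mxE; nra.
Qed.

Lemma dot_gt0 u : u != 0 -> 0 < dot u u.
Proof.
move=> u0; rewrite lt0r dot_ge0 andbT; apply: contra u0 => /eqP/dot_eq0 ->//.
Qed.

Lemma cauchy_schwarz u v : dot u v ^+ 2 <= dot u u * dot v v.
Proof.
rewrite -subr_ge0 (_ : _ - _ = dot (cross u v) (cross u v)) ?dot_ge0//.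
by rewrite !dotE !vecE; ring.
Qed.

Lemma enorm_ge0 u : 0 <= enorm u.
Proof. exact: sqrtr_ge0. Qed.

Lemma enorm_sqr u : enorm u ^+ 2 = dot u u.
Proof. by rewrite sqr_sqrtr ?dot_ge0. Qed.

Lemma enorm_gt0 u : u != 0 -> 0 < enorm u.
Proof. by move=> u0; rewrite sqrtr_gt0 dot_gt0. Qed.

Lemma enormZ a u : enorm (a *: u) = `|a| * enorm u.
Proof.
by rewrite /enorm dotZl dotZr mulrA -expr2 sqrtrM ?sqr_ge0// sqrtr_sqr.
Qed.

Lemma enormN u : enorm (- u) = enorm u.
Proof. by rewrite -scaleN1r enormZ normrN1 mul1r. Qed.

Lemma dot_le_enorm u v : `|dot u v| <= enorm u * enorm v.
Proof.
rewrite -(@ler_pXn2r _ 2) ?nnegrE ?mulr_ge0 ?enorm_ge0 ?normr_ge0//.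
by rewrite exprMn !enorm_sqr real_normK ?num_real// cauchy_schwarz.
Qed.

Lemma enormD u v : enorm (u + v) <= enorm u + enorm v.
Proof.
rewrite -(@ler_pXn2r _ 2) ?nnegrE ?addr_ge0 ?enorm_ge0//.
rewrite enorm_sqr sqrrD !enorm_sqr dotDl !dotDr (dotC v u).
have := ler_norm (dot u v); have := dot_le_enorm u v.
set p := enorm u * _; lra.
Qed.

Lemma coord_le_enorm u i : `|u 0 i| <= enorm u.
Proof.
rewrite -(@ler_pXn2r _ 2) ?nnegrE ?enorm_ge0 ?normr_ge0//.
rewrite enorm_sqr real_normK ?num_real// dotE.
by move: i; apply: forall_ord3; nra.
Qed.

Lemma enorm_le_coord u M : (forall i, `|u 0 i| <= M) -> enorm u <= 3 * M.
Proof.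
move=> h; have M0 : 0 <= M := le_trans (normr_ge0 _) (h o0).
rewrite -(@ler_pXn2r _ 2) ?nnegrE ?enorm_ge0 ?mulr_ge0//.
rewrite enorm_sqr dotE.
have sq i : u 0 i * u 0 i <= M * M.
  have := h i; rewrite ler_norml => /andP[h1 h2]; nra.
have := sq o0; have := sq o1; have := sq o2; nra.
Qed.

Lemma ball_coordP (x y : E3) (e : R) : 0 < e ->
  ball x e y <-> (forall i, `|x 0 i - y 0 i| < e).
Proof.
move=> e0; split=> [h i|h]; first exact: (h.2 0 i).
by split=> // i j; rewrite (ord1 i); exact: h.
Qed.

Lemma enorm_ball (x y : E3) (e : R) : enorm (x - y) < e -> ball x e y.
Proof.
move=> h; apply/ball_coordP; first exact: le_lt_trans (enorm_ge0 _) h.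
by move=> i; apply: le_lt_trans h; have := coord_le_enorm (x - y) i; rewrite !mxE.
Qed.

Lemma det_cols3 u v w : \det (cols3 u v w) = dot (cross u v) w.
Proof.
rewrite (expand_det_row _ 0) !big_ord_recl big_ord0 /cofactor.
rewrite !(expand_det_row _ 0) !big_ord_recl !big_ord0 /cofactor.
rewrite !det_mx11 !mxE /= dotE !vecE.
have l0 : lift ord0 ord0 = o1 :> 'I_3 by exact: val_inj.
have l1 : lift ord0 (lift ord0 ord0) = o2 :> 'I_3 by exact: val_inj.
have z : ord0 = o0 :> 'I_3 by exact: val_inj.
have z' : (0 : 'I_3) = o0 by exact: val_inj.
rewrite ?mxE /= ?l0 ?l1 ?z ?z' !(@expr0, @exprS).
ring.
Qed.

End Vectors.

Section Curves.
Context {R : realType}.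
Local Notation E3 := 'rV[R]_3.
Implicit Types (c : R -> E3) (O A : set R).

Definition curve_smooth_on O c := forall i, smooth_on O (fun t => c t 0 i).

Lemma derive1_coord c u i : derivable c u 1 ->
  derive1 c u 0 i = derive1 (fun t => c t 0 i) u.
Proof. by move=> dc; rewrite !derive1E derive_mx// mxE. Qed.

Lemma derivable_coord c u : derivable c u 1 <->
  (forall i, derivable (fun t => c t 0 i) u 1).
Proof.
rewrite derivable_mxP; split=> [h i|h i j]; first exact: h.
by rewrite (ord1 i).
Qed.

Lemma curve_smooth_onP O c : open O ->
  curve_smooth_on O c <-> (forall n u, O u -> derivable (derive1n n c) u 1).
Proof.
move=> oO.
have nO u (P : R -> Prop) : O u -> (forall v, O v -> P v) -> \forall v \near u, P v.
  by move=> Ou h; have := open_nbhs_nbhs (conj oO Ou); exact: filterS.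
split=> [sc|dc i].
  have di n i u : O u -> derivable (derive1n n (fun t => c t 0 i)) u 1.
    by move=> Ou; have /(smooth_onP _ oO) := sc i; exact.
  have key n : forall u, O u -> derivable (derive1n n c) u 1 /\
     forall i, derive1n n c u 0 i = derive1n n (fun t => c t 0 i) u.
    elim: n => [|n IH] u Ou.
      by split=> //; apply/derivable_coord => i; exact: (di 0%N).
    have eqi v i : O v -> derive1n n.+1 c v 0 i = derive1n n.+1 (fun t => c t 0 i) v.
      move=> Ov; rewrite !derive1nS derive1_coord; last by have [] := IH v Ov.
      rewrite !derive1E; apply: near_eq_derive.
      by apply: nO Ov _ => w /IH [].
    split; last by move=> i; exact: eqi.
    apply/derivable_coord => i.
    apply: (near_eq_derivable (f := derive1n n.+1 (fun t => c t 0 i))); last exact: di.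
    by apply: nO Ou _ => v Ov; rewrite eqi.
  by move=> n u Ou; have [] := key n u Ou.
have key n : forall u, O u ->
   derive1n n c u 0 i = derive1n n (fun t => c t 0 i) u.
  elim: n => [//|n IH] u Ou.
  rewrite !derive1nS derive1_coord; last exact: dc.
  by rewrite !derive1E; apply: near_eq_derive; exact: nO Ou _.
apply/(smooth_onP _ oO) => n u Ou.
apply: (near_eq_derivable (f := fun t => derive1n n c t 0 i)).
  by apply: nO Ou _ => v; exact: key.
by have /derivable_coord := dc n u Ou; exact.
Qed.

Lemma smooth_curve_onP A c :
  smooth_curve_on A c <-> exists O, [/\ open O, A `<=` O & curve_smooth_on O c].
Proof.
split=> [h|]; last first.
  move=> [B [oB AB /(curve_smooth_onP _ oB) sc]] t /AB Bt.
  by have := open_nbhs_nbhs (conj oB Bt); apply: filterS => u Bu n; exact: sc.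
exists (interior [set u | forall n, derivable (derive1n n c) u 1]); split.
- exact: open_interior.
- by move=> t /h.
- apply/curve_smooth_onP; first exact: open_interior.
  by move=> n u /interior_subset; exact.
Qed.

Lemma curve_smooth_derivable O c u : open O -> curve_smooth_on O c -> O u ->
  derivable c u 1.
Proof. by move=> oO /(curve_smooth_onP _ oO) h; exact: (h 0%N). Qed.

Lemma curve_smooth_derive1 O c : open O -> curve_smooth_on O c ->
  curve_smooth_on O (derive1 c).
Proof.
move=> oO /(curve_smooth_onP _ oO) h; apply/(curve_smooth_onP _ oO) => n u Ou.
by rewrite -derive1Sn; exact: h.
Qed.

Lemma curve_smooth_sub O O' c : O' `<=` O -> curve_smooth_on O c ->
  curve_smooth_on O' c.
Proof. by move=> O'O sc i k; apply: Ck_sub O'O _; exact: sc. Qed.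

Lemma derivable_continuous c u : derivable c u 1 -> {for u, continuous c}.
Proof. by move=> /derivable1_diffP/differentiable_continuous. Qed.

Lemma smooth_dot O c d : curve_smooth_on O c -> curve_smooth_on O d ->
  smooth_on O (fun t => dot (c t) (d t)).
Proof.
move=> sc sd k; rewrite (_ : (fun _ => _) = (fun t => c t 0 o0 * d t 0 o0 +
  c t 0 o1 * d t 0 o1 + c t 0 o2 * d t 0 o2)); last first.
  by apply/funext => t; rewrite dotE.
by apply: CkD; [apply: CkD|]; apply: CkM => //; [exact: sc|exact: sd|exact: sc|
  exact: sd|exact: sc|exact: sd].
Qed.

Lemma smooth_cross O c d : curve_smooth_on O c -> curve_smooth_on O d ->
  curve_smooth_on O (fun t => cross (c t) (d t)).
Proof.
move=> sc sd; have key i1 i2 j1 j2 k : Ck k O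
    (fun t => c t 0 i1 * d t 0 i2 - c t 0 j1 * d t 0 j2).
  by apply: CkB; apply: CkM => //; [exact: sc|exact: sd|exact: sc|exact: sd].
by apply: forall_ord3 => k; under eq_fun do rewrite vecE; exact: key.
Qed.

Lemma smooth_scale O (a : R -> R) c : smooth_on O a -> curve_smooth_on O c ->
  curve_smooth_on O (fun t => a t *: c t).
Proof.
move=> sa sc i k; under eq_fun do rewrite mxE.
by apply: CkM; [exact: sa|exact: sc].
Qed.

Lemma curve_smoothD O c d : curve_smooth_on O c -> curve_smooth_on O d ->
  curve_smooth_on O (fun t => c t + d t).
Proof.
move=> sc sd i k; under eq_fun do rewrite mxE.
by apply: CkD; [exact: sc|exact: sd].
Qed.

Lemma curve_smooth_cst O (v : E3) : curve_smooth_on O (fun=> v).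
Proof. by move=> i k; exact: Ck_cst. Qed.

Lemma curve_smooth_comp O O' c (psi : R -> R) :
  (forall u, O u -> O' (psi u)) -> curve_smooth_on O' c -> smooth_on O psi ->
  curve_smooth_on O (fun u => c (psi u)).
Proof.
move=> h sc sp i k.
exact: (Ck_comp (O' := O') (f := fun t => c t 0 i) h (sc i k) (sp k)).
Qed.

Lemma is_derive_dotr c (v : E3) u : derivable c u 1 ->
  is_derive u 1 (fun t => dot v (c t)) (dot v (derive1 c u)).
Proof.
move=> dc; have di i : is_derive u 1 (fun t => c t 0 i) (derive1 c u 0 i).
  rewrite derive1_coord // derive1E; apply/derivableP.
  by move/derivable_coord : dc; exact.
rewrite (_ : (fun _ => _) = (fun t => v 0 o0 * c t 0 o0 + v 0 o1 * c t 0 o1 +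
  v 0 o2 * c t 0 o2)); last by apply/funext => t; rewrite dotE.
have := di o0; have := di o1; have := di o2 => ? ? ?.
by apply: is_derive_eq; rewrite dotE.
Qed.

End Curves.

(** * Arc length and charts *)

Lemma within_continuousP {T : topologicalType} {R : realType} (A : set T) (f : T -> R) :
  {within A, continuous f} <-> forall x, A x -> forall e : R, 0 < e ->
    \forall y \near x, A y -> `|f x - f y| < e.
Proof.
split=> [/subspace_continuousP h x Ax e e0|h].
  have /cvgrPdist_lt /(_ e e0) := h x Ax.
  by rewrite /= near_withinE.
apply/subspace_continuousP => x Ax; apply/cvgrPdist_lt => e e0.
by rewrite near_withinE; exact: h.
Qed.

Section Charts.
Context {R : realType}.
Local Notation E3 := 'rV[R]_3.
Local Notation mu := (@lebesgue_measure R).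

Lemma derive1_curveP (c : R -> E3) (u : R) (v : E3) :
  (forall i, is_derive u 1 (fun t => c t 0 i) (v 0 i)) ->
  derivable c u 1 /\ derive1 c u = v.
Proof.
move=> h; have dc : derivable c u 1 by apply/derivable_coord => i; have [] := h i.
split=> //; apply/rowP => i; rewrite derive1_coord// derive1E.
by have [] := h i.
Qed.

Lemma is_derive_coord (c : R -> E3) (u : R) i : derivable c u 1 ->
  is_derive u 1 (fun t => c t 0 i) (derive1 c u 0 i).
Proof.
move=> dc; rewrite derive1_coord// derive1E; apply/derivableP.
by move/derivable_coord : dc; exact.
Qed.

Lemma derive1_curve_comp (c : R -> E3) (psi : R -> R) (u d : R) :
  derivable c (psi u) 1 -> is_derive u 1 psi d ->
  derivable (fun t => c (psi t)) u 1 /\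
  derive1 (fun t => c (psi t)) u = d *: derive1 c (psi u).
Proof.
move=> dc dpsi; apply: derive1_curveP => i; rewrite mxE.
have h := is_derive_coord i dc.
have := @is_derive1_comp _ (fun t => c t 0 i) psi u _ d h dpsi.
by rewrite mulrC.
Qed.

Lemma antiderivative (v : R -> R) (a b : R) : a < b ->
  (forall t, a <= t <= b -> {for t, continuous v}) ->
  exists m : R -> R, forall t, a < t < b -> is_derive t 1 m (v t).
Proof.
move=> ab cv; exists (fun t => (\int[mu]_(s in `[a, t]) v s)%R) => t /andP[at_ tb].
have iv : mu.-integrable `[a, b] (EFin \o v).
  apply: continuous_compact_integrable; first exact: segment_compact.
  apply: continuous_in_subspaceT => x; rewrite inE /= in_itv /=; exact: cv.
have [|d e] := @continuous_FTC1_closed R v a t b tb iv at_ _.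
  by apply: cv; rewrite !ltW.
by rewrite -e derive1E; exact/derivableP.
Qed.

(** A chart centred at [c 0] is recentred at [c t], so every point of a chart is smooth. This puts
    whole arcs outside [P_Sigma]. *)
Lemma smooth_point_chart (S : set E3) (W : set E3) (r : R) (c : R -> E3)
    (tau : E3 -> R) (t : R) : open W -> smooth_curve_on `]- r, r[ c ->
  (forall t : R, - r < t < r -> derive1 c t != 0) ->
  c @` `]- r, r[ = S `&` W -> {within S `&` W, continuous tau} ->
  (forall t : R, - r < t < r -> tau (c t) = t) ->
  - r < t < r -> smooth_point S (c t).
Proof.
move=> oW /smooth_curve_onP [B [oB AB sc]] c0 imc ctau tauK tr.
have inB (u : R) : - r < u < r -> B u by move=> ?; apply: AB; rewrite /= in_itv.
pose r2 : R := Num.min (r - t) (r + t).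
have r2E : r2 <= r - t /\ r2 <= r + t by rewrite /r2 !ge_min !lexx orbT.
have r20 : 0 < r2 by rewrite /r2 lt_min; lra.
have rng (u : R) : - r2 < u < r2 -> - r < t + u < r by lra.
pose W2 := [set y | (S `&` W) y -> `|tau y - t| < r2].
have dsh (u : R) : is_derive u 1 (fun u => t + u) 1.
  rewrite -[X in is_derive _ _ _ X]add0r.
  exact: (is_deriveD (is_derive_cst t u 1) (is_derive_id u 1)).
exists (W `&` interior W2), r2, (fun u => c (t + u)), (fun y => tau y - t).
have inSW (u : R) : - r < u < r -> (S `&` W) (c u).
  by move=> ur; rewrite -imc; exists u => //=; rewrite in_itv.
have ctauP := (within_continuousP _ _).1 ctau.
split.
- by split=> //; apply: openI => //; exact: open_interior.
- split.
    apply/smooth_curve_onP; exists [set u | - r2 < u < r2]; split.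
    + exact: open_itvoo.
    + by move=> u /=; rewrite in_itv.
    + apply: (curve_smooth_comp (O' := B)) => //; first by move=> u /= /rng /inB.
      by move=> k; apply: CkD; [exact: Ck_cst|exact: Ck_id].
  move=> u /rng ur.
  have [_ ->] := derive1_curve_comp (curve_smooth_derivable oB sc (inB _ ur)) (dsh u).
  by rewrite scale1r; exact: c0.
- by rewrite addr0.
- apply/seteqP; split=> y.
    move=> [u /=]; rewrite in_itv /= => ur <-; have := inSW _ (rng _ ur) => -[Sc Wc].
    split=> //; split=> //.
    have := ctauP _ (inSW _ (rng _ ur)) (r2 - `|u|).
    rewrite subr_gt0 ltr_norml ur tauK; last exact: rng.
    move=> /(_ isT) h; rewrite /interior; apply: filterS h => z h SWz.
    have := h SWz; have := ler_normD (tau z - (t + u)) u.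
    rewrite distrC (_ : tau z - _ + _ = tau z - t); last by ring.
    lra.
  move=> [Sy [Wy /interior_subset W2y]].
  have : (S `&` W) y by [].
  rewrite -imc => -[v /=]; rewrite in_itv /= => vr vy.
  have := W2y (conj Sy Wy); rewrite -vy tauK// ltr_norml => vt.
  by exists (v - t); rewrite ?in_itv /= ?vt// addrC subrK.
- split.
    apply/within_continuousP => y [Sy [Wy Iy]] e e0.
    have := ctauP y (conj Sy Wy) e e0; apply: filterS => z h [Sz [Wz _]].
    by rewrite (_ : _ - _ = tau y - tau z); [exact: h|ring].
  by move=> u /rng ur; rewrite tauK// addrC addKr.
Qed.

(** Arc length reparametrization: [m] is the antiderivative of the speed vanishing at 0, and the
    curve is composed with its inverse. The last clause says that points of [S] close to [p] have
    parameters close to 0, which excludes other branches of [S] near [p]. *)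
Lemma unit_speed_chart (S : set E3) p : smooth_point S p ->
  exists (x : R -> E3) (L : R),
    [/\ 0 < L, curve_smooth_on [set s | - L < s < L] x, x 0 = p,
        forall s : R, - L < s < L -> dot (derive1 x s) (derive1 x s) = 1 /\
                                 (S `\` P_Sigma S) (x s)
      & forall eta : R, 0 < eta -> exists W, [/\ open W, W p &
          forall y, S y -> W y -> exists s : R, - eta < s < eta /\ x s = y]].
Proof.
move=> [W [r [c [tau [[oW r0] [sc0 c0] cp imc [ctau tauK]]]]]].
have /smooth_curve_onP [B [oB AB sc]] := sc0.
pose I := [set t : R | - r < t < r].
have oI : open I by exact: open_itvoo.
have {B oB AB}sc : curve_smooth_on I c.
  by apply: curve_smooth_sub sc => u Iu; apply: AB; rewrite /= in_itv.
have sc' := curve_smooth_derive1 oI sc.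
pose v t := Num.sqrt (dot (derive1 c t) (derive1 c t)).
have v0 t : I t -> 0 < v t by move=> It; apply: enorm_gt0; exact: c0.
have sv : smooth_on I v.
  by move=> k; apply: Ck_sqrt => [u /c0 /dot_gt0 //|]; exact: smooth_dot.
(* Halving [r] makes the speed continuous on a closed interval. *)
have [|t|m0 dm0] := @antiderivative v (- (r / 2)) (r / 2).
  by lra.
  move=> tr; apply: continuous_derivable; apply: (Ck_derivable (sv 0%N)).
  by rewrite /I /=; lra.
pose m t := m0 t - m0 0.
pose J := [set t : R | - (r / 2) < t < r / 2].
have JI t : J t -> I t by rewrite /J /I /=; lra.
have dm t : J t -> is_derive t 1 m (v t).
  by move=> /dm0 h; rewrite /m; apply: is_derive_eq; rewrite subr0.
have m'E t : J t -> derive1 m t = v t by move=> /dm []; rewrite derive1E.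
have mz : m 0 = 0 by rewrite /m subrr.
have [|||inc [psi [psiK dpsi]]] := @increasing_local_inverse R m (- (r / 2)) (r / 2).
- by lra.
- by move=> t /dm [].
- by move=> t Jt; rewrite m'E// v0//; exact: JI.
have cm t : J t -> {for t, continuous m}.
  by move=> /dm [h _]; exact: continuous_derivable.
(* By the intermediate value theorem on [[- r / 4, r / 4]], every [u] with [|u| < L] is a value of
   [m]. *)
pose L : R := Num.min (m (r / 4)) (- m (- (r / 4))).
have L0 : 0 < L.
  have h1 : m 0 < m (r / 4) by apply: inc; rewrite ?in_itv /=; lra.
  have h2 : m (- (r / 4)) < m 0 by apply: inc; rewrite ?in_itv /=; lra.
  by rewrite /L lt_min; lra.
have surj (u : R) : - L < u < L -> exists2 t, J t & m t = u.
  move=> uL; have hL1 : L <= m (r / 4) by rewrite /L ge_min lexx.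
  have hL2 : L <= - m (- (r / 4)) by rewrite /L ge_min lexx orbT.
  have [|||t] := @IVT R m (- (r / 4)) (r / 4) u.
  - by lra.
  - apply: continuous_in_subspaceT => t; rewrite inE /= in_itv /= => tr.
    by apply: cm; rewrite /J /=; lra.
  - by rewrite ge_min le_max; lra.
  - by rewrite in_itv /= => tr <-; exists t => //; rewrite /J /=; lra.
have psiJ (u : R) : - L < u < L -> [/\ J (psi u), m (psi u) = u &
    is_derive u 1 psi (derive1 m (psi u))^-1].
  by move=> /surj [t Jt <-]; rewrite psiK//; split=> //; exact: dpsi.
have sm : smooth_on J m.
  case=> [|k]; first by move=> u /dm [].
  by exists v => //; apply: Ck_sub (sv k) => t; exact: JI.
have spsi : smooth_on [set s | - L < s < L] psi.
  move=> k; apply: (@Ck_inverse R k _ J m) => //.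
  - by move=> u /psiJ [].
  - exact: open_itvoo.
  - by move=> t Jt; rewrite m'E// gt_eqF// v0//; exact: JI.
  - by move=> u /psiJ [].
exists (fun s => c (psi s)), L; split=> //.
- apply: (curve_smooth_comp (O' := I)) => //.
  by move=> u /psiJ [/JI].
- by rewrite -mz psiK// /J /=; lra.
- move=> s sL; have [Jp mp dp] := psiJ s sL; have Ip := JI _ Jp; split.
    have [_ ->] := derive1_curve_comp (curve_smooth_derivable oI sc Ip) dp.
    rewrite dotZl dotZr m'E// mulrA -expr2 -[dot _ _]enorm_sqr -exprMn.
    by rewrite [enorm _]/(v _) mulVf ?expr1n// gt_eqF// v0.
  split.
    have : (c @` `]- r, r[) (c (psi s)) by exists (psi s) => //=; rewrite in_itv.
    by rewrite imc => -[].
  by move=> [_]; apply; exact: (smooth_point_chart oW sc0 c0 imc ctau tauK).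
move=> eta eta0.
have Jz : J 0 by rewrite /J /=; lra.
have : \forall t \near 0, J t /\ `|m t| < eta.
  near=> t; split.
    by near: t; apply: (@near_itvoo R (- (r / 2)) (r / 2) 0); lra.
  rewrite -[m t]subr0 distrC -mz; near: t.
  by have /cvgrPdist_lt := cm 0 Jz; exact.
move=> /nbhs_itvP [k k0 hk].
have Ip : (S `&` W) p by rewrite -imc -cp; exists 0 => //=; rewrite in_itv /=; lra.
have taup : tau p = 0 by rewrite -cp tauK//; lra.
have := (within_continuousP _ _).1 ctau p Ip.
move=> /(_ k k0); rewrite taup => hW.
exists (W `&` interior [set y | (S `&` W) y -> `|0 - tau y| < k]); split.
- by apply: openI => //; exact: open_interior.
- by split; [case: Ip|].
- move=> y Sy [Wy /interior_subset /= /(_ (conj Sy Wy))].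
  have : (S `&` W) y by [].
  rewrite -imc => -[t /=]; rewrite in_itv /= => tr ty; rewrite -ty tauK// sub0r normrN.
  move=> tk; have [Jt mt] : J t /\ `|m t| < eta.
    by apply: hk; rewrite !add0r -ltr_norml.
  by exists (m t); rewrite psiK// -ltr_norml.
Unshelve. all: by end_near.
Qed.

End Charts.

(** * Normal frames *)

Section Tubes.
Context {R : realType}.
Local Notation E3 := 'rV[R]_3.

Lemma dot_cross_self (u v : E3) : dot u (cross u v) = 0 /\ dot v (cross u v) = 0.
Proof. by rewrite !dotE !vecE; split; ring. Qed.

(** The square of the triple product is the Gram determinant. *)
Lemma dot_cross_cross (u v w : E3) :
  dot (cross u v) w ^+ 2 + dot (u - v) (u - v) * 0 =
  dot u u * dot v v * dot w w + 2 * dot u v * dot v w * dot w u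
  - dot u u * dot v w ^+ 2 - dot v v * dot w u ^+ 2 - dot w w * dot u v ^+ 2.
Proof. by rewrite !dotE !vecE; ring. Qed.

Lemma dot_crossE (u v : E3) :
  dot (cross u v) (cross u v) = dot u u * dot v v - dot u v ^+ 2.
Proof. by rewrite !dotE !vecE; ring. Qed.

(** The Gram determinant gives a triple product of square 1, positivity of [det] selects the value
    1, and then [u x v - w] has squared length 1 - 2 + 1 = 0. *)
Lemma right_handed_cross (u v w : E3) : right_handed_orthonormal u v w ->
  cross u v = w.
Proof.
move=> [uu vv ww [uv vw wu]]; rewrite det_cols3 => k0.
have := dot_cross_cross u v w; rewrite mulr0 addr0 uu vv ww uv vw wu.
rewrite !expr0n /= !mulr0 !subr0 !mulr1 addr0 => k2.
have k1 : dot (cross u v) w = 1.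
  by apply/eqP; move/eqP : k2; rewrite sqrf_eq1 => /orP[//|/eqP h]; lra.
apply/eqP; rewrite -subr_eq0; apply/eqP/dot_eq0.
rewrite dotDl !dotDr !dotNl !dotNr dot_crossE uu vv ww uv k1 (dotC w) k1.
by rewrite expr0n /=; ring.
Qed.

Lemma orthonormal_frame (u t : E3) : dot u u = 1 -> dot t t = 1 -> dot t u = 0 ->
  right_handed_orthonormal u (cross t u) t.
Proof.
move=> uu tt tu; have ut := tu; rewrite dotC in ut.
have [h1 h2] := dot_cross_self t u.
have vv : dot (cross t u) (cross t u) = 1.
  by rewrite dot_crossE tt uu tu expr0n /= mulr1 subr0.
split=> //; first by split=> //; rewrite dotC.
rewrite det_cols3 (_ : dot _ _ = dot u u * dot t t - dot t u ^+ 2).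
  by rewrite uu tt tu expr0n /= mulr1 subr0.
by rewrite !dotE !vecE; ring.
Qed.

Lemma tube_mapE (T : tube) (r th s : R) i : tube_map T r th s 0 i =
  tarc T s 0 i + (r * cos th * tfu T s 0 i + r * sin th * tfv T s 0 i).
Proof. by rewrite !mxE addrA. Qed.

Lemma is_derive_affine (f g h : R -> R) (t f' g' h' a b : R) :
  is_derive t 1 f f' -> is_derive t 1 g g' -> is_derive t 1 h h' ->
  is_derive t 1 (fun t => f t + (a * g t + b * h t)) (f' + (a * g' + b * h')).
Proof. by move=> ? ? ?; apply: is_derive_eq. Qed.

(** The cross product of the derivatives in [r] and [th] is [r] times [U x V], the unit tangent, so
    the determinant is [r] times the tangential component of the derivative in [s]. The factor [r]
    cancels the denominator $2 \pi \rho$. *)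
Lemma tube_jacE (T : tube) (r th s : R) :
  derivable (tarc T) s 1 -> derivable (tfu T) s 1 -> derivable (tfv T) s 1 ->
  right_handed_orthonormal (tfu T s) (tfv T s) (derive1 (tarc T) s) ->
  tube_jac T r th s =
  r * (1 + r * dot (cos th *: derive1 (tfu T) s + sin th *: derive1 (tfv T) s)
                   (derive1 (tarc T) s)).
Proof.
move=> dx dU dV rh; have uvw := right_handed_cross rh.
have [_ _ ww _ _] := rh.
set U := tfu T s in uvw *; set V := tfv T s in uvw *.
rewrite /tube_jac.
have [_ ->] : derivable (fun r' => tube_map T r' th s) r 1 /\
    derive1 (fun r' => tube_map T r' th s) r = cos th *: U + sin th *: V.
  apply: derive1_curveP => i; under eq_fun do rewrite tube_mapE.
  rewrite (_ : (fun _ => _) = (fun r' => cst (tarc T s 0 i) r' +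
      (cos th * tfu T s 0 i * id r' + sin th * tfv T s 0 i * id r'))); last first.
    by apply/funext => r'; rewrite /cst /=; ring.
  have h := is_derive_affine (cos th * tfu T s 0 i) (sin th * tfv T s 0 i)
    (is_derive_cst (tarc T s 0 i) r 1) (is_derive_id r 1) (is_derive_id r 1).
  by apply: is_derive_eq; rewrite !mxE; ring.
have [_ ->] : derivable (fun th' => tube_map T r th' s) th 1 /\
    derive1 (fun th' => tube_map T r th' s) th =
    (- (r * sin th)) *: U + (r * cos th) *: V.
  apply: derive1_curveP => i; under eq_fun do rewrite tube_mapE.
  rewrite (_ : (fun _ => _) = (fun th' => cst (tarc T s 0 i) th' +
      (r * tfu T s 0 i * cos th' + r * tfv T s 0 i * sin th'))); last first.
    by apply/funext => th'; rewrite /cst /=; ring.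
  have h := is_derive_affine (r * tfu T s 0 i) (r * tfv T s 0 i)
    (is_derive_cst (tarc T s 0 i) th 1) (is_derive_cos th) (is_derive_sin th).
  by apply: is_derive_eq; rewrite !mxE; ring.
have [_ ->] : derivable (fun s' => tube_map T r th s') s 1 /\
    derive1 (fun s' => tube_map T r th s') s =
    derive1 (tarc T) s + ((r * cos th) *: derive1 (tfu T) s +
                          (r * sin th) *: derive1 (tfv T) s).
  apply: derive1_curveP => i; under eq_fun do rewrite tube_mapE.
  have h := is_derive_affine (r * cos th) (r * sin th)
    (is_derive_coord i dx) (is_derive_coord i dU) (is_derive_coord i dV).
  by apply: is_derive_eq; rewrite !mxE.
rewrite det_cols3.
rewrite (_ : cross _ _ = (r * (cos th ^+ 2 + sin th ^+ 2)) *: cross U V); last first.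
  by apply: vecP; rewrite !mxE /=; ring.
rewrite cos2Dsin2 mulr1 uvw dotZl; congr (r * _).
by rewrite dotDr ww !dotDr dotDl !dotZr !dotZl 2!(dotC (derive1 (tarc T) s)); ring.
Qed.

Lemma cvg_near_norm (f : R -> R) (t e : R) : {for t, continuous f} -> 0 < e ->
  \forall s \near t, `|f t - f s| < e.
Proof. by move=> /cvgrPdist_lt cf e0; exact: cf. Qed.

Lemma frame_exists (T : R -> E3) (L : R) : 0 < L ->
  curve_smooth_on [set s | - L < s < L] T ->
  (forall s : R, - L < s < L -> dot (T s) (T s) = 1) ->
  exists (l : R) (U V : R -> E3),
    [/\ 0 < l <= L, curve_smooth_on [set s | - l < s < l] U,
        curve_smooth_on [set s | - l < s < l] V
      & forall s : R, - l < s < l -> right_handed_orthonormal (U s) (V s) (T s)].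
Proof.
move=> L0 sT uT.
(* Three squares with sum 1 cannot all be at least 1. The basis vector of this coordinate is not
   parallel to the tangent near 0, so Gram-Schmidt against the tangent gives [U], and [V] is the
   cross product. *)
have [i Ti] : exists i, T 0 0 i ^+ 2 < 1.
  have := uT 0; rewrite dotE oppr_lt0 L0 => /(_ isT) h.
  apply: contrapT => /forallNP h2; have h3 i : 1 <= T 0 0 i ^+ 2.
    by rewrite leNgt; apply/negP/h2.
  have := h3 o0; have := h3 o1; have := h3 o2; rewrite !expr2; lra.
have cTi : {for 0, continuous (fun s => T s 0 i ^+ 2)}.
  apply: continuous_derivable; rewrite (_ : (fun _ => _) = (fun s => T s 0 i * T s 0 i)).
    by apply: (Ck_derivable (CkM (sT i 0%N) (sT i 0%N))); rewrite /= oppr_lt0 L0.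
  by apply/funext => s; rewrite expr2.
have e0 : 0 < 1 - T 0 0 i ^+ 2 by lra.
have /nbhs_itvP[l0 l00 hl0] := cvg_near_norm cTi e0.
pose l : R := Num.min l0 L.
have [ll0 lL] : l <= l0 /\ l <= L by rewrite /l !ge_min !lexx orbT.
have l0' : 0 < l by rewrite /l lt_min l00 L0.
have lt1 (s : R) : - l < s < l -> T s 0 i ^+ 2 < 1.
  move=> sl; have : 0 - l0 < s < 0 + l0 by lra.
  by move=> /hl0; rewrite ltr_norml => /andP[]; lra.
pose a : E3 := delta_mx 0 i.
have aT s : dot a (T s) = T s 0 i.
  by rewrite dotE !mxE /=; move: (T s) => u; move: i {Ti cTi e0 hl0 lt1 a};
    apply: forall_ord3; rewrite /= ?(mul0r, mul1r, add0r, addr0).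
have aa : dot a a = 1.
  by rewrite dotE !mxE /=; move: i {Ti cTi e0 hl0 lt1 a aT};
    apply: forall_ord3; rewrite /= ?(mul0r, mul1r, add0r, addr0).
pose w s := a + (- dot a (T s)) *: T s.
have ww (s : R) : - l < s < l -> 0 < dot (w s) (w s).
  move=> sl; rewrite /w !dotDl !dotDr !dotZl !dotZr aa (dotC (T s)) uT; last by lra.
  by rewrite aT; have := lt1 s sl; rewrite expr2; lra.
have sub : [set s : R | - l < s < l] `<=` [set s | - L < s < L] by move=> s /=; lra.
have sw : curve_smooth_on [set s | - l < s < l] w.
  apply: curve_smoothD; first exact: curve_smooth_cst.
  apply: smooth_scale; last exact: curve_smooth_sub sub sT.
  move=> k; apply: CkN; apply: smooth_dot; first exact: curve_smooth_cst.
  exact: curve_smooth_sub sub sT.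
pose U s := (enorm (w s))^-1 *: w s.
have sU : curve_smooth_on [set s | - l < s < l] U.
  apply: smooth_scale => // k; apply: CkV.
    by move=> s /ww; rewrite -sqrtr_gt0 => h; rewrite gt_eqF.
  by apply: Ck_sqrt => [s /ww //|]; exact: smooth_dot.
exists l, U, (fun s => cross (T s) (U s)); split=> //.
- by rewrite l0'.
- by apply: smooth_cross => //; exact: curve_smooth_sub sub sT.
- move=> s sl; have Ts1 : dot (T s) (T s) = 1 by apply: uT; lra.
  apply: orthonormal_frame => //.
    rewrite /U dotZl dotZr mulrA -expr2 -enorm_sqr -exprMn mulVf ?expr1n//.
    by rewrite gt_eqF// sqrtr_gt0 ww.
  by rewrite /U dotZr /w dotDr dotZr Ts1 (dotC (T s)) mulr1 subrr mulr0.
Qed.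

(** Here [cos (b - a) = 1], hence [sin ((b - a) / 2) = 0], while half the difference lies in [[0,
    pi[], where the sine vanishes only at 0. *)
Lemma cos_sin_inj (a b : R) : 0 <= a < 2 * pi -> 0 <= b < 2 * pi ->
  cos a = cos b -> sin a = sin b -> a = b.
Proof.
wlog ab : a b / a <= b.
  move=> h ha hb c s; case: (leP a b) => [|/ltW] ab; first exact: h.
  by apply/esym/h.
move=> /andP[a0 a2] /andP[b0 b2] cab sab.
have h : cos (b - a) = 1 by rewrite cosB cab sab -!expr2 cos2Dsin2.
have h2 : sin ((b - a) / 2) = 0.
  have := cosD ((b - a) / 2) ((b - a) / 2); rewrite -splitr h.
  have := cos2Dsin2 ((b - a) / 2); rewrite !expr2 => e1 e2.
  apply/eqP; rewrite -sqrf_eq0 expr2; apply/eqP; lra.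
case: (ltP a b) => [alb|bla]; last by apply/eqP; rewrite eq_le ab bla.
have : 0 < sin ((b - a) / 2) by apply: sin_gt0_pi; lra.
by rewrite h2 ltxx.
Qed.

End Tubes.

(** * Tubular neighbourhoods *)

Section TubeExistence.
Context {R : realType}.
Local Notation E3 := 'rV[R]_3.

Lemma curve_bounded_near (c : R -> E3) (l : R) : 0 < l ->
  curve_smooth_on [set s | - l < s < l] c ->
  \forall s \near (0 : R), forall i, `|c s 0 i| <= enorm (c 0) + 1.
Proof.
move=> l0 sc; have bi i : \forall s \near (0 : R), `|c s 0 i| <= enorm (c 0) + 1.
  have ci : {for 0, continuous (fun s => c s 0 i)}.
    apply: continuous_derivable; apply: (Ck_derivable (sc i 0%N)).
    by rewrite /= oppr_lt0 l0.
  have := cvg_near_norm ci ltr01; apply: filterS => s.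
  have := coord_le_enorm (c 0) i; have := ler_distD (c 0 0 i) (c s 0 i) 0.
  rewrite !subr0 (distrC (c s 0 i)); move: (enorm _) `|_| `|_| `|_|.
  by clear => ? ? ? ?; lra.
have := bi o0; have := bi o1; have := bi o2 => h2 h1 h0.
by near=> s; apply: forall_ord3; near: s.
Unshelve. all: by end_near.
Qed.

(* Nearest-point estimate behind the tubular neighbourhood theorem: if [n] is a
   unit normal at [x s], then [r < |x s + r n - x s'|] for [s' != s], because
   [<n, x s' - x s>] is quadratic in [s' - s]. *)
Lemma normal_dist (x : R -> E3) (l M : R) :
  (forall s : R, - l < s < l -> is_derive s 1 x (derive1 x s)) ->
  (forall s : R, - l < s < l -> dot (derive1 x s) (derive1 x s) = 1) ->
  (forall s : R, - l < s < l -> derivable (derive1 x) s 1) ->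
  (forall s : R, - l < s < l -> forall i, `|derive1 (derive1 x) s 0 i| <= M) ->
  (forall s : R, - l < s < l -> 2^-1 <= dot (derive1 x 0) (derive1 x s)) ->
  (forall s s' : R, - l < s < l -> - l < s' < l ->
    enorm (x s - x s') <= `|s - s'|) /\
  (forall (s s' r : R) (n : E3), - l < s < l -> - l < s' < l -> dot n n = 1 ->
    dot n (derive1 x s) = 0 -> 0 <= r -> r * (24 * M) < 1 ->
    s != s' -> r < enorm (x s + r *: n - x s')).
Proof.
move=> dx ux d2x bM lowT.
(* The mean value theorem fails for vector functions, so it is applied to the component of [x] along
   a fixed [v]. *)
have mvt (v : E3) (s s' : R) : - l < s < l -> - l < s' < l ->
    exists2 c, - l < c < l /\ `|c - s| <= `|s' - s| &
      dot v (x s' - x s) = dot v (derive1 x c) * (s' - s).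
  move=> sl s'l; have [t tl|c hc e] := @MVT_near R (fun t => dot v (x t))
    (fun t => dot v (derive1 x t)) (- l) l _ s s' sl s'l.
    by apply: is_derive_dotr; have [] := dx t tl.
  by exists c => //; rewrite dotDr dotNr.
split=> [s s' sl s'l|s s' r n sl s'l nn nT r0 rM ss'].
  have [c [cl _] e] := mvt (x s - x s') s' s s'l sl.
  have [->|x0] := eqVneq (enorm (x s - x s')) 0; first exact: normr_ge0.
  have x1 : 0 < enorm (x s - x s') by rewrite lt0r x0 enorm_ge0.
  rewrite -(ler_pM2l x1) -expr2 enorm_sqr e (le_trans (ler_norm _))// normrM.
  apply: ler_wpM2r; first exact: normr_ge0.
  apply: le_trans (dot_le_enorm _ _) _.
  by rewrite {2}/enorm ux// sqrtr1 mulr1.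
have M0 : 0 <= M by exact: le_trans (normr_ge0 _) (bM s sl o0).
set D := x s' - x s.
(* The component of [D] along the unit vector [x' 0] is already at least half of [|s' - s|]. *)
have lowD : (s' - s) ^+ 2 <= 4 * dot D D.
  have [c [cl _] e] := mvt (derive1 x 0) s s' sl s'l.
  have z : - l < 0 < l by move: sl; clear; lra.
  have := cauchy_schwarz (derive1 x 0) D; rewrite ux// mul1r e.
  have := lowT c cl; set d := dot _ _ => hd; rewrite exprMn => h.
  have : 1 <= 4 * d ^+ 2 by move: hd; rewrite expr2; clear; nra.
  have := sqr_ge0 (s' - s); move: h; set q := (_ ^+ 2); move: (dot D D) (d ^+ 2) q.
  by clear => ? ? ?; nra.
(* As [n] is orthogonal to [x' s], only the increment of the tangent counts. Its coordinates change
   by at most [M |s' - s|], and the 3 comes from [enorm_le_coord]. *)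
have upn : `|dot n D| <= 3 * M * (s' - s) ^+ 2.
  have [c [cl cs] e] := mvt n s s' sl s'l.
  rewrite e normrM.
  have -> : dot n (derive1 x c) = dot n (derive1 x c - derive1 x s).
    by rewrite dotDr dotNr nT subr0.
  have h1 := dot_le_enorm n (derive1 x c - derive1 x s).
  have h2 : enorm (derive1 x c - derive1 x s) <= 3 * (M * `|s' - s|).
    apply: enorm_le_coord => i; rewrite !mxE.
    have [t tl|d [dl ds] ->] := @MVT_near R (fun t => derive1 x t 0 i)
      (fun t => derive1 (derive1 x) t 0 i) (- l) l _ s c sl cl.
      by apply: is_derive_coord; exact: d2x.
    rewrite normrM; apply: ler_pM; rewrite ?normr_ge0//.
    exact: bM.
  have n1 : enorm n = 1 by rewrite /enorm nn sqrtr1.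
  rewrite n1 mul1r in h1.
  have := ler_wpM2r (normr_ge0 (s' - s)) (le_trans h1 h2).
  by rewrite -!mulrA -expr2 real_normK ?num_real.
have sp : 0 < (s' - s) ^+ 2 by rewrite exprn_even_gt0 //= subr_eq0 eq_sym.
rewrite -[X in X < _]ger0_norm// -sqrtr_sqr /enorm.
rewrite (_ : x s + _ - _ = r *: n - D); last first.
  by rewrite /D; apply/rowP => i; rewrite !mxE; ring.
rewrite dotDl !dotDr !dotNl !dotNr !dotZl !dotZr nn (dotC D).
(* With [q = (s' - s) ^+ 2] the right side is at least [r ^+ 2 - 6 M r q + q / 4], which exceeds
   [r ^+ 2] exactly when [24 M r < 1]. *)
suff h : r ^+ 2 < r * (r * 1) + - (r * dot n D) + (- (r * dot n D) - - dot D D).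
  by rewrite ltr_sqrt// (le_lt_trans _ h)// sqr_ge0.
move: upn lowD sp rM r0; rewrite ler_norml => /andP[_].
move: (dot D D) ((s' - s) ^+ 2) (dot n D); clear => dD q nD h2 lowD sp rM r0.
have h3 := ler_wpM2l r0 h2.
have h4 : r * (24 * M) * q < q by rewrite gtr_pMl.
rewrite expr2; move: h3 h4; rewrite !mulrA.
by move: lowD sp; clear; lra.
Qed.

Lemma rho_le (S : set E3) q y : S y -> rho S q <= enorm (q - y).
Proof.
by move=> Sy; apply: ge_inf; [exists 0 => _ [z _ <-]; exact: enorm_ge0|exists y].
Qed.

Lemma le_rho (S : set E3) q y r : S y -> (forall z, S z -> r <= enorm (q - z)) ->
  r <= rho S q.
Proof.
move=> Sy h; apply: lb_le_inf; first by exists (enorm (q - y)), y.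
by move=> _ [z Sz <-]; exact: h.
Qed.

(** The triangle inequality for points of [S] at distance at least [e] from [p]: a tube point is
    within [e / 2] of [p], hence farther than [e / 2] from them, and [r < e / 4]. *)
Lemma far_ineq (r d l e a b c k m : R) : a <= m -> m <= l -> b <= c + k ->
  c <= a + r -> e <= b -> r < d -> d <= e / 4 -> l <= e / 4 -> 0 < e -> r < k.
Proof. by lra. Qed.

(** Everything follows from the foot [x s] being the unique nearest point of [S], at distance [r].
    Nearby points of [S] lie on the arc and are handled by [normal_dist], the remaining ones by
    [far_ineq]. *)
Lemma tube_exists (S : set E3) (p : E3) : smooth_point S p ->
  exists T, tube_ok S T /\
  exists W, [/\ open W, W p & S `&` W `<=` tube_base T].
Proof.
move=> /unit_speed_chart [x [L [L0 sx x0 uS loc]]].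
have oL : open [set s : R | - L < s < L] by exact: open_itvoo.
have sT := curve_smooth_derive1 oL sx.
have [|l0 [U [V [/andP[l00 l0L] sU sV rhf]]]] := frame_exists L0 sT.
  by move=> s /uS [].
have ol0 : open [set s : R | - l0 < s < l0] by exact: open_itvoo.
have sT' : curve_smooth_on [set s | - l0 < s < l0] (derive1 (derive1 x)).
  apply: curve_smooth_sub (curve_smooth_derive1 oL sT) => s /=.
  by move: l0L; clear; lra.
have [M [M0 M1 M2 M3]] : exists M : R, [/\ 0 < M,
    enorm (derive1 (derive1 x) 0) + 1 <= M, enorm (derive1 U 0) + 1 <= M &
    enorm (derive1 V 0) + 1 <= M].
  have := enorm_ge0 (derive1 V 0); have := enorm_ge0 (derive1 U 0).
  have := enorm_ge0 (derive1 (derive1 x) 0); move: (enorm _) (enorm _) (enorm _).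
  clear => a b c a0 b0 c0; exists (a + b + c + 1); split; lra.
have zL : - L < 0 < L by rewrite oppr_lt0 L0.
have near0 : \forall s \near (0 : R), [/\ - l0 < s < l0,
    forall i, `|derive1 (derive1 x) s 0 i| <= M,
    forall i, `|derive1 U s 0 i| <= M, forall i, `|derive1 V s 0 i| <= M &
    2^-1 <= dot (derive1 x 0) (derive1 x s)].
  have b1 := curve_bounded_near l00 sT'.
  have b2 := curve_bounded_near l00 (curve_smooth_derive1 ol0 sU).
  have b3 := curve_bounded_near l00 (curve_smooth_derive1 ol0 sV).
  have cT : {for 0, continuous (fun s => dot (derive1 x 0) (derive1 x s))}.
    apply: continuous_derivable.
    by have [] := is_derive_dotr (derive1 x 0) (curve_smooth_derivable oL sT zL).
  have h0 : (0 : R) < 2^-1 by rewrite invr_gt0.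
  have b4 := cvg_near_norm cT h0.
  have b5 : \forall s \near (0 : R), - l0 < s < l0.
    by apply: near_itvoo; rewrite oppr_lt0 l00.
  apply: filterS (filterI (filterI b1 b2) (filterI b3 (filterI b4 b5))).
  move=> s [[h1 h2] [h3 [h4 h5]]]; split=> // [i|i|i|].
  - exact: le_trans (h1 i) M1.
  - exact: le_trans (h2 i) M2.
  - exact: le_trans (h3 i) M3.
  - move: h4; rewrite (uS 0 zL).1 ltr_norml => /andP[_]; move: (dot _ _); clear => ?; lra.
have {near0}[l l_gt0 hl] := nbhs_itvP near0.
have {}hl (s : R) : - l < s < l -> [/\ - l0 < s < l0,
    forall i, `|derive1 (derive1 x) s 0 i| <= M,
    forall i, `|derive1 U s 0 i| <= M, forall i, `|derive1 V s 0 i| <= M &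
    2^-1 <= dot (derive1 x 0) (derive1 x s)].
  by move=> sl; apply: hl; rewrite !add0r.
have lL (s : R) : - l < s < l -> - L < s < L by move=> /hl [+ _ _ _ _]; move: l0L; clear; lra.
have [|||||lip nd] := @normal_dist x l M.
- move=> s /lL sL; rewrite derive1E; apply/derivableP.
  exact: curve_smooth_derivable oL sx sL.
- by move=> s /lL /uS [].
- by move=> s /lL; exact: curve_smooth_derivable oL sT.
- by move=> s /hl [].
- by move=> s /hl [].
have [W [oW Wp locW]] := loc l l_gt0.
have /nbhs_ballP[e0 /= e00 We] : nbhs p W by exact: open_nbhs_nbhs (conj oW Wp).
(* The bounds [e0 / 4] serve [far_ineq], the bound [(24 * M + 1)^-1] serves [normal_dist], and
   [l / 2] keeps the closed arc inside the open interval of the estimates. *)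
pose l1 : R := Num.min (l / 2) (e0 / 4).
pose d : R := Num.min (e0 / 4) (24 * M + 1)^-1.
have [l1l l1e] : l1 <= l / 2 /\ l1 <= e0 / 4 by rewrite /l1 !ge_min !lexx orbT.
have [de dM] : d <= e0 / 4 /\ d <= (24 * M + 1)^-1.
  by rewrite /d !ge_min !lexx orbT.
have l10 : 0 < l1 by rewrite /l1 lt_min !divr_gt0.
have M4 : 0 < 24 * M + 1 by rewrite addr_gt0// mulr_gt0.
have d0 : 0 < d by rewrite /d lt_min invr_gt0 M4 andbT divr_gt0.
have rM (r : R) : r < d -> r * (24 * M) < 1.
  move=> rd; have := lt_le_trans rd dM; rewrite -(ltr_pM2r M4) mulVf ?gt_eqF//.
  by move: M0; clear; have [r0|r0] := leP 0 r; nra.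
have l1l' (s : R) : - l1 <= s <= l1 -> - l < s < l.
  by move: l1l l_gt0; clear; lra.
pose T := Tube (- l1) l1 x U V d.
pose nrm (th s : R) := cos th *: U s + sin th *: V s.
have mapE r th s : tube_map T r th s = x s + r *: nrm th s.
  by rewrite /tube_map /nrm scalerDr !scalerA addrA.
have nrm1 (th s : R) : - l1 <= s <= l1 ->
    dot (nrm th s) (nrm th s) = 1 /\ dot (nrm th s) (derive1 x s) = 0.
  move=> /l1l' /hl [/rhf [uu vv _ [uv vw wu] _] _ _ _ _].
  rewrite /nrm !dotDl !dotDr !dotZl !dotZr uu vv (dotC (V s) (U s)) uv vw.
  rewrite (dotC (U s)) wu !mulr0 !mulr1 !addr0 add0r -!expr2; split=> //.
  exact: cos2Dsin2.
have Sx (s : R) : - l < s < l -> S (x s) by move=> /lL /uS [_ []].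
have near_pt (r th s : R) y : 0 <= r < d -> - l1 <= s <= l1 -> S y ->
    y = x s \/ r < enorm (tube_map T r th s - y).
  move=> /andP[r0 rd] sl1 Sy; rewrite mapE; have [n1 n0] := nrm1 th s sl1.
  have [ey|ey] := ltP (enorm (p - y)) e0.
    have [s' [s'l <-]] := locW y Sy (We y (enorm_ball ey)).
    have [->|ss'] := eqVneq s s'; first by left.
    by right; apply: nd => //; [exact: l1l'|exact: rM].
  right; have h1 : enorm (x 0 - x s) <= `|0 - s|.
    by apply: lip; [rewrite oppr_lt0 l_gt0|exact: l1l'].
  have h2 : `|0 - s| <= l1 by rewrite sub0r normrN ler_norml.
  have h3 := enormD (p - x s - r *: nrm th s) (x s + r *: nrm th s - y).
  have h4 := enormD (p - x s) (- (r *: nrm th s)).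
  have h5 : enorm (- (r *: nrm th s)) = r.
    by rewrite enormN enormZ /enorm n1 sqrtr1 mulr1 ger0_norm.
  have h6 : p - x s - r *: nrm th s + (x s + r *: nrm th s - y) = p - y.
    by move: (nrm th s) (x s) => N X; apply/rowP => i; rewrite !mxE; ring.
  rewrite h6 h5 in h3 h4; rewrite x0 in h1.
  exact: far_ineq h1 h2 h3 h4 ey rd de l1e e00.
have rhoE (r th s : R) : 0 <= r < d -> - l1 <= s <= l1 -> rho S (tube_map T r th s) = r.
  move=> rd sl1; have Sxs := Sx _ (l1l' _ sl1).
  have er : enorm (tube_map T r th s - x s) = r.
    have [n1 _] := nrm1 th s sl1.
    rewrite mapE addrC addKr enormZ /enorm n1 sqrtr1 mulr1 ger0_norm//.
    by case/andP: rd.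
  apply/eqP; rewrite eq_le; apply/andP; split; first by rewrite -[leRHS]er rho_le.
  apply: le_rho Sxs _ => y Sy.
  have [->|/ltW//] := near_pt r th s y rd sl1 Sy; by rewrite er.
exists T; split; last first.
  have [W' [oW' W'p locW']] := loc l1 l10.
  exists W'; split=> // y [Sy W'y]; have [s [sl <-]] := locW' y Sy W'y.
  by exists s => //=; rewrite in_itv /= !ltW//; case/andP: sl.
have smU c : curve_smooth_on [set s | - l0 < s < l0] c ->
    smooth_curve_on `[- l1, l1] c.
  move=> sc; apply/smooth_curve_onP; exists [set s | - l0 < s < l0]; split=> //.
  by move=> s /=; rewrite in_itv /= => /l1l' /hl [].
split=> /=.
- by split=> //; rewrite gtrN.
- split.
  + by apply: smU; apply: curve_smooth_sub sx => s /=; move: l0L; clear; lra.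
  + by move=> s /l1l' /lL /uS [h _]; rewrite /enorm h sqrtr1.
  + move=> s s'; rewrite !inE /= => sl s'l e.
    have {}sl : - l1 <= s <= l1 by move: sl; rewrite ?in_itv.
    have {}s'l : - l1 <= s' <= l1 by move: s'l; rewrite ?in_itv.
    apply/eqP/negP => /negP ne.
    have [n1 n0] := nrm1 0 s sl.
    (* With [r = 0] the estimate says that distinct parameters give distinct points. *)
    have := nd s s' 0 (nrm 0 s) (l1l' _ sl) (l1l' _ s'l) n1 n0 (lexx _).
    rewrite mul0r => /(_ ltr01 ne).
    by rewrite scale0r addr0 e subrr /enorm (dotE 0) !mxE !mul0r !addr0 sqrtr0 ltxx.
  + by move=> y [s /=]; rewrite in_itv /= => /l1l' /lL /uS [_ h] <-.
- split; [exact: smU|exact: smU|].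
  by move=> s /l1l' /hl [/rhf].
- split.
    (* The polar coordinates are read off the point: [r] is the distance to [S], [s] the parameter
       of the nearest point, and [th] follows from the components of the normal in the frame. *)
    move=> r th s r' th' s' rd thp sl r'd thp' s'l e.
    have rd1 : 0 <= r < d by move: rd; clear; lra.
    have rd2 : 0 <= r' < d by move: r'd; clear; lra.
    have rr : r = r' by rewrite -(rhoE r th s)// e rhoE.
    have ss : s = s'.
      have Sxs := Sx _ (l1l' _ s'l).
      have [h|] := near_pt r th s (x s') rd1 sl Sxs; last first.
        rewrite e mapE addrC addKr enormZ /enorm (nrm1 th' s' s'l).1 sqrtr1 mulr1.
        by rewrite -rr ger0_norm ?ltxx//; case/andP: rd1.
      apply/eqP/negP => /negP ne.
      have [n1 n0] := nrm1 0 s sl.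
      have := nd s s' 0 (nrm 0 s) (l1l' _ sl) (l1l' _ s'l) n1 n0 (lexx _).
      rewrite mul0r => /(_ ltr01 ne).
      by rewrite scale0r addr0 h subrr /enorm (dotE 0) !mxE !mul0r !addr0 sqrtr0 ltxx.
    move: e; rewrite -ss -rr !mapE => /addrI /scalerI e.
    have {}e : nrm th s = nrm th' s by apply: e; rewrite gt_eqF//; case/andP: rd.
    have [uu vv _ [uv _ _] _] : right_handed_orthonormal (U s) (V s) (derive1 x s).
      by move: sl => /l1l' /hl [/rhf].
    split=> //; apply: cos_sin_inj => //.
      have := congr1 (dot (U s)) e.
      by rewrite /nrm !dotDr !dotZr uu uv !mulr1 !mulr0 !addr0.
    have := congr1 (dot (V s)) e.
    by rewrite /nrm !dotDr !dotZr vv (dotC (V s)) uv !mulr1 !mulr0 !add0r.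
  move=> r th s rd thp sl.
  have [sl0 _ bU bV _] := hl s (l1l' _ sl).
  have sL := lL _ (l1l' _ sl).
  rewrite tube_jacE /=; last exact: rhf.
  (* Then [1 + r * k] is positive, because [24 M r < 1]. *)
  - set k := dot _ _; have kM : `|k| <= 6 * M.
      have := dot_le_enorm (cos th *: derive1 U s + sin th *: derive1 V s) (derive1 x s).
      rewrite -/k {2}/enorm (uS s sL).1 sqrtr1 mulr1 => /le_trans; apply.
      rewrite (_ : 6 * M = 3 * (M + M)); last by ring.
      apply: enorm_le_coord => i; rewrite !mxE (le_trans (ler_normD _ _))//.
      rewrite !normrM; apply: lerD.
        by rewrite -[leRHS]mul1r ler_pM// ?normr_ge0// ler_norml cos_geN1 cos_le1.
      by rewrite -[leRHS]mul1r ler_pM// ?normr_ge0// ler_norml sin_geN1 sin_le1.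
    have [r0 rd'] : 0 < r /\ r < d by case/andP: rd.
    have := rM r rd'; move: kM; rewrite ler_norml => /andP[k1 k2] k3.
    by rewrite mulf_neq0 ?gt_eqF//; move: k1 k3 r0 M0; clear; nra.
  - exact: curve_smooth_derivable oL sx sL.
  - exact: curve_smooth_derivable ol0 sU sl0.
  - exact: curve_smooth_derivable ol0 sV sl0.
- by move=> r th s rd _ sl; exact: rhoE.
Qed.

End TubeExistence.

(** * Bump functions *)

Section Bumps.
Context {R : realType}.
Local Notation E3 := 'rV[R]_3.

(** The powers of [x^-1] make the family stable under differentiation up to linear combinations, so
    that smoothness of all members is one induction. *)
Definition flat (n : nat) (x : R) : R :=
  if 0 < x then x^-1 ^+ n * expR (- x^-1) else 0.

(** This is $e^y \ge y^{n+1} / (n+1)!$ at $y = 1/x$. It makes the difference quotient at 0, which is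
    [flat n.+1], tend to 0. *)
Lemma flat_le n (x : R) : 0 < x -> `|flat n x| <= (n.+1)`!%:R * x.
Proof.
move=> x0; rewrite /flat x0 ger0_norm; last first.
  by rewrite mulr_ge0 ?expR_ge0// exprn_ge0// invr_ge0 ltW.
have y0 : 0 < x^-1 by rewrite invr_gt0.
have fn : 0 < (n.+1)`!%:R :> R by rewrite ltr0n fact_gt0.
have h := expR_ge1Dxn n (ltW y0).
rewrite expRN ler_pdivrMr ?expR_gt0// mulrAC -ler_pdivrMr// -exprSr.
by rewrite mulrC -ler_pdivrMr//; apply: le_trans h; rewrite lerDr.
Qed.

Lemma is_derive_flat n (x : R) :
  is_derive x 1 (flat n) (flat n.+2 x - n%:R * flat n.+1 x).
Proof.
have [x0|x0|->] := ltgtP x 0.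
- have e : \near x, cst 0 x = flat n x.
    have : x - 1 < x < 0 by rewrite x0 andbT gtrBl.
    by move=> /near_itvoo; apply: filterS => y /andP[_ y0]; rewrite /flat ltNge ltW.
  have -> : flat n.+2 x - n%:R * flat n.+1 x = 0.
    by rewrite /flat ltNge ltW//= mulr0 subr0.
  exact: near_eq_is_derive e (is_derive_cst _ _ _).
- have e : \near x, (fun y => y^-1 ^+ n * expR (- y^-1)) x = flat n x.
    have : 0 < x < x + 1 by rewrite x0 ltrDl ltr01.
    by move=> /near_itvoo; apply: filterS => y /andP[y0 _]; rewrite /flat y0.
  apply: near_eq_is_derive e _.
  have xn0 : x != 0 by rewrite gt_eqF.
  have d1 : is_derive x 1 (fun y : R => y^-1) (- (x^-1 ^+ 2)).
    have h := is_deriveV (f := id) (x := x) (v := 1) (t := 1) xn0 (is_derive_id _ _).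
    by apply: is_derive_eq; rewrite scaler1 exprVn.
  have d2 : is_derive x 1 (fun y : R => expR (- y^-1)) (expR (- x^-1) * x^-1 ^+ 2).
    have h := @is_derive1_comp _ expR (fun y => - y^-1) x _ _
      (is_derive_expR (- x^-1)) (is_deriveN d1).
    by apply: is_derive_eq; rewrite opprK.
  have d3 : is_derive x 1 (fun y : R => y^-1 ^+ n) (- (n%:R * x^-1 ^+ n.+1)).
    have hx : is_derive x^-1 1 (fun y : R => y ^+ n) (n%:R * x^-1 ^+ n.-1).
      split; first exact: exprn_derivable.
      by rewrite exp_derive -[_ *: _]/(_ * _) mulr1.
    have h := @is_derive1_comp _ (fun y : R => y ^+ n) GRing.inv x _ _ hx d1.
    apply: is_derive_eq; rewrite mulrN -mulrA -exprD addn2; case: (n) => [|m] //.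
    by rewrite !mul0r.
  have h := is_deriveM d3 d2.
  apply: is_derive_eq; rewrite /flat x0.
  rewrite -![_ *: _]/(_ * _) /= !exprS; ring.
- have z m : flat m (0 : R) = 0 by rewrite /flat ltxx.
  rewrite !z mulr0 subr0.
  have lim0 : (fun h : R => h^-1 *: ((flat n \o shift 0) (h *: 1) - flat n 0)) h
      @[h --> 0^'] --> (0 : R).
    rewrite z; apply/cvgrPdist_lt => e e0.
    have f1 : 0 < (n.+2)`!%:R :> R by rewrite ltr0n fact_gt0.
    near=> h; rewrite /= sub0r normrN subr0 addr0 scaler1.
    have h0 : h != 0 by near: h; exact: nbhs_dnbhs_neq.
    have [hp|hn] := ltP 0 h; last first.
      have -> : flat n h = 0 by rewrite /flat ltNge hn.
      by rewrite scaler0 normr0.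
    have -> : h^-1 *: flat n h = flat n.+1 h.
      by rewrite /flat hp -[_ *: _]/(_ * _) exprS mulrA.
    apply: le_lt_trans (flat_le _ hp) _.
    rewrite mulrC -ltr_pdivlMr//.
    have : `|h| < e / (n.+2)`!%:R.
      by near: h; apply: dnbhs0_lt; rewrite divr_gt0.
    by rewrite gtr0_norm.
  split; first by apply/cvg_ex; exists 0.
  exact: cvg_lim lim0.
Unshelve. all: by end_near.
Qed.

Lemma smooth_flat n : smooth_on setT (flat n).
Proof.
move=> k; elim: k n => [|k IH] n; first by move=> u _; have [] := is_derive_flat n u.
exists (fun x => flat n.+2 x - n%:R * flat n.+1 x).
  by move=> u _; exact: is_derive_flat.
by apply: CkB => //; apply: CkM => //; exact: Ck_cst.
Qed.

Lemma flat0_gt0 (x : R) : 0 < x -> 0 < flat 0 x.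
Proof. by move=> x0; rewrite /flat x0 mul1r expR_gt0. Qed.

Lemma flat0_ge0 (x : R) : 0 <= flat 0 x.
Proof. by rewrite /flat; case: ifP => // _; rewrite mul1r expR_ge0. Qed.

(** The two summands of the denominator are positive for $x^2 < 2$ and for $x^2 > 1$ respectively,
    so it never vanishes. Using the square avoids the corner of the absolute value. *)
Definition plateau (x : R) : R :=
  flat 0 (2 - x ^+ 2) / (flat 0 (2 - x ^+ 2) + flat 0 (x ^+ 2 - 1)).

Lemma smooth_plateau : smooth_on setT plateau.
Proof.
move=> k; have C2 : Ck k setT (fun x : R => x ^+ 2).
  rewrite (_ : (fun _ => _) = (fun x : R => x * x)).
    by apply: CkM; exact: Ck_id.
  by apply/funext => x; rewrite expr2.
have h1 : Ck k setT (fun x : R => flat 0 (2 - x ^+ 2)).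
  apply: (Ck_comp (O' := setT)) => //; first exact: smooth_flat.
  by apply: CkB => //; exact: Ck_cst.
have h2 : Ck k setT (fun x : R => flat 0 (x ^+ 2 - 1)).
  apply: (Ck_comp (O' := setT)) => //; first exact: smooth_flat.
  by apply: CkB => //; exact: Ck_cst.
apply: CkM => //; apply: CkV; last exact: CkD.
move=> u _; rewrite gt_eqF//; have [u1|u1] := ltP (u ^+ 2) 2.
  by rewrite ltr_pwDl// ?flat0_ge0// flat0_gt0// subr_gt0.
by rewrite ltr_wpDl ?flat0_ge0// flat0_gt0// subr_gt0; lra.
Qed.

Lemma plateau1 (x : R) : `|x| <= 1 -> plateau x = 1.
Proof.
move=> x1; have x2 : x ^+ 2 <= 1.
  by rewrite -real_normK ?num_real// expr_le1.
rewrite /plateau [flat 0 (_ - 1)]/flat ltNge subr_le0 x2 /= addr0 divff//.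
by rewrite gt_eqF// flat0_gt0//; lra.
Qed.

Lemma plateau0 (x : R) : 2 <= `|x| -> plateau x = 0.
Proof.
move=> x1; have x2 : 4 <= x ^+ 2.
  by rewrite -real_normK ?num_real// expr2; nra.
by rewrite /plateau {1}/flat ltNge (_ : _ <= 0) ?mul0r//; lra.
Qed.

(** * Smooth functions of three variables and bump functions *)

Fixpoint Ck3 (k : nat) (f : E3 -> R) : Prop :=
  (forall x, differentiable f x) /\
  if k is k'.+1 then forall i, Ck3 k' (pder i f) else True.

Definition smooth3 f := forall k, Ck3 k f.

Lemma smooth3P f : smooth3 f <-> smooth_fun_on setT f.
Proof.
split=> [sf x _|sf].
  near=> y; move=> s.
  have : Ck3 (size s) f by exact: sf.
  (* [foldr] applies the last index of the list first, and this is the derivative that [Ck3] peels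
     off. *)
  elim/last_ind: s f {sf} => [|s i IH] f /=; first by case.
  by rewrite size_rcons foldr_rcons /= => -[_ h]; exact: IH.
have {}sf s x : differentiable (foldr pder f s) x.
  by have := nbhs_singleton (sf x I); exact.
move=> k; elim: k f sf => [|k IH] f sf /=; first by split=> // x; exact: (sf [::]).
split=> [x|i]; first exact: (sf [::]).
by apply: IH => s x; have := sf (rcons s i) x; rewrite foldr_rcons.
Unshelve. all: by end_near.
Qed.

Lemma Ck3W k f : Ck3 k.+1 f -> Ck3 k f.
Proof.
elim: k f => [|k IH] f [df h]; first by split.
by split=> // i; apply: IH; exact: h.
Qed.

Lemma Ck3_diff k f x : Ck3 k f -> differentiable f x.
Proof. by case: k => [|k] [df _]. Qed.

Lemma Ck3D k f g : Ck3 k f -> Ck3 k g -> Ck3 k (fun x => f x + g x).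
Proof.
elim: k f g => [|k IH] f g [df hf] [dg hg].
  by split=> // x; exact: differentiableD.
split=> [x|i]; first exact: differentiableD.
rewrite (_ : pder i _ = (fun x => pder i f x + pder i g x)).
  by apply: IH; [exact: hf|exact: hg].
by apply/funext => x; rewrite /pder deriveD//; exact: diff_derivable.
Qed.

Lemma Ck3M k f g : Ck3 k f -> Ck3 k g -> Ck3 k (fun x => f x * g x).
Proof.
elim: k f g => [|k IH] f g Cf Cg; have [df hf] := Cf; have [dg hg] := Cg.
  by split=> // x; exact: differentiableM.
split=> [x|i]; first exact: differentiableM.
rewrite (_ : pder i _ = (fun x => f x * pder i g x + g x * pder i f x)).
  by apply: Ck3D; apply: IH; [exact: Ck3W|exact: hg|exact: Ck3W|exact: hf].
by apply/funext => x; rewrite /pder deriveM//; exact: diff_derivable.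
Qed.

Lemma Ck3_cst k (c : R) : Ck3 k (fun=> c).
Proof.
elim: k c => [|k IH] c; split=> //; try by move=> x; exact: differentiable_cst.
move=> i.
rewrite (_ : pder i _ = (fun=> 0)); first exact: IH.
by apply/funext => x; rewrite /pder derive_cst.
Qed.

Lemma Ck3_coord k (b : R -> R) i : Ck k setT b -> Ck3 k (fun x => b (x 0 i)).
Proof.
elim: k b => [|k IH] b Cb.
  split=> // x; apply: (@differentiable_comp _ _ _ _ (fun x : E3 => x 0 i) b).
    exact: differentiable_coord.
  by apply/derivable1_diffP; exact: Cb.
have [b' bb' Cb'] := Cb.
have db x : differentiable (fun x : E3 => b (x 0 i)) x.
  apply: (@differentiable_comp _ _ _ _ (fun x : E3 => x 0 i) b).
    exact: differentiable_coord.
  by apply/derivable1_diffP; have [] := bb' (x 0 i) I.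
split=> // j.
rewrite (_ : pder j _ = (fun x => b' (x 0 i) * (j == i)%:R)); last first.
  apply/funext => x; rewrite /pder.
  (* On the line through [x] in direction [j], the coordinate [i] is the affine function [g]. *)
  pose g : R -> R := cst (x 0 i) + (j == i)%:R *: id.
  have dg : is_derive (0 : R) 1 g (0 + (j == i)%:R *: 1).
    exact: (is_deriveD (is_derive_cst _ _ _) (is_deriveZ _ (is_derive_id _ _))).
  have gE h : g h = x 0 i + (j == i)%:R * h by [].
  have bx : is_derive (g 0) 1 b (b' (x 0 i)).
    by rewrite gE mulr0 addr0; exact: bb'.
  have [_ e] := is_derive1_comp bx dg.
  move: e; rewrite add0r -[_ *: 1]/(_ * 1) mulr1 => <-.
  rewrite /derive; apply: (congr1 (fun F : R -> R => lim (F @ 0^'))).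
  apply/funext => h /=.
  rewrite !mxE /= !gE mulr0 !addr0 scaler1 mulrC addrC (eq_sym i j).
  by [].
by apply: Ck3M; [exact: IH|exact: Ck3_cst].
Qed.

(** A product of functions of one coordinate fits the balls of the library, which are cubes. *)
Definition bump (p : E3) (r : R) (x : E3) : R :=
  plateau ((x 0 o0 - p 0 o0) / r) * plateau ((x 0 o1 - p 0 o1) / r) *
  plateau ((x 0 o2 - p 0 o2) / r).

Lemma smooth_bump p r : smooth3 (bump p r).
Proof.
have key i k : Ck3 k (fun x : E3 => plateau ((x 0 i - p 0 i) / r)).
  apply: (@Ck3_coord k (fun t => plateau ((t - p 0 i) / r))).
  apply: (Ck_comp (O' := setT)) => //; first exact: smooth_plateau.
  apply: CkM; last exact: Ck_cst.
  by apply: CkB; [exact: Ck_id|exact: Ck_cst].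
by move=> k; apply: Ck3M => //; exact: Ck3M.
Qed.

Lemma bump1 p r x : 0 < r -> ball p r x -> bump p r x = 1.
Proof.
move=> r0 /(ball_coordP _ _ r0) h.
have hi i : plateau ((x 0 i - p 0 i) / r) = 1.
  by apply: plateau1; rewrite normrM normfV (gtr0_norm r0) ler_pdivrMr// mul1r distrC ltW.
by rewrite /bump !hi !mulr1.
Qed.

Lemma bump0 p r x : 0 < r -> ~ ball p (2 * r) x -> bump p r x = 0.
Proof.
move=> r0 h; have r20 : 0 < 2 * r by rewrite mulr_gt0.
have hi i : 2 * r <= `|p 0 i - x 0 i| -> plateau ((x 0 i - p 0 i) / r) = 0.
  by move=> hr; apply: plateau0; rewrite normrM normfV (gtr0_norm r0) ler_pdivlMr// distrC.
have : exists i, 2 * r <= `|p 0 i - x 0 i|.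
  apply: contrapT => /forallNP h2; apply: h; apply/(ball_coordP _ _ r20) => i.
  by rewrite ltNge; apply/negP/h2.
move=> [i]; rewrite /bump; move: i.
by apply: forall_ord3 => /hi ->; rewrite ?mulr0 ?mul0r.
Qed.

End Bumps.

(** * Partition of unity *)

Section Partition.
Context {R : realType}.
Local Notation E3 := 'rV[R]_3.

Definition cube (p : E3) (r : R) : set E3 :=
  [set v | forall i, `[p 0 i - r, p 0 i + r]%classic (v 0 i)].

Lemma cube_compact p r : compact (cube p r).
Proof.
apply: (@rV_compact _ 3 (fun i => `[p 0 i - r, p 0 i + r]%classic)) => i.
exact: segment_compact.
Qed.

Lemma cubeE p r x : cube p r x <-> forall i, `|p 0 i - x 0 i| <= r.
Proof.
split=> h i; have := h i; rewrite /= in_itv /= ler_norml; first by lra.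
by move=> h'; lra.
Qed.

Lemma closure_ball_sub (p : E3) (r r' : R) : 0 < r < r' ->
  closure (ball p r) `<=` ball p r'.
Proof.
move=> /andP[r0 rr'] x cx; have d0 : 0 < r' - r by rewrite subr_gt0.
have [y [py xy]] := cx (ball x (r' - r)) (nbhsx_ballx x _ d0).
rewrite -(subrKC r r'); apply: ball_triangle py _; exact: ball_sym.
Qed.

Lemma ball_sub_cube (p : E3) (r : R) : 0 < r -> ball p r `<=` cube p r.
Proof.
by move=> r0 x /(ball_coordP _ _ r0) h; apply/cubeE => i; exact/ltW/h.
Qed.

Lemma Ck3_prod k (b : nat -> E3 -> R) n : (forall j, Ck3 k (b j)) ->
  Ck3 k (fun x => \prod_(j < n) (1 - b j x)).
Proof.
move=> Cb; elim: n => [|n IH].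
  by under eq_fun do rewrite big_ord0; exact: Ck3_cst.
under eq_fun do rewrite big_ord_recr /=; apply: Ck3M => //.
apply: Ck3D; first exact: Ck3_cst.
rewrite (_ : (fun _ => _) = (fun x => (-1) * b n x)); last first.
  by apply/funext => x; rewrite mulN1r.
by apply: Ck3M => //; exact: Ck3_cst.
Qed.

(** The sum is 1 wherever some [b i] is 1, so these products give a partition of unity without
    dividing by a sum of bumps. *)
Lemma sum_telescope (b : nat -> R) n :
  \sum_(i < n) b i * \prod_(j < i) (1 - b j) = 1 - \prod_(j < n) (1 - b j).
Proof.
elim: n => [|n IH]; first by rewrite !big_ord0 subrr.
by rewrite !big_ord_recr /= IH; ring.
Qed.

Lemma tube_partition (S K : set E3) : compact K ->
  (forall p, K p -> exists T, tube_ok S T /\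
     exists W, [/\ open W, W p & S `&` W `<=` tube_base T]) ->
  exists (n : nat) (T : 'I_n -> tube) (h : 'I_n -> E3 -> R),
    [/\ forall i, tube_ok S (T i),
        forall i, test_function (h i),
        forall i, supp (h i) `&` S `<=` tube_base (T i)
      & forall x, K x -> \forall y \near x, \sum_(i < n) h i y = 1].
Proof.
move=> cK hK.
have /choice[F hF] : forall p, exists q : @tube R * R, K p ->
    [/\ tube_ok S q.1, 0 < q.2 & S `&` ball p (3 * q.2) `<=` tube_base q.1].
  move=> p; have [Kp|nKp] := pselect (K p); last by exists (Tube 0 0 (cst 0) (cst 0) (cst 0) 0, 0).
  have [T [okT [W [oW Wp SW]]]] := hK p Kp.
  have /nbhs_ballP[e /= e0 We] : nbhs p W by exact: open_nbhs_nbhs (conj oW Wp).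
  (* A bump of radius [r] is 1 on the ball of radius [r] and vanishes off that of radius [2 r]; its
     closed support then lies in the ball of radius [3 r], on which [S] must lie in the arc. *)
  exists (T, e / 3) => _ /=; split=> //; first by rewrite divr_gt0.
  by rewrite mulrC divfK// => y [Sy /We Wy]; exact: SW.
move: cK; rewrite compact_cover => /(_ E3 K (fun p => interior (ball p (F p).2))).
case.
- by move=> p _; exact: open_interior.
- move=> p Kp; exists p => //; have [_ r0 _] := hF p Kp.
  exact: nbhsx_ballx.
move=> D DK Kcov; pose s := finmap.enum_fset D.
have sK i : (i < size s)%N -> K (nth 0 s i).
  by move=> si; apply/set_mem/DK; exact: mem_nth.
pose b (i : nat) := bump (nth 0 s i) (F (nth 0 s i)).2.
exists (size s), (fun i => (F (nth 0 s i)).1),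
  (fun i x => b i x * \prod_(j < i) (1 - b j x)).
have suppb (i : 'I_(size s)) :
    supp (fun x => b i x * \prod_(j < i) (1 - b j x)) `<=`
    ball (nth 0 s i) (3 * (F (nth 0 s i)).2).
  have [_ r0 _] := hF _ (sK _ (ltn_ord i)).
  apply: (@subset_trans _ (closure (ball (nth 0 s i) (2 * (F (nth 0 s i)).2)))).
    apply: closure_subset => x /= hx; apply: contrapT => nb.
    by move: hx; rewrite /b bump0// mul0r eqxx.
  by apply: closure_ball_sub; lra.
split=> [i|i|i|x Kx].
- by have [] := hF _ (sK _ (ltn_ord i)).
- split.
    apply/smooth3P => k; apply: Ck3M; first exact: smooth_bump.
    by apply: Ck3_prod => j; exact: smooth_bump.
  have [_ r0 _] := hF _ (sK _ (ltn_ord i)).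
  apply: (subclosed_compact _ (@cube_compact (nth 0 s i) (3 * (F (nth 0 s i)).2))).
    exact: closed_closure.
  by apply: subset_trans (suppb i) _; apply: ball_sub_cube; rewrite mulr_gt0.
- have [_ _] := hF _ (sK _ (ltn_ord i)); apply: subset_trans.
  by move=> y [/suppb ? ?].
have [p /= pD ip] := Kcov x Kx.
have ps : p \in s by [].
have si : (index p s < size s)%N by rewrite index_mem.
apply: filterS ip => y yb.
rewrite (sum_telescope (b ^~ y)) (bigD1 (Ordinal si)) //= /b nth_index// bump1//.
  by rewrite subrr mul0r subr0.
have Kp : K p by apply/set_mem/DK.
by have [] := hF p Kp.
Qed.

End Partition.

(** * The delta integral over a tube *)

Section TubeIntegral.
Context {R : realType}.
Local Notation E3 := 'rV[R]_3.
Local Notation mu := (@lebesgue_measure R).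

(** * Finite exceptional sets and measurability *)

Lemma compact_discrete_finite {T : ptopologicalType} (K F : set T) : compact K -> F `<=` K ->
  (forall x, K x -> \forall y \near x, F y -> y = x) -> finite_set F.
Proof.
move=> cK FK h.
move: cK; rewrite compact_cover.
move=> /(_ T K (fun x => interior [set y | F y -> y = x])); case.
- by move=> x _; exact: open_interior.
- by move=> x Kx; exists x => //; exact: h.
move=> D DK Kcov; apply: (sub_finite_set _ (finite_fset D)) => y Fy.
have [x /= xD /interior_subset/(_ Fy) ->] := Kcov y (FK y Fy).
exact: xD.
Qed.

Lemma measurable_fun_finite (F : set R) (f : R -> R) : finite_set F ->
  measurable_fun F f.
Proof.
move=> fF _ Y _; apply: countable_measurable; first by move=> x; exact: measurable_set1.
by apply: finite_set_countable; apply: sub_finite_set fF; exact: subIsetl.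
Qed.

(** Only [g] is assumed measurable. This matters for [delta_at0], whose value is unknown at the
    finitely many [s] with the arc point on the boundary of [U]. *)
Lemma Rintegral_eq_off_finite (D F : set R) (f g : R -> R) : measurable D ->
  measurable_fun D g -> finite_set F -> (forall s, D s -> ~ F s -> f s = g s) ->
  (\int[mu]_(s in D) f s = \int[mu]_(s in D) g s)%R.
Proof.
move=> mD mg fF fg; have mF : measurable F.
  apply: countable_measurable; first by move=> x; exact: measurable_set1.
  exact: finite_set_countable.
have mf : measurable_fun D f.
  rewrite -(setDUK (A := D `&` F) (B := D)); last exact: subIsetl.
  apply/measurable_funU; [exact: measurableI|exact/measurableD/measurableI|split].
    by apply: measurable_fun_finite; apply: sub_finite_set fF; exact: subIsetr.
  apply: (eq_measurable_fun g).
    by move=> s; rewrite inE => -[Ds nF]; rewrite fg// => Fs; exact: nF.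
  by apply: measurable_funS mg => //; exact: subDsetl.
rewrite /Rintegral; congr fine; apply: ae_eq_integral => //.
- exact/measurable_EFinP.
- exact/measurable_EFinP.
exists F; split=> //; first exact/countable_lebesgue_measure0/finite_set_countable.
move=> s /= /not_implyP[Ds ne]; apply: contrapT => nF; apply: ne.
by rewrite fg.
Qed.

Lemma open_preimage_on (B : set R) (c : R -> E3) (U : set E3) : open B -> open U ->
  (forall t, B t -> {for t, continuous c}) -> open (B `&` c @^-1` U).
Proof.
move=> oB oU cc; rewrite openE => t [Bt Ut].
apply: filterI; first exact: open_nbhs_nbhs (conj oB Bt).
by apply: cc => //; exact: open_nbhs_nbhs (conj oU Ut).
Qed.

Lemma measurable_along (B D : set R) (c : R -> E3) (U : set E3) (f : E3 -> R) :
  open B -> measurable D -> D `<=` B -> (forall t, B t -> {for t, continuous c}) ->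
  open U -> continuous f -> measurable_fun D (fun t => \1_(~` U) (c t) * f (c t)).
Proof.
move=> oB mD DB cc oU cf.
have mB : measurable B by exact: open_measurable.
have mfc : measurable_fun D (fun t => f (c t)).
  apply: measurable_funS DB _ => //.
  apply: open_continuous_measurable_fun => // t; rewrite inE => Bt.
  by apply: continuous_comp; [exact: cc|exact: cf].
apply: measurable_funM => //.
rewrite (_ : (fun t => _) = \1_(~` (c @^-1` U))); last first.
  by apply/funext => t; rewrite !indicE; congr (_ %:R); rewrite !in_setC; congr (~~ _);
    apply/asboolP/asboolP.
(* The curve is only known to be continuous on [B], so the preimage of [U] is open only after
   intersection with [B]. *)
apply: (@eq_measurable_fun _ _ _ _ D (\1_(~` (B `&` c @^-1` U)) : R -> R)).
  move=> t; rewrite inE => /DB Bt; rewrite !indicE !in_setC in_setI; congr ((~~ _)%:R).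
  by rewrite mem_set.
apply: measurable_indic; apply: measurableC.
by apply: open_measurable; exact: open_preimage_on.
Qed.

Lemma test_continuous (f : E3 -> R) : test_function f -> continuous f.
Proof.
move=> [/smooth3P sf _] x; apply: differentiable_continuous.
exact: Ck3_diff (sf 0%N).
Qed.

Lemma indic_locally_constant (U : set E3) x : ~ boundary U x ->
  \forall y \near x, \1_(~` U) y = \1_(~` U) x :> R.
Proof.
move=> nb; have [ix|nix] := pselect (interior U x).
  have Ux := interior_subset ix; apply: filterS ix => y Uy.
  by rewrite !indicE !in_setC !mem_set.
have [cx|ncx] := pselect (closure U x); first by exfalso; exact: nb.
have : open_nbhs x (~` closure U).
  by split=> //; apply: closed_openC; exact: closed_closure.
move=> /open_nbhs_nbhs; apply: filterS => y ncy.
by rewrite !indicE !in_setC !memNset// => /subset_closure.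
Qed.

Lemma tube_map_cvg (T : tube) (th s : R) :
  tube_map T r th s @[r --> 0] --> tarc T s.
Proof.
have [d _] : derivable (fun r' => tube_map T r' th s) 0 1 /\
    derive1 (fun r' => tube_map T r' th s) 0 = cos th *: tfu T s + sin th *: tfv T s.
  apply: derive1_curveP => i; under eq_fun do rewrite tube_mapE.
  rewrite (_ : (fun _ => _) = (fun r' => cst (tarc T s 0 i) r' +
      (cos th * tfu T s 0 i * id r' + sin th * tfv T s 0 i * id r'))); last first.
    by apply/funext => r'; rewrite /cst /=; ring.
  have h := is_derive_affine (cos th * tfu T s 0 i) (sin th * tfv T s 0 i)
    (is_derive_cst (tarc T s 0 i) (0 : R) 1) (is_derive_id (0 : R) (1 : R))
    (is_derive_id (0 : R) (1 : R)).
  by apply: is_derive_eq; rewrite !mxE; ring.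
have := derivable_continuous d; rewrite /prop_for /continuous_at.
by rewrite {2}/tube_map !mul0r !scale0r !addr0.
Qed.

Lemma cancel_ratio (a q r t : R) : r != 0 -> a * (q / t) = a * (r * q) / (t * r).
Proof. by move=> r0; rewrite (mulrC r) -(mulrA a) -mulf_div divff// mulr1. Qed.

(** Off the boundary of [U] the indicator is constant for small [r], and the quotient by [r] of the
    Jacobian tends to 1. The limit is independent of [th], so the integral over the angle just
    removes the [2 * pi]. *)
Lemma delta_at0E (S U : set E3) (f h : E3 -> R) (T : tube) (th s : R) :
  tube_ok S T -> continuous f -> continuous h -> tlo T <= s <= thi T ->
  ~ boundary U (tarc T s) ->
  delta_at0 (fun r => let x := tube_map T r th s in
    \1_(~` U) x * f x * h x * tube_jac T r th s / (2 * pi * r)) =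
  \1_(~` U) (tarc T s) * f (tarc T s) * h (tarc T s) / (2 * pi).
Proof.
move=> [_ [/smooth_curve_onP[B [oB AB sx]] _ _ _]].
move=> [/smooth_curve_onP[B1 [oB1 AB1 sU]] /smooth_curve_onP[B2 [oB2 AB2 sV]] rh] _ _.
move=> cf ch sl nb; have sI : `[tlo T, thi T]%classic s by rewrite /= in_itv.
have dx := curve_smooth_derivable oB sx (AB _ sI).
have dU := curve_smooth_derivable oB1 sU (AB1 _ sI).
have dV := curve_smooth_derivable oB2 sV (AB2 _ sI).
set k := dot (cos th *: derive1 (tfu T) s + sin th *: derive1 (tfv T) s)
  (derive1 (tarc T) s).
have pi0 : 2 * pi != 0 :> R by rewrite mulf_neq0 ?gt_eqF// pi_gt0.
have cm := @tube_map_cvg T th s.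
rewrite /delta_at0; apply: cvg_lim => //=.
have e : \forall r \near 0^'+, \1_(~` U) (tarc T s) * f (tube_map T r th s) *
    h (tube_map T r th s) * ((1 + r * k) / (2 * pi)) =
    \1_(~` U) (tube_map T r th s) * f (tube_map T r th s) *
    h (tube_map T r th s) * tube_jac T r th s / (2 * pi * r).
  have h1 : \forall r \near 0, \1_(~` U) (tube_map T r th s) = \1_(~` U) (tarc T s) :> R :=
    cm _ (indic_locally_constant nb).
  have h2 : \forall r \near 0^'+, \1_(~` U) (tube_map T r th s) = \1_(~` U) (tarc T s) :> R.
    exact: cvg_within h1.
  have h3 : \forall r \near (0:R)^'+, 0 < r by exact: nbhs_right_gt.
  apply: filterS2 h2 h3 => r -> r0.
  rewrite tube_jacE//; last exact: rh.
  have r1 : r != 0 by rewrite gt_eqF.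
  exact: cancel_ratio.
apply: cvg_trans (near_eq_cvg e) _.
have -> : \1_(~` U) (tarc T s) * f (tarc T s) * h (tarc T s) / (2 * pi) =
  \1_(~` U) (tarc T s) * f (tarc T s) * h (tarc T s) * ((1 + 0 * k) / (2 * pi)).
  by rewrite mul0r addr0 mul1r.
have cm' : tube_map T r th s @[r --> 0^'+] --> tarc T s by exact: cvg_within_filter.
apply: cvgM; first apply: cvgM; first apply: cvgM.
- exact: cvg_cst.
- exact: continuous_cvg (cf _) cm'.
- exact: continuous_cvg (ch _) cm'.
- apply: cvgM; last exact: cvg_cst.
  apply: cvgD; first exact: cvg_cst.
  apply: cvgM; last exact: cvg_cst.
  by apply: cvg_within_filter; exact: cvg_id.
Qed.

Lemma tube_integralE (S U : set E3) (f h : E3 -> R) (T : tube) :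
  tube_ok S T -> open U -> continuous f -> continuous h ->
  finite_set [set s | `[tlo T, thi T]%classic s /\ boundary U (tarc T s)] ->
  tube_integral U f h T =
  (\int[mu]_(s in `[tlo T, thi T]) (\1_(~` U) (tarc T s) * (f (tarc T s) * h (tarc T s))))%R.
Proof.
move=> okT oU cf ch fF; apply: Rintegral_eq_off_finite fF _ => //.
  have [_ [/smooth_curve_onP[B [oB AB sx]] _ _ _] _ _ _] := okT.
  apply: (measurable_along (f := fun y => f y * h y) oB _ AB _ oU) => //.
    by move=> t Bt; exact/derivable_continuous/(curve_smooth_derivable oB sx).
  by move=> y; apply: continuousM; [exact: cf|exact: ch].
move=> s sI nF; have nb : ~ boundary U (tarc T s) by move=> b; apply: nF.
have sl : tlo T <= s <= thi T by move: sI; rewrite /= in_itv.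
have pi0 : 0 < pi :> R by exact: pi_gt0.
transitivity (\int[mu]_(th in `[0%R, 2 * pi]) (\1_(~` U) (tarc T s) * f (tarc T s) *
    h (tarc T s) / (2 * pi)))%R.
  by apply: eq_Rintegral => th _; exact: (delta_at0E _ okT).
rewrite Rintegral_cst//= lebesgue_measure_itv/= lte_fin mulr_gt0// -EFinB /= subr0.
by rewrite divfK ?mulrA// mulf_neq0// gt_eqF.
Qed.

(** * Crossings of an arc with the boundary of the neighbourhood *)

Lemma diff_dot (g : E3 -> R) p v : differentiable g p -> 'd g p v = dot v (gradient g p).
Proof.
move=> dg; rewrite [in LHS](row_sum_delta v) linear_sum /dot; apply: eq_bigr => i _.
by rewrite linearZ /= /gradient mxE /pder deriveE.
Qed.

Lemma near_neq0 (f : R -> R) (x d : R) : is_derive x 1 f d -> d != 0 -> f x = 0 ->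
  \forall y \near x, f y = 0 -> y = x.
Proof.
move=> /is_derive1_caratheodory[g [fE cg gx]] d0 fx.
have : \forall y \near x, g y != 0.
  have := cg [set z | z != 0]; apply; rewrite gx.
  by apply: open_nbhs_nbhs; split=> //; exact: open_neq.
apply: filterS => y gy fy; have := fE y; rewrite fx fy subr0 => /esym/eqP.
by rewrite mulf_eq0 (negPf gy) /= subr_eq0 => /eqP.
Qed.

(** By perpendicularity the tangent of the chart is [k] times the gradient of [g], with [k] nonzero
    by regularity. So [g] along the chart has derivative [k |grad g|^2], which is nonzero, and an
    isolated zero; [tau] transfers this from parameters to points of [S]. *)
Lemma boundary_isolated (S U : set E3) p : smooth_point S p -> S p -> boundary U p ->
  perpendicular_surface_at S (boundary U) p ->
  \forall y \near p, S y -> boundary U y -> y = p.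
Proof.
move=> [W [r [c [tau [[oW r0] [sc c0] cp imc [ctau tauK]]]]]] Sp bp.
move=> [W' [g [[oW' W'p] sg g0 bU perp]]].
have r00 : - r < 0 < r by rewrite oppr_lt0 r0.
have I0 : `]- r, r[%classic (0 : R) by rewrite /= in_itv.
have gp : g p = 0 by have : (boundary U `&` W') p by []; rewrite bU => -[].
have [k ek] : exists k, derive1 c 0 = k *: gradient g p.
  apply: perp; exists c; split=> //.
    by move=> t ->; exact: sc.
  apply: filterS (near_itvoo r00) => t tr.
  have : (c @` `]- r, r[) (c t) by exists t => //=; rewrite in_itv.
  by rewrite imc => -[].
have dg : differentiable g p by have := nbhs_singleton (sg p W'p) [::].
have dc : derivable c 0 1 by have := nbhs_singleton (sc 0 I0) 0%N.
have dgc : is_derive (0:R) 1 (g \o c) (k * dot (gradient g p) (gradient g p)).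
  have dc' : differentiable c 0 by exact/derivable1_diffP.
  have dg' : differentiable g (c 0) by rewrite cp.
  split; first by apply/derivable1_diffP; exact: differentiable_comp.
  rewrite -derive1E derive1E'; last exact: differentiable_comp.
  rewrite diff_comp//= -derive1E' // cp ek diff_dot// dotZl.
  by [].
have nz : k * dot (gradient g p) (gradient g p) != 0.
  rewrite mulf_neq0//; last by rewrite gt_eqF// dot_gt0// g0.
  by apply: contra (c0 0 r00) => /eqP k0; rewrite ek k0 scale0r.
have [|d d0 hd] := nbhs_itvP (near_neq0 dgc nz _); first by rewrite /= cp.
have SWp : (S `&` W) p by rewrite -imc -cp; exists 0.
have tp : tau p = 0 by rewrite -cp tauK.
have := (within_continuousP _ _).1 ctau p SWp d d0; rewrite tp => h1.
have h2 : nbhs p W' by exact: open_nbhs_nbhs (conj oW' W'p).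
have h3 : nbhs p W by apply: open_nbhs_nbhs; split=> //; case: SWp.
apply: filterS3 h1 h2 h3 => y h W'y Wy Sy bUy.
have : (S `&` W) y by [].
rewrite -imc => -[t /=]; rewrite in_itv /= => tr ty.
have gy : g y = 0 by have : (boundary U `&` W') y by []; rewrite bU => -[].
have := h (conj Sy Wy); rewrite sub0r normrN -ty tauK// => td.
rewrite (_ : t = 0) ?cp//; apply: hd; last by rewrite /= ty.
by rewrite !add0r -ltr_norml.
Qed.

Lemma boundary_finite (S U : set E3) (T : tube) : tube_ok S T ->
  (forall p, S p -> boundary U p -> perpendicular_surface_at S (boundary U) p) ->
  finite_set [set s | `[tlo T, thi T]%classic s /\ boundary U (tarc T s)].
Proof.
move=> [_ [/smooth_curve_onP[B [oB AB sx]] _ inj base] _ _ _] perp.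
apply: (@compact_discrete_finite R `[tlo T, thi T]).
- exact: segment_compact.
- by move=> s [].
move=> s sI; have cx : {for s, continuous (tarc T)}.
  exact/derivable_continuous/(curve_smooth_derivable oB sx)/AB.
have [Sxs nP] : (S `\` P_Sigma S) (tarc T s) by apply: base; exists s.
have sp : smooth_point S (tarc T s) by apply: contrapT => ?; apply: nP.
have inS t : `[tlo T, thi T]%classic t -> S (tarc T t).
  by move=> tI; have [] : (S `\` P_Sigma S) (tarc T t) by apply: base; exists t.
have [b|nb] := pselect (boundary U (tarc T s)).
  have h : \forall t \near s, S (tarc T t) -> boundary U (tarc T t) ->
      tarc T t = tarc T s := cx _ (boundary_isolated sp Sxs b (perp _ Sxs b)).
  apply: filterS h => t h [tI bt]; apply: inj; rewrite ?inE//.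
  by apply: h => //; exact: inS.
have cb : closed (boundary U).
  apply: closedI; first exact: closed_closure.
  by apply: open_closedC; exact: open_interior.
have h : \forall t \near s, ~ boundary U (tarc T t) :=
  cx (~` boundary U) (open_nbhs_nbhs (conj (closed_openC cb) nb)).
by apply: filterS h => t h [_ bt]; exfalso; exact: h.
Qed.

End TubeIntegral.

(** * Local structure of the graph *)

Section GraphLocal.
Context {R : realType}.
Local Notation E3 := 'rV[R]_3.

(* Unlike [eint], open also for a loop, whose base point is left out. *)
Definition eoo (e : edge R) : set R :=
  match ekind e with
  | Segment a b => `]a, b[
  | Ray a => `]a, +oo[
  | Line => setT
  | Loop a b => `]a, b[
  end.

Lemma eoo_open e : open (eoo e).
Proof.
by rewrite /eoo; case: (ekind e) => *; first [exact: openT|exact: interval_open].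
Qed.

Lemma eoo_eint e : eoo e `<=` eint e.
Proof.
rewrite /eoo /eint; case: (ekind e) => [a b|a||a b] t //=.
by rewrite !in_itv /= => /andP[/ltW -> ->].
Qed.

Lemma eint_edom (e : edge R) : eint e `<=` edom e.
Proof.
rewrite /edom /eint; case: (ekind e) => [a b|a||a b] t //=; rewrite !in_itv /=.
- by move=> /andP[/ltW -> /ltW ->].
- by rewrite !andbT => /ltW.
- by move=> /andP[-> /ltW ->].
Qed.

Lemma eoo_edom (e : edge R) : eoo e `<=` edom e.
Proof. by move=> t /eoo_eint /eint_edom. Qed.

Lemma edom_measurable (e : edge R) : measurable (edom e).
Proof. by rewrite /edom; case: (ekind e). Qed.

Lemma edom_eoo_finite (e : edge R) : finite_set (edom e `\` eoo e).
Proof.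
have cc a b : finite_set (`[a, b] `\` `]a, b[ : set R).
  apply: (@sub_finite_set _ _ [set a; b]); last exact: finite_set2.
  move=> t []; rewrite /= !in_itv /= => /andP[at_ tb] /negP.
  by rewrite negb_and -!leNgt => /orP[] h; [left|right]; apply/eqP;
    rewrite eq_le ?h ?at_ ?tb.
rewrite /edom /eoo; case: (ekind e) => [a b|a||a b]; [exact: cc| |by rewrite setDT|exact: cc].
apply: (@sub_finite_set _ _ [set a]); last exact: finite_set1.
move=> t []; rewrite /= !in_itv /= !andbT => at_ /negP.
by rewrite -leNgt => h; apply/eqP; rewrite eq_le h at_.
Qed.

Lemma dot_continuous (v : E3) : continuous (fun y : E3 => dot v y).
Proof.
move=> y; rewrite (_ : (fun _ => _) = (fun y : E3 => v 0 o0 * id (y 0 o0) +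
  v 0 o1 * id (y 0 o1) + v 0 o2 * id (y 0 o2))); last first.
  by apply/funext => z; rewrite dotE.
apply/differentiable_continuous/(@Ck3_diff _ 0).
by apply: Ck3D; [apply: Ck3D|]; apply: Ck3M; (exact: Ck3_cst ||
  (apply: (@Ck3_coord R 0 id); exact: Ck_id)).
Qed.

Context (G : topological_graph R).
Local Notation e_ := (edge_of G).
Local Notation S := (Sigma_of G).

(** If [t] is not an interior parameter, its point is a vertex, which is impossible, or [t] is the
    end [b] of a loop. In the latter case the same point has the interior parameter [a], which
    forces [t0 = a], excluded from [eoo]. *)
Lemma edge_eval_inj i j t0 t : edges G i -> edges G j -> eoo (e_ i) t0 -> edom (e_ j) t ->
  e_ j t = e_ i t0 -> j = i /\ t = t0.
Proof.
move=> Ei Ej it0 jt e; have t0int := eoo_eint it0.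
have hint s : eint (e_ j) s -> e_ j s = e_ i t0 -> j = i /\ s = t0.
  move=> sint es; have ji : j = i.
    apply: (interiors_disjoint Ej Ei); exists (e_ i t0); split; last by exists t0.
    by exists s.
  split=> //; subst j; have [_ _ _ inj _] := edges_smooth Ei.
  by apply: inj; rewrite ?inE.
have nV : ~ vertices G (e_ i t0).
  move=> Vt; have : (e_ i @` eint (e_ i) `&` vertices G) (e_ i t0).
    by split=> //; exists t0.
  by rewrite interiors_vertices.
have [jint|njint] := pselect (eint (e_ j) t); first exact: hint.
have hV : eends (e_ j) (e_ j t) -> j = i /\ t = t0.
  by move=> /(ends_vertices Ej); rewrite e.
have [kok _ _ _ _] := edges_smooth Ej.
move: jt njint hV hint kok; rewrite /edom /eint /eends /kind_ok.
case kE : (ekind (e_ j)) => [a b|a||a b] /=; rewrite ?in_itv /= ?andbT.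
- move=> /andP[at_ tb] nt hV _ _; apply: hV; move: nt => /negP.
  by rewrite negb_and -!leNgt => /orP[] h; [left|right]; congr (ecurve _ _); apply/eqP;
    rewrite eq_le ?h ?at_ ?tb.
- move=> at_ nt hV _ _; apply: hV; move: nt => /negP; rewrite -leNgt => h.
  by congr (ecurve _ _); apply/eqP; rewrite eq_le h at_.
- by move=> _ /(_ I).
- move=> /andP[at_ tb] nt _ hint [ab per].
  have tb' : t = b.
    move: nt => /negP; rewrite at_ /= -leNgt => h.
    by apply/eqP; rewrite eq_le tb h.
  have [||ji at0] := hint a.
  + by rewrite in_itv /= lexx ab.
  + by rewrite -e tb' -[in RHS](subrKC a b) per.
  exfalso; move: it0; rewrite -ji /eoo kE /= in_itv /= -at0 ltxx //.
Qed.

Lemma eoo_not_vertex i t0 : edges G i -> eoo (e_ i) t0 -> ~ vertices G (e_ i t0).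
Proof.
move=> Ei /eoo_eint it0 Vt; have : (e_ i @` eint (e_ i) `&` vertices G) (e_ i t0).
  by split=> //; exists t0.
by rewrite interiors_vertices.
Qed.

Lemma edge_smooth_open i : edges G i -> exists B,
  [/\ open B, edom (e_ i) `<=` B & curve_smooth_on B (e_ i)].
Proof. by move=> /edges_smooth [_ /smooth_curve_onP]. Qed.

(** All the rest of the graph inside a cube, [C], is closed and misses the point. Local finiteness
    leaves finitely many pieces, and properness makes each piece compact even for an infinite
    edge. *)
Lemma local_edge i t0 k : edges G i -> eoo (e_ i) t0 -> 0 < k ->
  \forall y \near e_ i t0, S y -> exists t, [/\ t0 - k < t < t0 + k, edom (e_ i) t & e_ i t = y].
Proof.
move=> Ei it0 k0; set p := e_ i t0.
pose K := cube p 1; have cK : compact K by exact: cube_compact.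
have [fV fJ] := locally_finite G cK.
(* The edge [i] itself contributes to [C] its parameters far from [t0], since it must not return to
   the point. *)
pose A j : set R := if j == i then ~` [set t | t0 - k < t < t0 + k] else setT.
have cA j : closed (A j).
  by rewrite /A; case: ifP => _; [apply: open_closedC; exact: open_itvoo|exact: closedT].
pose J := [set j | edges G j /\ e_ j @` edom (e_ j) `&` K !=set0].
pose C := (vertices G `&` K) `|`
  \bigcup_(j in J) (e_ j @` ((edom (e_ j) `&` e_ j @^-1` K) `&` A j)).
have hE : hausdorff_space E3 by exact: norm_hausdorff.
have clC : closed C.
  apply: closedU; first by apply: compact_closed => //; exact: finite_compact.
  apply: closed_bigcup fJ _ => j [Ej _]; apply: compact_closed => //.
  apply: continuous_compact.
    have [B [oB dB sB]] := edge_smooth_open Ej.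
    apply: continuous_in_subspaceT => t; rewrite inE => -[[/dB Bt _] _].
    exact/derivable_continuous/(curve_smooth_derivable oB sB).
  have [_ _ _ _ proper] := edges_smooth Ej.
  by apply: compact_closedI => //; exact: proper.
have nC : ~ C p.
  case=> [[Vp _]|[j [Ej _] [t [[jt _] At]]]]; first exact: eoo_not_vertex Vp.
  move=> /(edge_eval_inj Ei Ej it0 jt) [ji tt0]; move: At.
  by rewrite /A ji eqxx /= tt0; apply; rewrite gtrBl k0 ltrDl.
have nK : nbhs p K by apply: filterS (ball_sub_cube ltr01) (nbhsx_ballx p 1 ltr01).
have nnC : nbhs p (~` C) by apply: open_nbhs_nbhs; split=> //; exact: closed_openC.
apply: filterS2 nK nnC => y Ky nCy Sy; apply: contrapT => nt; apply: nCy.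
case: Sy => [Vy|[j Ej [t jt ty]]]; first by left.
right; exists j; first by split=> //; exists y; split=> //; exists t.
exists t => //; split; first by split=> //=; rewrite ty.
rewrite /A; case: eqP => // ji tk; apply: nt; exists t; rewrite -ji//.
Qed.

(** Projection onto the tangent line at [t0] is strictly increasing along the edge near [t0]. Its
    inverse [psi] recovers the parameter from the point by a formula defined on the whole space. *)
Lemma edge_local_inverse i t0 : edges G i -> eoo (e_ i) t0 ->
  exists (k : R) (psi : R -> R), let m t := dot (derive1 (e_ i) t0) (e_ i t) in
    [/\ 0 < k,
        forall t, t0 - k < t < t0 + k -> eoo (e_ i) t,
        {in `]t0 - k, t0 + k[ &, {homo m : x y / x < y}},
        forall t, t0 - k < t < t0 + k -> psi (m t) = t
      & forall t, t0 - k < t < t0 + k -> exists2 d, 0 < d & is_derive (m t) 1 psi d].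
Proof.
move=> Ei it0; have [_ _ d0 _ _] := edges_smooth Ei.
have [B [oB dB sB]] := edge_smooth_open Ei.
set v := derive1 (e_ i) t0.
pose m t := dot v (e_ i t).
have Bt0 : B t0 by exact/dB/eoo_edom.
have vv : 0 < dot v v by apply: dot_gt0; exact/d0/eoo_edom.
have dm t : B t -> is_derive t 1 m (dot v (derive1 (e_ i) t)).
  by move=> Bt; exact/is_derive_dotr/(curve_smooth_derivable oB sB).
have cd : {for t0, continuous (fun t => dot v (derive1 (e_ i) t))}.
  apply: continuous_derivable; have [//] := is_derive_dotr v
    (curve_smooth_derivable oB (curve_smooth_derive1 oB sB) Bt0).
have n1 := cvg_near_norm cd vv.
have n2 := open_nbhs_nbhs (conj (@eoo_open (e_ i)) it0).
have [k k0 hk] := nbhs_itvP (filterI n1 n2).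
have {}hk t : t0 - k < t < t0 + k -> [/\ eoo (e_ i) t, B t & 0 < derive1 m t].
  move=> /hk [h et]; have Bt : B t by exact/dB/eoo_edom.
  split=> //; have [_] := dm t Bt; rewrite -derive1E => ->.
  by move: h; rewrite -/v ltr_norml => /andP[_]; rewrite ltrBlDr ltrDl.
have [||| inc [psi [psiK dpsi]]] := @increasing_local_inverse R m (t0 - k) (t0 + k).
- by rewrite ltrD2l gtrN.
- by move=> t /hk [_ Bt _]; have [] := dm t Bt.
- by move=> t /hk [].
exists k, psi; split=> //.
- by move=> t /hk [].
- move=> t tk; exists (derive1 m t)^-1; last exact: dpsi.
  by rewrite invr_gt0; have [] := hk t tk.
Qed.

Lemma eoo_smooth_point i t0 : edges G i -> eoo (e_ i) t0 -> smooth_point S (e_ i t0).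
Proof.
move=> Ei it0; have [k [psi [k0 kin inc psiK dpsi]]] := edge_local_inverse Ei it0.
have [_ _ d0 _ _] := edges_smooth Ei.
have [B [oB dB sB]] := edge_smooth_open Ei.
set v := derive1 (e_ i) t0 in inc psiK dpsi.
pose m t := dot v (e_ i t).
have le := local_edge Ei it0 k0.
have Bk t : t0 - k < t < t0 + k -> B t by move=> /kin /eoo_edom /dB.
have ce t : B t -> {for t, continuous (e_ i)}.
  by move=> Bt; exact/derivable_continuous/(curve_smooth_derivable oB sB).
have Bt0 : B t0 by exact/dB/eoo_edom.
have nW : \forall t \near t0, interior [set y | S y -> exists t,
    [/\ t0 - k < t < t0 + k, edom (e_ i) t & e_ i t = y]] (e_ i t).
  by apply: ce => //; exact: (nbhs_interior le).
have [r1 r10 hr1] := nbhs_itvP nW.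
pose r : R := Num.min r1 (k / 2).
have [rr1 rk] : r <= r1 /\ r <= k / 2 by rewrite /r !ge_min !lexx orbT.
have r0 : 0 < r by rewrite /r lt_min r10 divr_gt0.
have rng u : - r < u < r -> t0 - k < t0 + u < t0 + k.
  by move: rk k0; clear; lra.
have rng1 u : - r < u < r -> t0 - r1 < t0 + u < t0 + r1.
  by move: rr1; clear; lra.
have mon a b : t0 - k < a < t0 + k -> t0 - k < b < t0 + k -> (m a < m b) = (a < b).
  move=> ha hb; apply/idP/idP; last by apply: inc; rewrite in_itv.
  case: (ltgtP a b) => // [ba|->]; last by rewrite ltxx.
  have := inc b a; rewrite !in_itv /= => /(_ hb ha ba) h1 h2.
  by have := lt_trans h1 h2; rewrite ltxx.
have rb : - r < 0 < r by rewrite oppr_lt0 r0.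
have ends : t0 - k < t0 - r < t0 + k /\ t0 - k < t0 + r < t0 + k.
  by move: rk k0 r0; clear; lra.
(* By monotonicity of the projection, this slab forces parameters in the window of size [k] into the
   window of size [r]. *)
pose Wl := [set y : E3 | m (t0 - r) < dot v y < m (t0 + r)].
have cdot := @dot_continuous v.
have oWl : open Wl.
  apply: (@open_comp _ _ (dot v) [set z | m (t0 - r) < z < m (t0 + r)]).
    by move=> y _; exact: cdot.
  exact: open_itvoo.
exists (interior [set y | S y -> exists t,
    [/\ t0 - k < t < t0 + k, edom (e_ i) t & e_ i t = y]] `&` Wl), r,
  (fun u => e_ i (t0 + u)), (fun y => psi (dot v y) - t0).
have sub1 y : S y -> interior [set y | S y -> exists t,
    [/\ t0 - k < t < t0 + k, edom (e_ i) t & e_ i t = y]] y -> Wl y ->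
    exists u, - r < u < r /\ y = e_ i (t0 + u).
  move=> Sy /interior_subset/(_ Sy)[t [tk _ <-]] [/andP[h1 h2]].
  exists (t - t0); rewrite subrKC; split=> //.
  by move: h1 h2; rewrite !mon//; [move=> ? ?; apply/andP; split; lra|case: ends..].
split.
- by split=> //; apply: openI => //; exact: open_interior.
- split.
    apply/smooth_curve_onP; exists [set u | - r < u < r]; split.
    + exact: open_itvoo.
    + by move=> u /=; rewrite in_itv.
    + apply: (curve_smooth_comp (O' := B)) => //; first by move=> u /rng /Bk.
      by move=> n; apply: CkD; [exact: Ck_cst|exact: Ck_id].
  move=> u /rng ur.
  have dsh : is_derive u 1 (fun u => t0 + u) 1.
    rewrite -[X in is_derive _ _ _ X]add0r.
    exact: (is_deriveD (is_derive_cst t0 u 1) (is_derive_id u 1)).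
  have [_ ->] := derive1_curve_comp (curve_smooth_derivable oB sB (Bk _ ur)) dsh.
  by rewrite scale1r; apply: d0; exact/eoo_edom/kin.
- by rewrite addr0.
- apply/seteqP; split=> [y [u /=]|y [Sy [Wy Wly]]].
    rewrite in_itv /= => ur <-; split; first by right; exists i => //; exists (t0 + u) => //;
      exact/eoo_edom/kin/rng.
    split; first exact/hr1/rng1.
    have h := rng u ur; rewrite /Wl /= -!/(m _) !mon //; [|by case: ends..].
    by move: ur; clear; lra.
  by have [u [ur ->]] := sub1 y Sy Wy Wly; exists u => //=; rewrite in_itv.
- split; last by move=> u /rng ur; rewrite psiK// addrC addKr.
  apply: continuous_in_subspaceT => y; rewrite inE => -[Sy [Wy Wly]].
  have [u [ur ->]] := sub1 y Sy Wy Wly.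
  have [d _ [dp _]] := dpsi _ (rng _ ur).
  apply: continuousB; last exact: cst_continuous.
  by apply: continuous_comp; [exact: cdot|exact: continuous_derivable].
Qed.

Lemma P_Sigma_near_eoo i t0 : edges G i -> eoo (e_ i) t0 ->
  \forall y \near e_ i t0, ~ P_Sigma S y.
Proof.
move=> Ei it0; have [k k0 hk] := nbhs_itvP
  (open_nbhs_nbhs (conj (@eoo_open (e_ i)) it0)).
apply: filterS (local_edge Ei it0 k0) => y h [Sy]; apply.
have [t [/hk it _ <-]] := h Sy; exact: eoo_smooth_point.
Qed.

End GraphLocal.

(** * Transition maps *)

Section Analysis.
Context {R : realType}.
Local Notation mu := (@lebesgue_measure R).

(** Dominated convergence speaks of sequences; this brings it to bear on a real parameter. *)
Lemma within_sequential (f : R -> R) (B : set R) (s0 e : R) :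
  (forall u : nat -> R, (forall n, B (u n)) -> u n @[n --> \oo] --> s0 ->
    f (u n) @[n --> \oo] --> f s0) ->
  0 < e -> \forall b \near s0, B b -> `|f s0 - f b| < e.
Proof.
move=> h e0; apply: contrapT => nh.
have hn (n : nat) : exists b, [/\ B b, `|s0 - b| < n.+1%:R^-1 & e <= `|f s0 - f b|].
  apply: contrapT => /forallNP hb; apply: nh.
  exists n.+1%:R^-1 => /=; first by rewrite invr_gt0.
  move=> b sb Bb; rewrite ltNge; apply/negP => eb.
  by apply: (hb b); split.
have [u hu] := choice hn.
have us : u n @[n --> \oo] --> s0.
  apply/cvgrPdist_lt => d d0; near=> n.
  have [_ h1 _] := hu n; apply: lt_trans h1 _; near: n.
  exact: (near_infty_natSinv_lt (PosNum d0)).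
have := h u (fun n => let: And3 a _ _ := hu n in a) us.
move=> /cvgrPdist_lt /(_ e e0) [n _ /(_ n (leqnn n)) /=].
by have [_ _] := hu n; rewrite leNgt => /negP.
Unshelve. all: by end_near.
Qed.

(** Dominated convergence with bound [|H|]. It serves twice: for the swept part of an edge as the
    arc grows, and for the part of an edge outside [U e] as [e] tends to 0. *)
Lemma Rintegral_family_cont (D : set R) (H : R -> R) (A : R -> set R) (B N : set R) (s0 : R) :
  measurable D -> mu.-integrable D (EFin \o H) ->
  (forall b, B b -> measurable (A b)) -> B s0 -> finite_set N ->
  (forall t, D t -> ~ N t -> \forall b \near s0, B b -> (A b t <-> A s0 t)) ->
  forall e : R, 0 < e -> \forall b \near s0, B b ->
  `|(\int[mu]_(t in D) (\1_(A s0) t * H t))%R - (\int[mu]_(t in D) (\1_(A b) t * H t))%R| < e.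
Proof.
move=> mD iH mA Bs0 fN hN e e0.
have mH : measurable_fun D H by apply/measurable_EFinP; exact: (measurable_int mu).
apply: (@within_sequential (fun b => (\int[mu]_(t in D) (\1_(A b) t * H t))%R)) => //.
move=> u Bu us.
have mf b : B b -> measurable_fun D (fun t => (\1_(A b) t * H t)%:E).
  move=> Bb; apply/measurable_EFinP; apply: measurable_funM => //.
  by apply: measurable_indic; exact: (mA _ Bb).
have leH b t : (`|(\1_(A b) t * H t)%:E| <= (`|H t|)%:E)%E.
  rewrite lee_fin normrM indicE; case: (_ \in _); rewrite ?normr1 ?mul1r//.
  by rewrite normr0 mul0r.
have [|||||i0 _ cv] := @dominated_convergence _ _ _ mu D mD
  (fun n t => (\1_(A (u n)) t * H t)%:E) (fun t => (\1_(A s0) t * H t)%:E)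
  (fun t => (`|H t|)%:E).
- move=> n; exact: (mf _ (Bu n)).
- exact: (mf _ Bs0).
- exists N; split.
  + apply: countable_measurable; first by move=> x; exact: measurable_set1.
    exact: finite_set_countable.
  + exact/countable_lebesgue_measure0/finite_set_countable.
  + move=> t /= /not_implyP[Dt ncv]; apply: contrapT => Nt; apply: ncv.
    have near_t : \forall n \near \oo, B (u n) -> (A (u n) t <-> A s0 t) :=
      us _ (hN t Dt Nt).
    have ev : \forall n \near \oo, (\1_(A s0) t * H t)%:E = (\1_(A (u n)) t * H t)%:E.
      apply: filterS near_t => n /(_ (Bu n)) AE.
      rewrite !indicE (_ : (t \in A s0) = (t \in A (u n)))//.
      have [At|nAt] := pselect (A s0 t); first by rewrite !mem_set//; exact/AE.
      by rewrite !memNset// => /AE.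
    by apply: cvg_trans (near_eq_cvg ev) _; exact: cvg_cst.
- have := integrable_abse iH; apply: eq_integrable => // t _.
- by apply/aeW => t n _; exact: leH.
have fin : (\int[mu]_(t in D) (\1_(A s0) t * H t)%:E)%E \is a fin_num.
  exact: integrable_fin_num.
rewrite /Rintegral; apply: (@fine_cvg _ _ _ _
  (fun n => \int[mu]_(t in D) (\1_(A (u n)) t * H t)%:E)%E).
by rewrite fineK.
Qed.

(** The interval is split at one exceptional point at a time; continuity joins the two halves. *)
Lemma constant_off_seq (Phi : R -> R) (s : seq R) (u v : R) : u < v ->
  {within `[u, v], continuous Phi} ->
  (forall z, u < z < v -> z \notin s -> is_derive z 1 Phi 0) -> Phi u = Phi v.
Proof.
elim: s u v => [|z s IH] u v uv cP dP.
  have [|c _] := @MVT R Phi (cst 0) u v uv _ cP.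
    by move=> x; rewrite in_itv /= => xuv; exact: dP.
  by rewrite mul0r => /eqP; rewrite subr_eq0 => /eqP.
have [/andP[uz zv]|nz] := boolP (u < z < v); last first.
  apply: IH => // y yuv ys; apply: dP => //; rewrite inE negb_or ys andbT.
  by apply: contra nz => /eqP <-.
transitivity (Phi z).
- apply: IH => //.
    by apply: continuous_subspaceW cP; apply: subset_itvl; rewrite bnd_simp ltW.
  move=> y /andP[uy yz] ys; apply: dP; first by rewrite uy (lt_trans yz).
  by rewrite inE negb_or ys andbT lt_eqF.
- apply: IH => //.
    by apply: continuous_subspaceW cP; apply: subset_itvr; rewrite bnd_simp ltW.
  move=> y /andP[zy yv] ys; apply: dP; first by rewrite yv (lt_trans uz).
  by rewrite inE negb_or ys andbT gt_eqF.
Qed.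

Lemma near_eq_continuous (f g : R -> R) (s : R) : (\forall t \near s, f t = g t) ->
  {for s, continuous f} -> {for s, continuous g}.
Proof.
move=> fg cf; rewrite /prop_for /continuous_at -(nbhs_singleton fg).
exact: cvg_trans (near_eq_cvg fg) cf.
Qed.

(** Both signs are needed because an edge may run along the arc backwards. Regularity on the larger
    interval []c, d[] supplies the one-sided limits at [a] and [b]. *)
Lemma substitution_nbhd (phi phi' G : R -> R) (a b c d : R) : c < a -> a <= b -> b < d ->
  (forall s, c < s < d -> is_derive s 1 phi (phi' s)) ->
  (forall s, c < s < d -> {for s, continuous phi'}) ->
  (forall s, c < s < d -> {for phi s, continuous G}) ->
  ((forall s, c < s < d -> 0 < phi' s) ->
    (forall t, phi a <= t <= phi b <-> exists2 s, a <= s <= b & phi s = t) /\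
    (\int[mu]_(t in `[phi a, phi b]) G t =
    \int[mu]_(s in `[a, b]) (G (phi s) * phi' s))%R) /\
  ((forall s, c < s < d -> phi' s < 0) ->
    (forall t, phi b <= t <= phi a <-> exists2 s, a <= s <= b & phi s = t) /\
    (\int[mu]_(t in `[phi b, phi a]) G t =
    \int[mu]_(s in `[a, b]) (G (phi s) * - phi' s))%R).
Proof.
move=> ca ab bd dphi cphi' cG.
have cd s : a <= s <= b -> c < s < d by lra.
have cphi s : c < s < d -> {for s, continuous phi}.
  by move=> /dphi [h _]; exact: continuous_derivable.
have d1 s : c < s < d -> derive1 phi s = phi' s.
  by move=> /dphi [_ h]; rewrite derive1E.
have c1 s : c < s < d -> {for s, continuous (derive1 phi)}.
  move=> sd; apply: near_eq_continuous (cphi' s sd).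
  by apply: filterS (near_itvoo sd) => t td; rewrite d1.
have c1oo : {in `]a, b[, continuous (derive1 phi)}.
  by move=> s; rewrite in_itv /= => sab; apply: c1; lra.
have cl : cvg (derive1 phi x @[x --> a^'+]).
  by apply/cvg_ex; exists (derive1 phi a); apply: cvg_within_filter; apply: c1; lra.
have cr : cvg (derive1 phi x @[x --> b^'-]).
  by apply/cvg_ex; exists (derive1 phi b); apply: cvg_within_filter; apply: c1; lra.
have LR : derivable_oo_LRcontinuous phi a b.
  split.
  - by move=> s; rewrite in_itv /= => sab; have [] : is_derive s 1 phi (phi' s) by apply: dphi; lra.
  - by apply: cvg_within_filter; apply: cphi; lra.
  - by apply: cvg_within_filter; apply: cphi; lra.
have ivt t : phi a <= t <= phi b \/ phi b <= t <= phi a -> exists2 s, a <= s <= b & phi s = t.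
  move=> ht; have [||s] := @IVT R phi a b t ab.
  - apply: continuous_in_subspaceT => s; rewrite inE /= in_itv /= => /cd; exact: cphi.
  - by rewrite ge_min le_max; case: ht => /andP[-> ->]; rewrite ?orbT.
  - by rewrite in_itv /=; exists s.
split=> sg.
- have inc : {in `[a, b] &, {homo phi : x y / x < y}}.
    move=> x y; rewrite !in_itv /= => xab yab xy.
    have [||z [zcd _] e] := @MVT_near R phi phi' c d _ x y; try by lra.
    by rewrite -subr_gt0 e mulr_gt0// ?subr_gt0// sg.
  have le y z : a <= y -> y <= z -> z <= b -> phi y <= phi z.
    move=> ay; rewrite le_eqVlt => /predU1P[->//|yz] zb; apply/ltW/inc => //;
      by rewrite in_itv /=; move: ay yz zb; clear; lra.
  split=> [t|].
    split=> [h|[s /andP[as_ sb] <-]]; first exact: ivt (or_introl h).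
    by rewrite !le.
  rewrite /Rintegral integration_by_substitution_increasing//.
    congr fine; apply: eq_integral => s; rewrite inE /= in_itv /= => /cd sd.
    by rewrite -(d1 s sd).
  apply: continuous_in_subspaceT => t; rewrite inE /= in_itv /= => ht.
  by have [s /cd sd <-] := ivt t (or_introl ht); exact: cG.
- have dec : {in `[a, b] &, {homo phi : x y /~ x < y}}.
    move=> x y; rewrite !in_itv /= => xab yab xy.
    have [||z [zcd _] e] := @MVT_near R phi phi' c d _ y x; try by lra.
    by rewrite -subr_lt0 -opprB oppr_lt0 -opprB e -mulrN nmulr_rgt0 ?sg// opprB; lra.
  have le y z : a <= y -> y <= z -> z <= b -> phi z <= phi y.
    move=> ay; rewrite le_eqVlt => /predU1P[->//|yz] zb; apply/ltW/dec => //;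
      by rewrite in_itv /=; move: ay yz zb; clear; lra.
  split=> [t|].
    split=> [h|[s /andP[as_ sb] <-]]; first exact: ivt (or_intror h).
    by rewrite !le.
  rewrite /Rintegral integration_by_substitution_decreasing//.
    congr fine; apply: eq_integral => s; rewrite inE /= in_itv /= => /cd sd.
    by rewrite -(d1 s sd).
  apply: continuous_in_subspaceT => t; rewrite inE /= in_itv /= => ht.
  by have [s /cd sd <-] := ivt t (or_intror ht); exact: cG.
Qed.

Lemma transition (G : topological_graph R) (T : tube) i (s0 t0 : R) :
  tube_ok (Sigma_of G) T -> edges G i -> tlo T < s0 < thi T ->
  eoo (edge_of G i) t0 -> edge_of G i t0 = tarc T s0 ->
  exists (d sg : R) (phi : R -> R),
    [/\ 0 < d, sg = 1 \/ sg = -1 &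
        forall s, s0 - d < s < s0 + d ->
          [/\ tlo T < s < thi T, eoo (edge_of G i) (phi s),
              edge_of G i (phi s) = tarc T s &
              is_derive s 1 phi (sg / enorm (derive1 (edge_of G i) (phi s)))]].
Proof.
move=> [_ [/smooth_curve_onP[B [oB AB sx]] ux _ base] _ _ _] Ei s0l it0 et0.
have [k [psi [k0 kin inc psiK dpsi]]] := edge_local_inverse Ei it0.
have [_ _ e0 _ _] := edges_smooth Ei.
have [Be [oBe dBe sBe]] := edge_smooth_open Ei.
set e := edge_of G i in it0 et0 kin inc psiK dpsi e0 dBe sBe *.
set v := derive1 e t0 in inc psiK dpsi.
set x := tarc T in sx ux base et0 *.
have inB s : tlo T < s < thi T -> B s.
  by move=> /andP[h1 h2]; apply: AB; rewrite /= in_itv /= !ltW.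
have dx s : tlo T < s < thi T -> derivable x s 1.
  by move=> /inB; exact: curve_smooth_derivable.
pose phi s := psi (dot v (x s)).
have near1 : \forall s \near s0, tlo T < s < thi T /\
    exists t, [/\ t0 - k < t < t0 + k, e t = x s & phi s = t].
  have cx : {for s0, continuous x} by exact/derivable_continuous/dx.
  have h : \forall s \near s0, Sigma_of G (x s) -> exists t,
      [/\ t0 - k < t < t0 + k, edom e t & e t = x s].
    by have := local_edge Ei it0 k0; rewrite et0 => hh; exact: cx _ hh.
  apply: filterS2 h (near_itvoo s0l) => s h sl; split=> //.
  have [|t [tk _ ex]] := h.
    have [] // : (Sigma_of G `\` P_Sigma (Sigma_of G)) (x s).
    apply: base; exists s => //; rewrite /= in_itv /=.
    by case/andP: sl => /ltW -> /ltW ->.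
  by exists t; split=> //; rewrite /phi -ex psiK.
have [d1 d10 hd1] := nbhs_itvP near1.
have derphi s : s0 - d1 < s < s0 + d1 -> exists2 c, 0 < c &
    is_derive s 1 phi (c * dot v (derive1 x s)).
  move=> /hd1 [sl [t [tk ex ps]]].
  have [c c0 dc] := dpsi t tk; exists c => //.
  have dd := is_derive_dotr v (dx s sl).
  have dc' : is_derive (dot v (x s)) 1 psi c by rewrite -ex.
  exact: (@is_derive1_comp _ psi (fun s => dot v (x s)) s _ _ dc' dd).
(* Differentiating [e (phi s) = x s] gives [phi' e' = x'], hence [|phi'| |e'| = 1]. *)
have normphi s q : s0 - d1 < s < s0 + d1 -> is_derive s 1 phi q ->
    derive1 x s = q *: derive1 e (phi s) /\ `|q| * enorm (derive1 e (phi s)) = 1.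
  move=> sd dq; have [sl [t [tk ex ps]]] := hd1 s sd.
  have de : derivable e (phi s) 1.
    by rewrite ps; apply: curve_smooth_derivable oBe sBe _; exact/dBe/eoo_edom/kin.
  have [_ dcomp] := derive1_curve_comp de dq.
  have eq1 : derive1 x s = q *: derive1 e (phi s).
    rewrite -dcomp !derive1E; apply: near_eq_derive.
    apply: filterS (near_itvoo sd) => y yd; have [_ [t' [_ ex' ->]]] := hd1 y yd.
    by rewrite ex'.
  split=> //; rewrite -enormZ -eq1; apply: ux.
  by case/andP: sl => /ltW -> /ltW ->.
have s0d : s0 - d1 < s0 < s0 + d1 by rewrite gtrBl ltrDl d10.
have phis0 : phi s0 = t0 by rewrite /phi -et0 psiK// gtrBl ltrDl k0.
(* Otherwise [phi' s0 = 0], against [|phi'| |e'| = 1]. So this product keeps its sign near [s0], and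
   that sign is [sg]. *)
have nz : dot v (derive1 x s0) != 0.
  have [c c0 dc] := derphi s0 s0d.
  have [eq1 eq2] := normphi s0 _ s0d dc.
  apply/eqP => z; move: eq2; rewrite z mulr0 normr0 mul0r => /eqP.
  by rewrite eq_sym oner_eq0.
have cdot : {for s0, continuous (fun s => dot v (derive1 x s))}.
  apply: continuous_derivable; have [//] := is_derive_dotr v
    (curve_smooth_derivable oB (curve_smooth_derive1 oB sx) (inB s0 s0l)).
have nz0 : 0 < `|dot v (derive1 x s0)| by rewrite normr_gt0.
have [d2 d20 hd2] := nbhs_itvP (cvg_near_norm cdot nz0).
pose d : R := Num.min d1 d2.
have [dd1 dd2] : d <= d1 /\ d <= d2 by rewrite /d !ge_min !lexx orbT.
pose sg : R := if 0 < dot v (derive1 x s0) then 1 else -1.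
exists d, sg, phi; split.
- by rewrite /d lt_min d10.
- by rewrite /sg; case: ifP; [left|right].
move=> s sd.
have sd1 : s0 - d1 < s < s0 + d1 by move: sd dd1; clear; lra.
have sd2 : s0 - d2 < s < s0 + d2 by move: sd dd2; clear; lra.
have [sl [t [tk ex ps]]] := hd1 s sd1.
split=> //; first by rewrite ps; exact: kin.
  by rewrite ps.
have [c c0 dc] := derphi s sd1; have [_ eq2] := normphi s _ sd1 dc.
have en : 0 < enorm (derive1 e (phi s)).
  by apply: enorm_gt0; apply: e0; rewrite ps; exact/eoo_edom/kin.
suff -> : sg / enorm (derive1 e (phi s)) = c * dot v (derive1 x s) by [].
apply: (mulIf (lt0r_neq0 en)); rewrite divfK ?gt_eqF// -[LHS]mulr1 -eq2 mulrA.
congr (_ * _); have := hd2 s sd2; rewrite /sg.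
move: (dot v (derive1 x s0)) (dot v (derive1 x s)) c0; clear => p q c0.
case: (ltP 0 p) => p0.
  rewrite (gtr0_norm p0) ltr_norml => /andP[_ h].
  by rewrite mul1r gtr0_norm// mulr_gt0//; lra.
rewrite (ler0_norm p0) ltr_norml => /andP[h _].
by rewrite mulN1r ltr0_norm ?opprK// pmulr_rlt0//; lra.
Qed.

End Analysis.

(** * Arcs against edges *)

Section ArcIntegral.
Context {R : realType}.
Local Notation E3 := 'rV[R]_3.
Local Notation mu := (@lebesgue_measure R).
Context (G : topological_graph R).
Local Notation e_ := (edge_of G).
Local Notation S := (Sigma_of G).

Definition speed (i : nat) (t : R) : R := enorm (derive1 (e_ i) t).

Definition edge_integrand (U : set E3) (F : E3 -> R) (i : nat) (t : R) : R :=
  \1_(~` U) (e_ i t) * F (e_ i t) * speed i t.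

Lemma same_side (s s0 b : R) : s != s0 -> `|s0 - b| < `|s - s0| ->
  s <= b <-> s <= s0.
Proof.
case: (ltgtP s s0) => // h _; last first.
  rewrite [X in _ < X]gtr0_norm ?subr_gt0// ltr_norml => /andP[? ?].
  by split => // ?; lra.
rewrite [X in _ < X]ltr0_norm ?subr_lt0// ltr_norml => /andP[? ?].
by split => // _; lra.
Qed.

Lemma widen_itv (z d d' s : R) : d <= d' -> z - d < s < z + d -> z - d' < s < z + d'.
Proof. lra. Qed.

Lemma lt_sub_itv (u a b v s : R) : u < a -> b < v -> a <= s <= b -> u < s < v.
Proof. lra. Qed.

Lemma speed_continuous i B t : open B -> curve_smooth_on B (e_ i) -> B t ->
  {for t, continuous (speed i)}.
Proof.
move=> oB sB Bt; apply: (@continuous_comp _ _ _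
  (fun t => dot (derive1 (e_ i) t) (derive1 (e_ i) t)) (@Num.sqrt R)).
  have sd := curve_smooth_derive1 oB sB.
  exact/continuous_derivable/(Ck_derivable (smooth_dot sd sd 0%N)).
exact: sqrt_continuous.
Qed.

Lemma speed_gt0 i t : edges G i -> edom (e_ i) t -> 0 < speed i t.
Proof. by move=> Ei it; apply: enorm_gt0; have [_ _ h _ _] := edges_smooth Ei; exact: h. Qed.

Lemma integrable_extend (D D' : set R) (h : R -> R) : measurable D -> measurable D' ->
  (forall t, D t -> ~ D' t -> h t = 0) -> D' `<=` D ->
  mu.-integrable D' (EFin \o h) -> mu.-integrable D (EFin \o h).
Proof.
move=> mD mD' h0 D'D ih.
have i' := (@integrable_mkcond _ _ _ mu D' (EFin \o h) mD').1 ih.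
apply/(@integrable_mkcond _ _ _ mu D (EFin \o h) mD); apply: eq_integrable i' => // t _.
rewrite !patchE; have [D't|nD't] := pselect (D' t).
  by rewrite !mem_set//; exact: D'D.
rewrite (memNset nD't); have [Dt|nDt] := pselect (D t); last by rewrite memNset.
by rewrite mem_set//= h0.
Qed.

(** The parameter domain may be unbounded, but by properness the integrand vanishes off a compact
    set of parameters. *)
Lemma edge_integrable (U K : set E3) (F : E3 -> R) i : edges G i -> open U ->
  continuous F -> compact K -> (forall y, ~ K y -> F y = 0) ->
  mu.-integrable (edom (e_ i)) (EFin \o edge_integrand U F i).
Proof.
move=> Ei oU cF cK F0; have [B [oB dB sB]] := edge_smooth_open Ei.
have [_ _ _ _ proper] := edges_smooth Ei.
have ce t : B t -> {for t, continuous (e_ i)}.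
  by move=> Bt; exact/derivable_continuous/(curve_smooth_derivable oB sB).
have mD := @edom_measurable R (e_ i).
have cKc := proper K cK.
have mKc : measurable (edom (e_ i) `&` e_ i @^-1` K) by exact: compact_measurable.
have ih : mu.-integrable (edom (e_ i)) (EFin \o (fun t => F (e_ i t) * speed i t)).
  apply: (integrable_extend mD mKc).
  - by move=> t Dt nK; rewrite F0 ?mul0r// => Kt; apply: nK.
  - exact: subIsetl.
  - apply: continuous_compact_integrable => //.
    apply: continuous_in_subspaceT => t; rewrite inE => -[/dB Bt _].
    apply: continuousM; last exact: speed_continuous oB sB Bt.
    by apply: continuous_comp; [exact: ce|exact: cF].
apply: le_integrable ih => //.
  apply/measurable_EFinP; apply: measurable_funM; first exact: measurable_along oB mD dB ce oU cF.
  apply: measurable_funS dB _; first exact: open_measurable.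
  apply: open_continuous_measurable_fun => // t; rewrite inE => Bt.
  exact: speed_continuous oB sB Bt.
move=> t _; rewrite lee_fin /edge_integrand -mulrA normrM indicE.
by case: (_ \in _); rewrite ?normr1 ?mul1r// normr0 mul0r.
Qed.

Lemma indic_le1 (A : set R) (H : R -> R) t : `|\1_A t * H t| <= `|H t|.
Proof.
by rewrite normrM indicE; case: (_ \in _); rewrite ?normr1 ?mul1r// normr0 mul0r.
Qed.

Lemma indic_integrable (D A : set R) (H : R -> R) : measurable D -> measurable A ->
  mu.-integrable D (EFin \o H) -> mu.-integrable D (EFin \o (fun t => \1_A t * H t)).
Proof.
move=> mD mA iH.
have mH : measurable_fun D H by apply/measurable_EFinP; exact: (measurable_int mu).
apply: le_integrable iH => //.
  by apply/measurable_EFinP/measurable_funM; first exact: measurable_indic.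
by move=> t _; rewrite lee_fin; exact: indic_le1.
Qed.

Lemma Rintegral_indic (D A : set R) (H : R -> R) : A `<=` D ->
  (\int[mu]_(t in D) (\1_A t * H t) = \int[mu]_(t in A) H t)%R.
Proof.
move=> AD; rewrite -[in RHS](setIidr AD) Rintegral_mkcondr; apply: eq_Rintegral => t _.
by rewrite patch_indic mulrC.
Qed.

Lemma arc_exceptional_finite (T : tube) (J : set nat) : tube_ok S T -> finite_set J ->
  (forall j, edges G j -> (e_ j @` edom (e_ j)) `&` tube_base T !=set0 -> J j) ->
  J `<=` edges G ->
  finite_set [set s | `[tlo T, thi T]%classic s /\
    ~ exists j t, [/\ J j, eoo (e_ j) t & e_ j t = tarc T s]].
Proof.
move=> [_ [/smooth_curve_onP[B [oB AB sx]] _ inj base] _ _ _] fJ hJ JE.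
have cb : compact (tube_base T).
  apply: continuous_compact; last exact: segment_compact.
  apply: continuous_in_subspaceT => s; rewrite inE => /AB Bs.
  exact/derivable_continuous/(curve_smooth_derivable oB sx).
pose P := (vertices G `&` tube_base T) `|`
  \bigcup_(j in J) (e_ j @` (edom (e_ j) `\` eoo (e_ j))).
have fP : finite_set P.
  rewrite finite_setU; split; first by have [] := locally_finite G cb.
  by apply: bigcup_finite => // j _; exact/finite_image/edom_eoo_finite.
(* An injective extension of the arc to the whole line, so that preimages of finite sets are finite
   and contain only parameters of the arc. *)
pose q (s : R) : E3 + R := if s \in `[tlo T, thi T] then inl (tarc T s) else inr s.
apply: (@sub_finite_set _ _ (q @^-1` (inl @` P))).
  move=> s [sI nj] /=; exists (tarc T s); last by rewrite /q ifT// inE.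
  have Ts : tube_base T (tarc T s) by exists s.
  have [[Vs|[j Ej [t jt et]]] _] := base _ Ts; first by left; split.
  right; have Jj : J j.
    by apply: hJ => //; exists (tarc T s); split=> //; exists t.
  exists j => //; exists t => //; split=> // jt'; apply: nj; exists j, t.
  by split.
apply: finite_preimage; last exact: finite_image.
move=> s s' _ _; rewrite /q; case: ifPn => sI; case: ifPn => s'I // -[] //.
by apply: inj.
Qed.

Section Arc.
Context (T : @tube R) (U K : set E3) (F : E3 -> R) (J : seq nat).
Context (okT : tube_ok S T).
Context (oU : open U).
Context (cF : continuous F).
Context (cK : compact K).
Context (F0 : forall y, ~ K y -> F y = 0).
Context (uJ : uniq J).
Context (JE : forall j, j \in J -> edges G j).

Local Notation lo := (tlo T).
Local Notation hi := (thi T).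
Local Notation x := (tarc T).
Local Notation H := (edge_integrand U F).
Let g (s : R) := \1_(~` U) (x s) * F (x s).
(** The part of edge [j] swept by the arc up to [b]. Restriction to [eoo] removes finitely many
    parameters and makes the edge parameter of a point unique. *)
Let A (j : nat) (b : R) := [set t | eoo (e_ j) t /\ exists2 s, lo <= s <= b & e_ j t = x s].
Let Aab (j : nat) (a b : R) := [set t | eoo (e_ j) t /\ exists2 s, a < s <= b & e_ j t = x s].
(* [Phi] is continuous, with zero derivative off finitely many points, hence constant. *)
Let Phi b := \sum_(j <- J) \int[mu]_(t in eoo (e_ j)) (\1_(A j b) t * H j t)
  - \int[mu]_(s in `[lo, b]) g s.

Let arc_open : exists B, [/\ open B, (forall s, lo <= s <= hi -> B s) &
  curve_smooth_on B x].
Proof.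
have [_ [/smooth_curve_onP[B [oB AB sx]] _ _ _] _ _ _] := okT.
by exists B; split=> // s sI; apply: AB; rewrite /= in_itv.
Qed.

Let arc_continuous s : lo <= s <= hi -> {for s, continuous x}.
Proof.
move=> sI; have [B [oB AB sx]] := arc_open.
exact/derivable_continuous/(curve_smooth_derivable oB sx)/AB.
Qed.

Let arc_inj s s' : lo <= s <= hi -> lo <= s' <= hi -> x s = x s' -> s = s'.
Proof.
have [_ [_ _ inj _] _ _ _] := okT => sI s'I.
by apply: inj; rewrite inE /= ?in_itv.
Qed.

Let lohi : lo < hi. Proof. by have [[]] := okT. Qed.

Let g_integrable : mu.-integrable `[lo, hi] (EFin \o g).
Proof.
have [B [oB AB sx]] := arc_open.
have ih : mu.-integrable `[lo, hi] (EFin \o (fun s => F (x s))).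
  apply: continuous_compact_integrable; first exact: segment_compact.
  apply: continuous_in_subspaceT => s; rewrite inE /= in_itv /= => sI.
  by apply: continuous_comp; [exact: arc_continuous|exact: cF].
apply: le_integrable ih => //.
  apply/measurable_EFinP; apply: (measurable_along oB _ _ _ oU cF) => //.
  by move=> s Bs; exact/derivable_continuous/(curve_smooth_derivable oB sx).
move=> s _; rewrite lee_fin /g normrM indicE.
by case: (_ \in _); rewrite ?normr1 ?mul1r// normr0 mul0r.
Qed.

Let eoo_measurable j : measurable (eoo (e_ j)).
Proof. by apply: open_measurable; exact: eoo_open. Qed.

Let A_measurable j b : j \in J -> lo <= b <= hi -> measurable (A j b).
Proof.
move=> Jj /andP[lob bhi]; have [B [oB dB sB]] := edge_smooth_open (JE Jj).
have cC : closed (x @` `[lo, b]).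
  apply: compact_closed; first exact: norm_hausdorff.
  apply: continuous_compact; last exact: segment_compact.
  apply: continuous_in_subspaceT => s; rewrite inE /= in_itv /= => /andP[h1 h2].
  by apply: arc_continuous; rewrite h1 (le_trans h2).
have -> : A j b = eoo (e_ j) `\` (eoo (e_ j) `&` e_ j @^-1` (~` (x @` `[lo, b]))).
  apply/seteqP; split=> [t [et [s sI es]]|t [et h]].
    by split=> // -[_]; apply; exists s => //=; rewrite in_itv.
  split=> //; apply: contrapT => h2; apply: h; split=> // -[s].
  by rewrite /= in_itv /= => sI es; apply: h2; exists s.
apply: measurableD => //; apply: open_measurable.
apply: open_preimage_on; [exact: eoo_open|exact: closed_openC|move=> t et].
exact/derivable_continuous/(curve_smooth_derivable oB sB)/dB/eoo_edom.
Qed.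

Let H_integrable j : j \in J -> mu.-integrable (eoo (e_ j)) (EFin \o H j).
Proof.
move=> Jj; apply: integrableS (edge_integrable (JE Jj) oU cF cK F0) => //.
- exact: edom_measurable.
- exact: eoo_measurable.
- exact: eoo_edom.
Qed.

Let fiber_finite j y : j \in J -> finite_set [set t | eoo (e_ j) t /\ e_ j t = y].
Proof.
move=> Jj; have [[t0 [et0 e0]]|nt] := pselect (exists t, eoo (e_ j) t /\ e_ j t = y).
  apply: (@sub_finite_set _ _ [set t0]); last exact: finite_set1.
  move=> t [et e1] /=; have [] // := edge_eval_inj (JE Jj) (JE Jj) et0 (eoo_edom et).
  by rewrite e0.
apply: (@sub_finite_set _ _ set0); last exact: finite_set0.
by move=> t ht; apply: nt; exists t.
Qed.

(** A parameter [t] whose point is [x s] joins [A j b] when [b] passes [s]. So membership is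
    constant for [b] near [s0] unless the point is [x s0], which holds for finitely many [t]. *)
Let Phi_continuous : {within `[lo, hi], continuous Phi}.
Proof.
have cj j : j \in J -> {within `[lo, hi], continuous
    (fun b => \int[mu]_(t in eoo (e_ j)) (\1_(A j b) t * H j t))}.
  move=> Jj; apply/within_continuousP => s0; rewrite /= in_itv /= => s0I.
  apply: (@Rintegral_family_cont R (eoo (e_ j)) (H j) (A j) `[lo, hi]
    [set t | eoo (e_ j) t /\ e_ j t = x s0]) => //.
  - exact: H_integrable.
  - by move=> b; rewrite /= in_itv /=; exact: A_measurable.
  - exact: fiber_finite.
  - move=> t et nt.
    have [[s sI es]|ns] := pselect (exists2 s, lo <= s <= hi & e_ j t = x s); last first.
      near=> b; rewrite /= in_itv /= => /andP[lob bhi]; split=> -[_ [s /andP[h1 h2] es]].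
        by exfalso; apply: ns; exists s => //; rewrite h1 (le_trans h2).
      by exfalso; apply: ns; exists s => //; rewrite h1 (le_trans h2)//; case/andP: s0I.
    have AE b : lo <= b <= hi -> A j b t <-> s <= b.
      move=> /andP[lob bhi]; split=> [[_ [s' /andP[h1 h2] es']]|sb].
        suff -> : s = s' by [].
        by apply: arc_inj => //; [rewrite h1 (le_trans h2)|rewrite -es].
      by split=> //; exists s => //; rewrite sb andbT; case/andP: sI.
    have nss : s != s0 by apply/eqP => e; apply: nt; rewrite -e.
    have d0 : 0 < `|s - s0| by rewrite normr_gt0 subr_eq0.
    exists `|s - s0| => //= b bs; rewrite in_itv /= => bI.
    by rewrite !AE//; exact: same_side.
apply/within_continuousP => s0 s0I.
suff h : {within `[lo, hi], continuous (fun b => \sum_(j <- J)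
    \int[mu]_(t in eoo (e_ j)) (\1_(A j b) t * H j t))}.
  apply: (within_continuousP _ _).1 s0I => y.
  apply: (@continuousB _ _ _ (_ : subspace `[lo, hi] -> R)); first exact: h.
  exact: (@parameterized_integral_continuous R lo hi g (ltW lohi) g_integrable).
have sub : forall j, j \in J -> j \in J by [].
elim: {1 3}J sub => [|j J' IH] sub.
  rewrite (_ : (fun _ => _) = cst 0); last by apply/funext => b; rewrite big_nil.
  by move=> y; exact: cst_continuous.
rewrite (_ : (fun _ => _) = (fun b =>
   \int[mu]_(t in eoo (e_ j)) (\1_(A j b) t * H j t) + \sum_(j <- J')
    \int[mu]_(t in eoo (e_ j)) (\1_(A j b) t * H j t))); last first.
  by apply/funext => b; rewrite big_cons.
move=> y; apply: (@continuousD _ _ _ (_ : subspace `[lo, hi] -> R)).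
  by apply: cj; apply: sub; rewrite mem_head.
by apply: IH => k kJ; apply: sub; rewrite inE kJ orbT.
Unshelve. all: by end_near.
Qed.

(* Near a point of the arc interior to the edge [i], the transition map turns
   the two integrals into each other. *)
Let Phi_derive0 i z t0 : i \in J -> lo < z < hi -> eoo (e_ i) t0 ->
  e_ i t0 = x z -> ~ boundary U (x z) -> is_derive z 1 Phi 0.
Proof.
move=> Ji zI it0 et0 nb; have Ei := JE Ji.
have [d0 [sg [phi [d00 sgE hphi]]]] := transition okT Ei zI it0 et0.
have [Be [oBe dBe sBe]] := edge_smooth_open Ei.
have near1 : \forall s \near z, \1_(~` U) (x s) = \1_(~` U) (x z) :> R.
  apply: (arc_continuous _ (indic_locally_constant nb)).
  by case/andP: zI => /ltW -> /ltW ->.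
have [d1 d10 hd1] := nbhs_itvP near1.
set c0 : R := \1_(~` U) (x z) in hd1.
pose d : R := Num.min d0 d1.
have dd0 : 0 < d by rewrite /d lt_min d00.
have hd s : z - d < s < z + d -> [/\ lo < s < hi, eoo (e_ i) (phi s), e_ i (phi s) = x s,
    is_derive s 1 phi (sg / speed i (phi s)) & \1_(~` U) (x s) = c0].
  have [dd dd'] : d <= d0 /\ d <= d1 by rewrite /d !ge_min !lexx orbT.
  move=> sd; have [|h1 h2 h3 h4] := hphi s; first exact: widen_itv dd sd.
  by split=> //; apply: hd1; exact: widen_itv dd' sd.
(* Near [z] the function is even constant: both its increments over []a, b]] are the same integral,
   over the edge and over the arc. *)
have cst_Phi a b : z - d < a -> a <= b -> b < z + d -> Phi b = Phi a.
  move=> za ab bz.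
  have dab s : a <= s <= b -> z - d < s < z + d by exact: lt_sub_itv.
  have aI : lo < a < hi by have [] := hd a (dab a _); rewrite ?lexx.
  have bI : lo < b < hi by have [] := hd b (dab b _); rewrite ?lexx ?ab.
  have aI' : lo <= a <= hi by case/andP: aI => /ltW -> /ltW ->.
  have bI' : lo <= b <= hi by case/andP: bI => /ltW -> /ltW ->.
  have sI s : a <= s <= b -> lo <= s <= hi.
    case/andP: aI => loa _; case/andP: bI => _ bhi.
    by move=> /(lt_sub_itv loa bhi) /andP[/ltW -> /ltW ->].
  have Aab_eq j t : j \in J -> \1_(A j b) t = \1_(A j a) t + \1_(Aab j a b) t :> R.
    move=> Jj; have [[et [s sab es]]|nAab] := pselect (Aab j a b t).
      rewrite !indicE (memNset (A := A j a)) ?add0r; last first.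
        move=> [_ [s' /andP[h1 h2] es']].
        have ss' : s = s'.
          apply: arc_inj; [|by rewrite h1 (le_trans h2)//; case/andP: aI'|by rewrite -es].
          by apply: sI; case/andP: sab => /ltW -> ->.
        by move: sab; rewrite ss' ltNge h2.
      rewrite !mem_set//; first by split=> //; exists s.
      split=> //; exists s => //; case/andP: sab => h1 ->; rewrite andbT.
      by apply: ltW; apply: lt_trans h1; case/andP: aI.
    rewrite !indicE (memNset nAab) addr0.
    have [Aat|nAa] := pselect (A j a t).
      rewrite !mem_set//; have [et [s /andP[h1 h2] es]] := Aat.
      by split=> //; exists s => //; rewrite h1 (le_trans h2).
    rewrite !memNset// => -[et [s /andP[h1 h2] es]].
    have [sa|as_] := leP s a; first by apply: nAa; split=> //; exists s => //; rewrite h1.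
    by apply: nAab; split=> //; exists s => //; rewrite as_.
  have mAab j : j \in J -> measurable (Aab j a b).
    move=> Jj; rewrite (_ : Aab j a b = A j b `\` A j a).
      by apply: measurableD; exact: A_measurable.
    apply/seteqP; split=> t.
      move=> ht; have := Aab_eq j t Jj; rewrite !indicE (mem_set ht).
      have [Abt|nAb] := pselect (A j b t); have [Aat|nAa] := pselect (A j a t);
        rewrite ?(mem_set Abt) ?(memNset nAb) ?(mem_set Aat) ?(memNset nAa) //=; lra.
    move=> [Abt nAa]; have := Aab_eq j t Jj; rewrite !indicE (mem_set Abt) (memNset nAa).
    by have [//|nh] := pselect (Aab j a b t); rewrite (memNset nh) /=; lra.
  have step j : j \in J -> \int[mu]_(t in eoo (e_ j)) (\1_(A j b) t * H j t) =
      \int[mu]_(t in eoo (e_ j)) (\1_(A j a) t * H j t) +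
      \int[mu]_(t in Aab j a b) H j t.
    move=> Jj; rewrite -(@Rintegral_indic (eoo (e_ j)) (Aab j a b)); last by move=> t [].
    rewrite -RintegralD//; first by apply: eq_Rintegral => t _; rewrite Aab_eq// mulrDl.
    - exact: eoo_measurable.
    - apply: indic_integrable; [exact: eoo_measurable|exact: A_measurable|exact: H_integrable].
    - apply: indic_integrable; [exact: eoo_measurable|exact: mAab|exact: H_integrable].
  have other j : j \in J -> j != i -> \int[mu]_(t in Aab j a b) H j t = 0.
    move=> Jj ji; rewrite (_ : Aab j a b = set0) ?Rintegral_set0//.
    apply/seteqP; split=> // t [et [s /andP[h1 h2] es]].
    have [|_ ep eps _ _] := hd s; first by apply: dab; rewrite h2 ltW.
    have [] := edge_eval_inj Ei (JE Jj) ep (eoo_edom et).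
      by rewrite eps.
    by move/eqP: ji.
  (* Freezing the indicator at its value [c0] near [z] gives the continuous integrand that
     substitution requires. *)
  pose Hc t := c0 * F (e_ i t) * speed i t.
  have cphi s : z - d < s < z + d -> {for s, continuous phi}.
    by move=> /hd [_ _ _ [h _] _]; exact: continuous_derivable.
  have Bphi s : z - d < s < z + d -> Be (phi s).
    by move=> /hd [_ /eoo_edom /dBe].
  have sp0 s : z - d < s < z + d -> 0 < speed i (phi s).
    by move=> /hd [_ /eoo_edom h _ _ _]; exact: speed_gt0.
  have cHc s : z - d < s < z + d -> {for phi s, continuous Hc}.
    move=> sd; have Bs := Bphi s sd.
    apply: continuousM; last exact: speed_continuous oBe sBe Bs.
    apply: continuousM; first exact: cst_continuous.
    apply: continuous_comp; last exact: cF.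
    exact/derivable_continuous/(curve_smooth_derivable oBe sBe).
  have cphi' s : z - d < s < z + d -> {for s, continuous (fun s => sg / speed i (phi s))}.
    move=> sd; apply: continuousM; first exact: cst_continuous.
    apply: continuousV; first by rewrite gt_eqF// sp0.
    apply: (@continuous_comp _ _ _ phi (speed i)); first exact: cphi.
    exact: speed_continuous oBe sBe (Bphi s sd).
  have dphi s : z - d < s < z + d -> is_derive s 1 phi (sg / speed i (phi s)).
    by move=> /hd [].
  have [incr decr] := substitution_nbhd za ab bz dphi cphi' cHc.
  (* The swept set and the image interval [[u, v]] differ at most in [phi a], since [Aab] leaves [a]
     out. *)
  have main u v : (forall t, u <= t <= v <-> exists2 s, a <= s <= b & phi s = t) ->
      \int[mu]_(t in `[u, v]) Hc t = \int[mu]_(s in `[a, b]) g s ->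
      \int[mu]_(t in Aab i a b) H i t = \int[mu]_(s in `[a, b]) g s.
    move=> uv <-; rewrite Rintegral_mkcond [RHS]Rintegral_mkcond.
    have Hphi s : a <= s <= b -> H i (phi s) = Hc (phi s).
      by move=> /dab /hd [_ _ es _ es']; rewrite /edge_integrand /Hc es es'.
    apply: (@Rintegral_eq_off_finite R setT [set phi a]) => //.
      apply/(measurable_restrictT _ _).1 => //.
      apply: subspace_continuous_measurable_fun => //.
      apply: continuous_in_subspaceT => t; rewrite inE /= in_itv /= => /uv[s /dab sd <-].
      exact: cHc.
    move=> t _ nt; rewrite !patchE.
    have [Ht|nHt] := pselect (Aab i a b t).
      have [et [s sab es]] := Ht.
      have sab' : a <= s <= b by case/andP: sab => /ltW -> ->.
      have [_ ep eps _ _] := hd s (dab s sab').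
      have [_ ts] := edge_eval_inj Ei Ei ep (eoo_edom et) (etrans es (esym eps)).
      have It : `[u, v]%classic t by rewrite /= in_itv; apply/uv; exists s.
      by rewrite !mem_set// ts Hphi.
    rewrite (memNset nHt); have [It|nIt] := pselect (`[u, v]%classic t); last by rewrite memNset.
    exfalso; apply: nHt; move: It; rewrite /= in_itv /= => /uv[s sab ts].
    have [_ ep eps _ _] := hd s (dab s sab).
    rewrite -ts; split=> //; exists s => //.
    case/andP: sab => h ->; rewrite andbT lt_neqAle h andbT.
    by apply/eqP => e; apply: nt; rewrite -ts e.
  have this : \int[mu]_(t in Aab i a b) H i t = \int[mu]_(s in `[a, b]) g s.
    have gE s : a <= s <= b -> c0 * F (e_ i (phi s)) = g s.
      by move=> /dab /hd [_ _ es _ es']; rewrite /g es es'.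
    case: sgE => sE.
    + have [|uv e] := incr; first by move=> s sd; rewrite sE mul1r invr_gt0 sp0.
      apply: main uv _; rewrite e; apply: eq_Rintegral => s; rewrite inE /= in_itv /= => sab.
      have s0 := sp0 s (dab s sab).
      by rewrite sE mul1r /Hc mulfK ?gt_eqF// gE.
    + have [|uv e] := decr; first by move=> s sd; rewrite sE mulN1r oppr_lt0 invr_gt0 sp0.
      apply: main uv _; rewrite e; apply: eq_Rintegral => s; rewrite inE /= in_itv /= => sab.
      have s0 := sp0 s (dab s sab).
      by rewrite sE mulN1r opprK /Hc mulfK ?gt_eqF// gE.
  have sum2 : \sum_(j <- J) \int[mu]_(t in Aab j a b) H j t = \int[mu]_(s in `[a, b]) g s.
    rewrite (bigD1_seq i)//= this big1_seq ?addr0// => j /andP[ji Jj].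
    exact: other.
  rewrite /Phi (eq_big_seq _ step) big_split /= sum2.
  have igb : mu.-integrable `[lo, b] (EFin \o g).
    apply: integrableS g_integrable => //.
    by apply: subset_itvl; rewrite bnd_simp; case/andP: bI'.
  have := @Rintegral_itvB R g (BLeft lo) (BRight b) a igb.
  rewrite !bnd_simp ab; case/andP: aI' => -> _ /(_ isT isT).
  rewrite Rintegral_itv_obnd_cbnd; last first.
    by apply: integrableS igb => //; apply: subset_itvr; rewrite bnd_simp; case/andP: aI => /ltW.
  by move=> <-; ring.
have zd : z - d < z < z + d by rewrite gtrBl ltrDl dd0.
have e : \forall v \near z, cst (Phi z) v = Phi v.
  apply: itv_nbhs dd0 _ => v /andP[zv vz]; rewrite /cst.
  by have [zv'|/ltW vz'] := leP z v; [apply/esym|]; apply: cst_Phi => //; case/andP: zd.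
exact: near_eq_is_derive e (is_derive_cst _ _ _).
Qed.

Lemma arc_integral :
  (forall p, S p -> boundary U p -> perpendicular_surface_at S (boundary U) p) ->
  (forall j, edges G j -> (e_ j @` edom (e_ j)) `&` tube_base T !=set0 -> j \in J) ->
  (forall y, S y -> ~ tube_base T y -> F y = 0) ->
  \int[mu]_(s in `[lo, hi]) (\1_(~` U) (x s) * F (x s)) =
  \sum_(j <- J) \int[mu]_(t in edom (e_ j)) edge_integrand U F j t.
Proof.
move=> perp hJ Fb.
have fb := boundary_finite okT perp.
have fe := @arc_exceptional_finite T [set` J] okT (finite_seq J) hJ JE.
have PhiE : Phi lo = Phi hi.
  apply: (@constant_off_seq R Phi (finmap.enum_fset (fset_set
    ([set s | `[lo, hi]%classic s /\ boundary U (x s)] `|`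
    [set s | `[lo, hi]%classic s /\
      ~ exists j t, [/\ [set` J] j, eoo (e_ j) t & e_ j t = x s]])))).
  - exact: lohi.
  - exact: Phi_continuous.
  move=> z zI nz.
  have zI' : `[lo, hi]%classic z.
    by rewrite /= in_itv /=; case/andP: zI => /ltW -> /ltW ->.
  have := nz; rewrite [_ \in _]in_fset_set; last by rewrite finite_setU.
  rewrite notin_setE => /not_orP[nb ne].
  have [[j [t [Jj et es]]]|nj] := pselect (exists j t,
    [/\ [set` J] j, eoo (e_ j) t & e_ j t = x z]); last by exfalso; apply: ne; split.
  by apply: (Phi_derive0 Jj zI et es) => b; apply: nb; split.
(* Up to [lo] the arc has swept a single point, which each edge meets at finitely many
   parameters. *)
have Philo : Phi lo = 0.
  rewrite /Phi set_itv1 Rintegral_set1 subr0 big1_seq// => j /= Jj.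
  transitivity (\int[mu]_(t in eoo (e_ j)) (cst 0 t : R)).
    apply: (@Rintegral_eq_off_finite R _ [set t | eoo (e_ j) t /\ e_ j t = x lo]) => //.
      exact: fiber_finite.
    move=> t et nt; rewrite indicE memNset ?mul0r// => -[_ [s sl es]].
    by apply: nt; split=> //; rewrite es; congr (tarc _ _); apply: le_anti; rewrite andbC.
  by have := @Rintegral_cst _ _ _ mu _ (eoo_measurable j) 0; rewrite mul0r.
move: PhiE; rewrite Philo /Phi => /esym/eqP; rewrite subr_eq0 => /eqP <-.
apply: eq_big_seq => j Jj.
(* The unswept part of an edge contributes nothing, as [F] vanishes on [S] off the arc. *)
have -> : \int[mu]_(t in eoo (e_ j)) (\1_(A j hi) t * H j t) =
    \int[mu]_(t in eoo (e_ j)) H j t.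
  apply: eq_Rintegral => t; rewrite inE => et.
  have [h|nh] := pselect (A j hi t); first by rewrite indicE mem_set// mul1r.
  rewrite indicE memNset// mul0r /edge_integrand Fb ?mulr0 ?mul0r//.
    by right; exists j; [exact: JE|exists t => //; exact: eoo_edom].
  move=> [s]; rewrite /= in_itv /= => sI es; apply: nh; split=> //; exists s => //.
rewrite -[in LHS](setIidr (@eoo_edom R (e_ j))) Rintegral_mkcondr.
apply/esym; apply: (@Rintegral_eq_off_finite R _ (edom (e_ j) `\` eoo (e_ j))).
- exact: edom_measurable.
- rewrite patch_indic; apply: measurable_funM => //.
    have := edge_integrable (JE Jj) oU cF cK F0.
    by move/(measurable_int mu)/measurable_EFinP.
- exact: edom_eoo_finite.
- move=> t et nt; rewrite patchE mem_set//.
  by apply: contrapT => h; apply: nt; split.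
Qed.

End Arc.
End ArcIntegral.

(** * The limit *)

Section ChiDelta.
Context {R : realType}.
Local Notation E3 := 'rV[R]_3.
Local Notation mu := (@lebesgue_measure R).
Context (G : topological_graph R).
Local Notation e_ := (edge_of G).
Local Notation S := (Sigma_of G).

Lemma supp_out (f : E3 -> R) y : ~ supp f y -> f y = 0.
Proof.
by move=> ns; apply/eqP; apply: contrapT => /negP fy; apply: ns; exact: subset_closure.
Qed.

Lemma tube_base_compact (T : @tube R) : tube_ok S T -> compact (tube_base T).
Proof.
move=> [_ [/smooth_curve_onP[B [oB AB sx]] _ _ _] _ _ _].
apply: continuous_compact; last exact: segment_compact.
apply: continuous_in_subspaceT => s; rewrite inE => /AB Bs.
exact/derivable_continuous/(curve_smooth_derivable oB sx).
Qed.

Definition edge_total (U : set E3) (f : E3 -> R) : R :=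
  \sum_(i \in edges G) \int[mu]_(t in edom (e_ i)) edge_integrand G U f i t.

(** Any finite list of edges containing those that meet [K] computes the total, so the list can be
    enlarged to suit several tubes at once. *)
Lemma edge_total_seq (U K : set E3) (f : E3 -> R) (J : seq nat) : uniq J ->
  (forall j, j \in J -> edges G j) -> (forall y, ~ K y -> f y = 0) ->
  (forall j, edges G j -> (e_ j @` edom (e_ j)) `&` K !=set0 -> j \in J) ->
  edge_total U f = \sum_(j <- J) \int[mu]_(t in edom (e_ j)) edge_integrand G U f j t.
Proof.
move=> uJ JE f0 KJ; rewrite /edge_total.
pose F j := \int[mu]_(t in edom (e_ j)) edge_integrand G U f j t.
rewrite -[RHS]/(\sum_(j <- J) F j).
have -> : \sum_(j <- J) F j = \sum_(j \in [set` J]) F j by exact: fsbig_seq.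
apply/esym; apply: fsbig_widen => [j Jj|j [Ej nJ]]; first exact: JE.
rewrite /= /F (@eq_Rintegral _ _ _ mu _ (fun=> 0)).
  by have := @Rintegral_cst _ _ _ mu _ (@edom_measurable R (e_ j)) 0; rewrite mul0r.
move=> t; rewrite inE => Dt; rewrite /edge_integrand f0 ?mulr0 ?mul0r// => Kt.
by apply: nJ; apply: KJ => //; exists (e_ j t); split=> //; exists t.
Qed.

Lemma Rintegral_sum (I : Type) (r : seq I) (D : set R) (F : I -> R -> R) : measurable D ->
  (forall i, mu.-integrable D (EFin \o F i)) ->
  mu.-integrable D (EFin \o (fun t => \sum_(i <- r) F i t)) /\
  \int[mu]_(t in D) (\sum_(i <- r) F i t) = \sum_(i <- r) \int[mu]_(t in D) F i t.
Proof.
move=> mD iF; elim: r => [|i r [ir IH]].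
  rewrite big_nil; under [X in EFin \o X]eq_fun do rewrite big_nil.
  split; first exact: (integrable0 mu).
  under eq_Rintegral do rewrite big_nil.
  by have := @Rintegral_cst _ _ _ mu _ mD 0; rewrite mul0r.
rewrite big_cons -IH -RintegralD//; split.
  have : mu.-integrable D ((EFin \o F i) \+ (EFin \o (fun t => (\sum_(i <- r) F i t)%R)))%E.
    exact: integrableD.
  apply: eq_integrable => // t _ /=.
  by rewrite big_cons EFinD.
by apply: eq_Rintegral => t _; rewrite big_cons.
Qed.

Section Neighbourhood.
Context (e : R) (U : set E3) (f : E3 -> R).
Context (adm : admissible_nbhd S e U) (tf : test_function f).

Lemma admissible_open : open U.
Proof.
have [[N [hN _ ->]] _ _] := adm; apply: bigcup_open => p /hN [].
by [].
Qed.

Lemma P_Sigma_sub : P_Sigma S `<=` U.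
Proof. by have [[N [hN _ ->]] _ _] := adm; move=> p Pp; exists p => //; have [] := hN p Pp. Qed.

Lemma chi_delta_value_exists : exists v, chi_delta_value S U f v.
Proof.
have cK : compact ((S `\` U) `&` supp f).
  rewrite setIC; apply: compact_closedI; first by case: tf.
  by apply: closedI; [exact: graph_closed|exact/open_closedC/admissible_open].
have [p [[Sp nU] _]|n [T [h [okT th sh hs]]]] := @tube_partition R S _ cK.
  (* A point of [S] outside [U] is smooth because [U] contains [P_Sigma]. *)
  apply: tube_exists; apply: contrapT => ns; apply: nU.
  exact: P_Sigma_sub.
by exists (\sum_(i < n) tube_integral U f (h i) (T i)), n, T, h.
Qed.

Lemma chi_delta_value_eq v : chi_delta_value S U f v -> v = edge_total U f.
Proof.
move=> [n [T [h [okT th sh hs ->]]]].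
have cK : compact (supp f) by case: tf.
(* One list for the support of [f] and for all the arcs, so that the sums over tubes and over edges
   can be exchanged. *)
pose E := [set j | edges G j /\ (e_ j @` edom (e_ j)) `&` supp f !=set0] `|`
  \bigcup_(k in [set: 'I_n]) [set j | edges G j /\
    (e_ j @` edom (e_ j)) `&` tube_base (T k) !=set0].
have fE : finite_set E.
  rewrite finite_setU; split; first by have [] := locally_finite G cK.
  apply: bigcup_finite; first exact: finite_finset.
  by move=> k _; have [] := locally_finite G (tube_base_compact (okT k)).
pose J : seq nat := finmap.enum_fset (fset_set E).
have JP j : (j \in J) = (j \in E) by rewrite [LHS]in_fset_set.
have uJ : uniq J by exact: finmap.fset_uniq.
have JE j : j \in J -> edges G j.
  by rewrite JP inE => -[[]|[k _ []]].
have cf := test_continuous tf.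
have f0 y : ~ supp f y -> f y = 0 by exact: supp_out.
rewrite (edge_total_seq (K := supp f) _ uJ JE f0); last first.
  by move=> j Ej m; rewrite JP inE; left.
have [_ _ perp] := adm.
have term k : tube_integral U f (h k) (T k) = \sum_(j <- J)
    \int[mu]_(t in edom (e_ j)) edge_integrand G U (fun y => f y * h k y) j t.
  have ch := test_continuous (th k).
  rewrite (tube_integralE (okT k) admissible_open cf ch); last exact: boundary_finite.
  apply: (@arc_integral R G (T k) U (supp f) (fun y => f y * h k y) J) => //.
  - exact: admissible_open.
  - by move=> y; apply: continuousM; [exact: cf|exact: ch].
  - by move=> y ny; rewrite f0// mul0r.
  - by move=> j Ej m; rewrite JP inE; right; exists k.
  - move=> y Sy nb; rewrite (supp_out (f := h k)) ?mulr0// => sy.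
    by apply: nb; apply: sh; split.
rewrite (eq_bigr _ (fun k _ => term k)) exchange_big /=.
apply: eq_big_seq => j Jj.
have mD := @edom_measurable R (e_ j).
have [|_ <-] := @Rintegral_sum _ (index_enum 'I_n) (edom (e_ j))
    (fun k => edge_integrand G U (fun y => f y * h k y) j) mD.
  move=> k; apply: (edge_integrable (JE j Jj) admissible_open _ cK).
    by move=> y; apply: continuousM; [exact: cf|exact/test_continuous].
  by move=> y ny; rewrite f0// mul0r.
apply: eq_Rintegral => t; rewrite inE => Dt; rewrite /edge_integrand -big_distrl /=.
rewrite -big_distrr -big_distrr /=; congr (_ * _).
(* The sum of the [h k] is known to be 1 only on [S] outside [U] and in the support of [f];
   elsewhere both sides vanish. *)
have [Ut|nUt] := pselect (U (e_ j t)).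
  by rewrite indicE memNset ?mul0r//; apply.
have [st|nst] := pselect (supp f (e_ j t)); last by rewrite f0// mul0r mulr0.
rewrite (nbhs_singleton (hs (e_ j t) _)) ?mulr1//.
by split=> //; split=> //; right; exists j; [exact: JE|exists t].
Qed.

Lemma chi_delta_eq : chi_delta S U f = edge_total U f.
Proof.
rewrite /chi_delta; case: xgetP => [v _ /chi_delta_value_eq //|nv].
by have [v hv] := chi_delta_value_exists; case: (nv v).
Qed.

End Neighbourhood.

Lemma delta_Sigma_eq f : delta_Sigma G f = edge_total set0 f.
Proof.
rewrite /delta_Sigma /edge_total; apply: eq_fsbigr => i _.
apply: eq_Rintegral => t _; rewrite /edge_integrand indicE setC0 mem_set// mul1r.
by [].
Qed.

(** A ball about the point contains no point of [P_Sigma], and [U e] stays within [e] of [P_Sigma].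
    The radius depends on [t], so convergence is only pointwise. *)
Lemma avoid_P_Sigma i t (U : R -> set E3) : edges G i -> eoo (e_ i) t ->
  exists2 r, 0 < r & forall e, 0 < e < r -> admissible_nbhd S e (U e) -> ~ U e (e_ i t).
Proof.
move=> Ei et; have /nbhs_ballP[r /= r0 hr] := P_Sigma_near_eoo Ei et.
exists r => // e /andP[e0 er] [_ Ue _] /Ue [p Pp pe].
by apply: (hr p) Pp; apply: enorm_ball; exact: lt_trans er.
Qed.

Lemma edge_limit i (U : R -> set E3) (f : E3 -> R) : edges G i ->
  admissible_family S U -> test_function f ->
  \int[mu]_(t in edom (e_ i)) edge_integrand G (U e) f i t @[e --> 0^'+] -->
  \int[mu]_(t in edom (e_ i)) edge_integrand G set0 f i t.
Proof.
move=> Ei admU tf; have cK : compact (supp f) by case: tf.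
have cf := test_continuous tf.
have [B [oB dB sB]] := edge_smooth_open Ei.
have mD := @edom_measurable R (e_ i).
have ce t : B t -> {for t, continuous (e_ i)}.
  by move=> Bt; exact/derivable_continuous/(curve_smooth_derivable oB sB).
(* The limit is recast as continuity at 0. Nothing is known of [U 0], so the value at 0 is set by
   hand to the whole edge, and [P] collects 0 with the admissible [e]. *)
pose A e := if e == 0 then edom (e_ i) else edom (e_ i) `\` (B `&` e_ i @^-1` (U e)).
pose P := [set e : R | e = 0 \/ 0 < e /\ admissible_nbhd S e (U e)].
have i0 : mu.-integrable (edom (e_ i)) (EFin \o edge_integrand G set0 f i).
  by apply: (edge_integrable Ei open0 cf cK) => y; exact: supp_out.
have := @Rintegral_family_cont R (edom (e_ i)) (edge_integrand G set0 f i) A P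
  (edom (e_ i) `\` eoo (e_ i)) 0 mD i0.
have mA b : P b -> measurable (A b).
  rewrite /A; case: eqP => // b0 [//|[_ adm]]; apply: measurableD => //.
  by apply: open_measurable; apply: open_preimage_on => //; exact: admissible_open adm.
have P0 : P 0 by left.
have near_t t : edom (e_ i) t -> ~ (edom (e_ i) `\` eoo (e_ i)) t ->
    \forall b \near 0, P b -> (A b t <-> A 0 t).
  move=> Dt nt; have et : eoo (e_ i) t by apply: contrapT => h; apply: nt.
  have [r r0 hr] := avoid_P_Sigma U Ei et.
  exists r => //= b /=; rewrite distrC subr0 => br; rewrite /A eqxx => -[->|[b0 adm]].
    by rewrite eqxx.
  rewrite gt_eqF//; split=> [[]//|_]; split=> // -[_ Ut].
  by apply: (hr b) Ut => //; rewrite b0 -(gtr0_norm b0).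
move=> /(_ mA P0 (edom_eoo_finite (e_ i)) near_t) h.
apply/cvgrPdist_lt => eps eps0.
have h1 : \forall b \near 0^'+, P b -> `|\int[mu]_(t in edom (e_ i))
    (\1_(A 0) t * edge_integrand G set0 f i t) - \int[mu]_(t in edom (e_ i))
    (\1_(A b) t * edge_integrand G set0 f i t)| < eps.
  by apply: cvg_within; exact: h.
have h2 : \forall b \near (0 : R)^'+, 0 < b by exact: nbhs_right_gt.
apply: filterS3 h1 h2 admU => b hb b0 adm.
have Pb : P b by right.
have := hb Pb; congr (`|_ - _| < _); apply: eq_Rintegral => t; rewrite inE => Dt.
  by rewrite indicE /A eqxx mem_set// mul1r.
rewrite /A gt_eqF// /edge_integrand !mulrA; congr (_ * _ * _).
rewrite setC0 !indicE in_setT mulr1; congr (_%:R).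
have [Ut|nUt] := pselect (U b (e_ i t)).
  rewrite (memNset (A := ~` U b)); last by apply.
  by rewrite memNset// => -[_]; apply; split=> //; exact: dB.
by rewrite !mem_set//; split=> // -[].
Qed.

Lemma cvg_sum_seq (I : eqType) (r : seq I) (F : set_system R) (FF : Filter F)
    (g : I -> R -> R) (l : I -> R) :
  (forall i, i \in r -> g i e @[e --> F] --> l i) ->
  \sum_(i <- r) g i e @[e --> F] --> \sum_(i <- r) l i.
Proof.
elim: r => [|i r IH] h.
  by rewrite big_nil; under eq_fun do rewrite big_nil; exact: cvg_cst.
rewrite big_cons; under eq_fun do rewrite big_cons.
apply: cvgD; first by apply: h; rewrite mem_head.
by apply: IH => j jr; apply: h; rewrite inE jr orbT.
Qed.

End ChiDelta.

Theorem theorem2 (R : realType) (G : topological_graph R)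
    (U : R -> set 'rV[R]_3) (f : 'rV[R]_3 -> R) :
  admissible_family (Sigma_of G) U ->
  test_function f ->
  (\forall e \near 0^'+, exists! v : R, chi_delta_value (Sigma_of G) (U e) f v)
  /\ chi_delta (Sigma_of G) (U e) f @[e --> 0^'+] --> delta_Sigma G f.
Proof.
move=> admU tf; split.
  apply: filterS admU => e adm; have [v hv] := chi_delta_value_exists adm tf.
  exists v; split=> // w hw.
  by rewrite (chi_delta_value_eq adm tf hv) (chi_delta_value_eq adm tf hw).
have cK : compact (supp f) by case: tf.
have [_ fJ] := locally_finite G cK.
(* This finite list does not depend on [e], so the limit can be taken edge by edge. *)
pose J : seq nat := finmap.enum_fset (fset_set [set j | edges G j /\
  (edge_of G j @` edom (edge_of G j)) `&` supp f !=set0]).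
have JP j : j \in J -> edges G j by rewrite [_ \in _]in_fset_set// inE => -[].
have total V : edge_total G V f = \sum_(j <- J)
    \int[lebesgue_measure]_(t in edom (edge_of G j)) edge_integrand G V f j t.
  apply: (@edge_total_seq R G V (supp f) f J) => //.
  - exact: finmap.fset_uniq.
  - exact: supp_out.
  - by move=> j Ej m; rewrite [_ \in _]in_fset_set// inE.
have ev : \forall e \near 0^'+, \sum_(j <- J) \int[lebesgue_measure]_(t in
    edom (edge_of G j)) edge_integrand G (U e) f j t = chi_delta (Sigma_of G) (U e) f.
  by apply: filterS admU => e adm; rewrite (chi_delta_eq adm tf) total.
apply: cvg_trans (near_eq_cvg ev) _; rewrite delta_Sigma_eq total.
by apply: cvg_sum_seq => j /JP Ej; exact: edge_limit.
Qed.
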